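(* Given a residue $\mathrm{res}\in\mathbb{C}$ and an asymptotic values invariant $\iota\in\mathcal{I}_{2,\mathrm{res}}$, the minimal number $s\in\mathbb{N}$ such that there exists a meromorphic connection on the tangent bundle of $\mathbb{CP}^1$ with $s$ simple poles, a double pole of residue $\mathrm{res}$ and invariant $\iota$, and no other pole, is: - $0$ if $\mathrm{res}=2$ and $\iota$ is centered; - $1$ if $\mathrm{res}\in\mathbb{Z}\cap[3,+\infty)$ and $\iota$ is centered; - $1$ if $\mathrm{res}\in\mathbb{C}\setminus\{2,3,\ldots\}$ and $\iota$ is not centered; - $2$ if $\mathrm{res}\in\mathbb{Z}\cap[2,+\infty)$ and $\iota$ is not centered; - $2$ if $\mathrm{res}\in\mathbb{C}\setminus\{2,3,\ldots\}$ and $\iota$ is centered.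
   Context: A meromorphic connection $\nabla$ on (the tangent bundle of) a Riemann surface is given in each holomorphic chart $R$ by a meromorphic function $\Gamma_R$ (Christoffel symbol) with $\Gamma_1=\psi'\cdot(\Gamma_2\circ\psi)+\psi''/\psi'$ for $\psi=R_2\circ R_1^{-1}$. Orders and residues of poles are chart independent; the residue $\mathrm{res}$ of $\nabla$ at a pole is the residue of $-\Gamma$. Let $p$ be a double pole (order $2$) with residue $\mathrm{res}$; in a holomorphic chart sending $p$ to $0$ write $\Gamma(z)=a_{-2}z^{-2}+\cdots$. Its repelling axis is the half-line $[0,+\infty)e^{i\theta}$ with $-a_{-2}e^{-i\theta}\in\mathbb{R}_{<0}$. Let $\tilde B$ be a universal covering of $B(0,\epsilon)\setminus\{0\}$ ($\epsilon$ small) with a lift of the argument to $\mathbb{R}$. A developing map is a holomorphic $\tilde\phi:\tilde B\to\mathbb{C}$ with nowhere vanishing derivative and $\tilde\phi''/\tilde\phi'=\Gamma$. Let $\theta_0\in\mathbb{R}$ be a lifted argument of the repelling axis and $\theta_n=\theta_0+2\pi n$. For each $n\in\mathbb{Z}$, $\tilde\phi$ converges to a complex number $u_n$, depending only on $n$, along every path in $\tilde B$ tending to $0$ with lifted argument tending to $\theta_n$. The family $(u_n)_{n\in\mathbb{Z}}$ is the asymptotic value family of $\tilde\phi$; it belongs to the set $\mathcal{U}_{2,\mathrm{res}}$ of $u\in\mathbb{C}^{\mathbb{Z}}$ for which there is $b\in\mathbb{C}$ with $u_{k+1}=e^{-2\pi i\,\mathrm{res}}u_k+b$ for all $k$. $\mathcal{I}_{2,\mathrm{res}}$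 is the quotient of $\mathcal{U}_{2,\mathrm{res}}$ by $u\sim u'$ iff some affine bijection $g$ of $\mathbb{C}$ satisfies $g(u_k)=u'_k$ for all $k$. The invariant $\iota$ of the double pole is the class of $(u_n)$, which does not depend on choices. The double pole, and its invariant $\iota$, are centered if $(u_n)$ is constant. For each $\mathrm{res}$, $\mathcal{I}_{2,\mathrm{res}}$ has exactly two elements, one centered and one not. *)

(* Defs.v *)
From Stdlib Require Import Reals ZArith List.
From Coquelicot Require Import Coquelicot.

Open Scope C_scope.

Definition Cexp (z : C) : C := (exp (Re z) * cos (Im z), exp (Re z) * sin (Im z))%R.

Definition is_Cderive (f : C -> C) (z l : C) : Prop :=
  @is_derive C_AbsRing C_NormedModule f z l.

Definition holomorphic_at (f : C -> C) (p : C) : Prop :=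
  locally p (fun z => exists l, is_Cderive f z l).

(* Near p, f - (a_1 / (z - p) + ... + a_n / (z - p)^n) extends to a holomorphic
   function. *)
Definition principal_part (f : C -> C) (p : C) (n : nat) (a : nat -> C) : Prop :=
  exists h : C -> C, holomorphic_at h p /\
    locally' p (fun z =>
      f z = h z + sum_n_m (G := C_AbelianMonoid) (fun k => a k / (z - p) ^ k) 1 n).

Definition pole (f : C -> C) (p : C) (n : nat) : Prop :=
  (1 <= n)%nat /\ exists a, principal_part f p n a /\ a n <> 0.

Definition residue (f : C -> C) (p r : C) : Prop :=
  exists n a, (1 <= n)%nat /\ principal_part f p n a /\ a 1%nat = r.

(* Meromorphic functions are total functions: their values at poles are
   irrelevant, and removable singularities are not allowed. *)
Definition meromorphic (f : C -> C) : Prop :=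
  forall p, holomorphic_at f p \/ exists n, pole f p n.

Inductive sphere : Type :=
| fin (z : C)
| infty.

(* The atlas of charts centered at the points of the sphere: z - a at a finite
   point a, and 1 / z at infinity.  Each of them maps its domain onto C. *)
Definition chart_dom (p m : sphere) : Prop :=
  match p with
  | fin _ => m <> infty
  | infty => m <> fin 0
  end.

Definition chart (p m : sphere) : C :=
  match p, m with
  | fin a, fin z => z - a
  | infty, fin z => / z
  | _, infty => 0
  end.

Definition chart_inv (p : sphere) (x : C) : sphere :=
  match p with
  | fin a => fin (x + a)
  | infty => if Ceq_dec x 0 then infty else fin (/ x)
  end.

Definition transition (p q : sphere) (x : C) : C := chart q (chart_inv p x).

(* [christoffel p] is the Christoffel symbol in the chart centered at p.  The
   transformation law is only meaningful off the poles, where values are junk. *)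
Record connection : Type := Connection {
  christoffel : sphere -> C -> C;
  christoffel_mero : forall p, meromorphic (christoffel p);
  christoffel_law : forall (p q : sphere) (x : C) (psi1 : C -> C) (psi2 : C),
    chart_dom q (chart_inv p x) ->
    holomorphic_at (christoffel p) x ->
    locally x (fun y => is_Cderive (transition p q) y (psi1 y)) ->
    is_Cderive psi1 x psi2 ->
    christoffel p x = psi1 x * christoffel q (transition p q x) + psi2 / psi1 x
}.

Definition conn_pole (nabla : connection) (p : sphere) (n : nat) : Prop :=
  pole (christoffel nabla p) 0 n.

Definition conn_residue (nabla : connection) (p : sphere) (r : C) : Prop :=
  residue (fun x => - christoffel nabla p x) 0 r.

(* The universal covering of the punctured disk B(0,eps) \ {0} is the half-plane
   Re zeta < ln eps, with projection Cexp; the lifted argument is Im. *)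
Definition in_cover (eps : R) (zeta : C) : Prop := (Re zeta < ln eps)%R.

(* d is the derivative of f at zeta with respect to z = Cexp zeta. *)
Definition is_zderive (f : C -> C) (zeta d : C) : Prop :=
  is_Cderive f zeta (d * Cexp zeta).

Definition developing_map (Gamma : C -> C) (eps : R) (phi : C -> C) : Prop :=
  exists phi1 phi2 : C -> C, forall zeta, in_cover eps zeta ->
    is_zderive phi zeta (phi1 zeta) /\ phi1 zeta <> 0 /\
    is_zderive phi1 zeta (phi2 zeta) /\
    phi2 zeta / phi1 zeta = Gamma (Cexp zeta).

(* theta is an argument of the repelling axis of a Christoffel symbol with
   leading term a2 / z^2. *)
Definition repelling_arg (a2 : C) (theta : R) : Prop :=
  let w := - a2 * Cexp (- (Ci * RtoC theta)) in Im w = 0%R /\ (Re w < 0)%R.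

(* Paths in the covering are parametrized by the real line, and tend to the
   puncture at +oo. *)
Definition asymptotic_value (eps : R) (phi : C -> C) (theta : R) (v : C) : Prop :=
  forall gamma : R -> C,
    (forall t, continuous gamma t) ->
    (forall t, in_cover eps (gamma t)) ->
    filterlim (fun t => Cexp (gamma t)) (Rbar_locally p_infty) (locally (0 : C)) ->
    filterlim (fun t => Im (gamma t)) (Rbar_locally p_infty) (locally theta) ->
    filterlim (fun t => phi (gamma t)) (Rbar_locally p_infty) (locally v).

Definition asymptotic_family (Gamma : C -> C) (u : Z -> C) : Prop :=
  exists (a : nat -> C) (eps theta0 : R) (phi : C -> C),
    principal_part Gamma 0 2 a /\
    (0 < eps)%R /\
    (forall z, z <> 0 -> (Cmod z < eps)%R -> holomorphic_at Gamma z) /\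
    developing_map Gamma eps phi /\
    repelling_arg (a 2%nat) theta0 /\
    forall n : Z, asymptotic_value eps phi (theta0 + 2 * PI * IZR n)%R (u n).

Definition U2 (res : C) (u : Z -> C) : Prop :=
  exists b : C, forall k : Z,
    u (k + 1)%Z = Cexp (- (2 * RtoC PI * Ci * res)) * u k + b.

Definition affine_equiv (u u' : Z -> C) : Prop :=
  exists a b : C, a <> 0 /\ forall k, u' k = a * u k + b.

(* The quotient of U2 by affine_equiv, as the type of equivalence classes. *)
Record I2 (res : C) : Type := MkI2 {
  I2_class : (Z -> C) -> Prop;
  I2_classP : exists u, U2 res u /\
    forall u', I2_class u' <-> U2 res u' /\ affine_equiv u u'
}.
Arguments I2_class {res} _ _.

Definition centered {res : C} (iota : I2 res) : Prop :=
  exists u, I2_class iota u /\ forall k l : Z, u k = u l.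

Definition double_pole (nabla : connection) (p : sphere) (res : C) (iota : I2 res)
  : Prop :=
  conn_pole nabla p 2 /\ conn_residue nabla p res /\
  exists u, asymptotic_family (christoffel nabla p) u /\ I2_class iota u.

Definition realizable (res : C) (iota : I2 res) (s : nat) : Prop :=
  exists (nabla : connection) (p : sphere) (l : list sphere),
    double_pole nabla p res iota /\
    NoDup l /\ length l = s /\ ~ In p l /\
    (forall q, In q l -> conn_pole nabla q 1) /\
    (forall q n, conn_pole nabla q n -> q = p \/ In q l).

Definition is_minimum (P : nat -> Prop) (s : nat) : Prop :=
  P s /\ forall t, P t -> (s <= t)%nat.

Definition integer_ge (m : Z) (z : C) : Prop :=
  exists n : Z, (m <= n)%Z /\ z = RtoC (IZR n).

(* Main.v *)
(* A Christoffel symbol on CP^1 with a double pole and at most one simple pole is explicit: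
   after subtraction of its principal parts it is entire and tends to 0 at infinity, because
   of the term psi''/psi' in the transformation law, so it vanishes by Liouville's theorem.
   In a coordinate z with the double pole at infinity and the simple one at 0, developing
   maps have derivative z^(res-2) exp(-a z), up to a constant, and there is no simple pole
   exactly when res = 2.

   If res - 2 is a natural number, such maps have the explicit form P(z) exp(-a z) + constant
   with P a polynomial, so the pole is centered.  Conversely, suppose that all the asymptotic
   values are equal to u.  Then h = (phi - u) / phi' is single valued near the double pole,
   and O(y^2) in a coordinate y centered there, by estimating phi' along suitable paths to
   the repelling axis.  The equation h' = 1 - Gamma h gives a recurrence between the Laurent
   coefficients of h, which grow factorially unless res - 2 is a natural number.

   Hence with at most one simple pole, the pole is centered if and only if res is an integer
   at least 2.  The remaining cases are realized with two simple poles: the developing map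
   z^(res-2) exp(-z) is centered for every res, and the one with derivative
   exp(-z) (z-1)^(res-1) / z is not centered for res an integer at least 2, since
   its residue at 0 is nonzero. *)
Require Import Defs.
From Stdlib Require Import Reals ZArith List Lra Lia IndefiniteDescription.
From Coquelicot Require Import Coquelicot.

Local Open Scope C_scope.

(** * Complex differentiation *)

(** All local analysis at the double pole takes place in the logarithm [zeta] of the centered
    coordinate. Complex powers become exponentials, developing maps live on a half-plane, where a
    function of zero derivative is constant, and circles become vertical segments of length
    [2 * PI], so that Goursat's theorem on rectangles is enough for means over circles. Two families
    in [U2] are affinely equivalent as soon as they agree on whether [u 1 = u 0]: no asymptotic
    value has to be computed, only centeredness has to be decided. The delicate point is the
    converse with one simple pole. The equation for [h] has a formal solution [y ^ 2 / a + ...], a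
    polynomial if [res - 2] is a natural number and divergent otherwise. Equal asymptotic values
    give a bound in all directions at once, hence Laurent coefficients, which cannot be those of a
    divergent series. In the two-pole examples, [c = res - 2] is the critical point of
    [z ^ (res - 2) * exp (- z)]; for [res] an integer the multiplier is 1, so being centered means
    that a residue vanishes. *)

Lemma locally_Cmod (p : C) (P : C -> Prop) :
  locally p P <-> exists d, 0 < d /\ forall w, Cmod (w - p) < d -> P w.
Proof.
split.
- intros H.
  destruct (locally_norm_le_locally (K := C_AbsRing) (V := C_NormedModule) p P H)
    as [d Hd].
  exists d; split; [apply cond_pos|].
  intros w Hw; exact (Hd w Hw).
- intros (d & Hd & H).
  apply (locally_le_locally_norm (K := C_AbsRing) (V := C_NormedModule) p P).
  exists (mkposreal d Hd); intros w Hw; exact (H w Hw).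
Qed.

Lemma locally'_Cmod (p : C) (P : C -> Prop) :
  locally' p P <->
  exists d, 0 < d /\ forall w, w <> p -> Cmod (w - p) < d -> P w.
Proof.
unfold locally', within; rewrite locally_Cmod.
split; intros (d & Hd & H); exists d; split; auto.
Qed.

Lemma filterlim_Cmod (f : R -> C) (l : C) :
  filterlim f (Rbar_locally p_infty) (locally l) <->
  forall e, 0 < e -> exists M, forall t, M < t -> Cmod (f t - l) < e.
Proof.
split.
- intros H e He.
  destruct (H (fun w => Cmod (w - l) < e)) as [M HM].
  + apply locally_Cmod; exists e; split; auto.
  + exists M; exact HM.
- intros H P HP.
  apply locally_Cmod in HP; destruct HP as (d & Hd & HP).
  destruct (H d Hd) as [M HM].
  exists M; intros t Ht; apply HP, HM, Ht.
Qed.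

Definition Ccont (f : C -> C) (z : C) : Prop :=
  forall e, 0 < e ->
  exists d, 0 < d /\ forall w, Cmod (w - z) < d -> Cmod (f w - f z) < e.

Lemma Cmod_minus_sym (a b : C) : Cmod (a - b) = Cmod (b - a).
Proof. rewrite <- Cmod_opp; f_equal; ring. Qed.

Lemma Cmod_minus_triangle (a b c : C) :
  Cmod (a - c) <= Cmod (a - b) + Cmod (b - c).
Proof. replace (a - c) with ((a - b) + (b - c)) by ring; apply Cmod_triangle. Qed.

Lemma Cmod_triangle_rev (a b : C) : Cmod a - Cmod b <= Cmod (a - b).
Proof.
pose proof (Cmod_triangle (a - b) b) as H.
replace (a - b + b) with a in H by ring; lra.
Qed.

Lemma Ccont_const (c z : C) : Ccont (fun _ => c) z.
Proof.
intros e He; exists 1%R; split; [lra|]; intros w _.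
replace (c - c) with (RtoC 0) by ring; now rewrite Cmod_0.
Qed.

Lemma Ccont_id (z : C) : Ccont (fun w => w) z.
Proof. intros e He; exists e; split; auto. Qed.

Lemma Ccont_continuous (f : C -> C) (z : C) :
  Ccont f z <-> continuous (T := C_UniformSpace) (U := C_NormedModule) f z.
Proof.
split.
- intros H P HP; apply locally_Cmod in HP; destruct HP as (e & He & HP).
  destruct (H e He) as (d & Hd & H'); apply locally_Cmod; exists d; split; auto.
- intros H e He; apply (locally_Cmod z (fun w => Cmod (f w - f z) < e)).
  apply (H (fun v => Cmod (v - f z) < e)), locally_Cmod; eauto.
Qed.

Lemma Ccont_plus (f g : C -> C) (z : C) :
  Ccont f z -> Ccont g z -> Ccont (fun w => f w + g w) z.
Proof. rewrite !Ccont_continuous; apply (continuous_plus (V := C_NormedModule)). Qed.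

Lemma Ccont_mult (f g : C -> C) (z : C) :
  Ccont f z -> Ccont g z -> Ccont (fun w => f w * g w) z.
Proof.
rewrite !Ccont_continuous; intros Hf.
apply (continuous_scal (V := C_NormedModule) f g).
intros P HP; apply Hf, locally_C, HP.
Qed.

Lemma Ccont_comp (f g : C -> C) (z : C) :
  Ccont g z -> Ccont f (g z) -> Ccont (fun w => f (g w)) z.
Proof.
intros Hg Hf e He.
destruct (Hf e He) as (d & Hd & H); destruct (Hg d Hd) as (d' & Hd' & H').
exists d'; split; auto.
Qed.

Lemma Ccont_inv (z : C) : z <> 0 -> Ccont Cinv z.
Proof.
intros Hz e He.
assert (Hm := proj1 (Cmod_gt_0 z) Hz); set (m := Cmod z) in *.
exists (Rmin (m / 2) (e * (m * m) / 2)).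
assert (0 < e * (m * m)) by (apply Rmult_lt_0_compat; [|apply Rmult_lt_0_compat]; lra).
split; [apply Rmin_glb_lt; lra|]; intros w Hw.
destruct (Rmin_Rgt_l _ _ _ Hw) as [H1 H2].
assert (Hwm : m / 2 < Cmod w).
{ pose proof (Cmod_triangle_rev z w) as H3; rewrite Cmod_minus_sym in H3.
  fold m in H3; lra. }
assert (Hw0 : w <> 0) by (apply Cmod_gt_0; lra).
replace (/ w - / z) with ((z - w) / (w * z)) by (field; auto).
rewrite Cmod_div by (now apply Cmult_neq_0).
rewrite Cmod_mult, Cmod_minus_sym; fold m.
apply (Rmult_lt_reg_r (Cmod w * m)); [apply Rmult_lt_0_compat; lra|].
unfold Rdiv; rewrite Rmult_assoc, Rinv_l, Rmult_1_r
  by (apply Rgt_not_eq, Rmult_lt_0_compat; lra).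
assert (e * (m / 2 * m) < e * (Cmod w * m)).
{ apply Rmult_lt_compat_l; [lra|]; apply Rmult_lt_compat_r; lra. }
lra.
Qed.

Lemma Ccont_ext_loc (f g : C -> C) (z d : _) :
  0 < d -> (forall w, Cmod (w - z) < d -> f w = g w) -> Ccont f z -> Ccont g z.
Proof.
intros Hd H Hf e He; destruct (Hf e He) as (d' & Hd' & H').
exists (Rmin d d'); split; [now apply Rmin_glb_lt|]; intros w Hw.
destruct (Rmin_Rgt_l _ _ _ Hw) as [H1 H2].
rewrite <- !H; auto.
replace (z - z) with (RtoC 0) by ring; now rewrite Cmod_0.
Qed.

Lemma is_Cderive_eps (f : C -> C) (z l : C) :
  is_Cderive f z l <->
  forall e, 0 < e -> exists d, 0 < d /\
    forall w, Cmod (w - z) < d -> Cmod (f w - f z - l * (w - z)) <= e * Cmod (w - z).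
Proof.
split.
- intros [_ H] e He.
  assert (Hf : @is_filter_lim (AbsRing_UniformSpace C_AbsRing)
    (@locally (AbsRing_UniformSpace C_AbsRing) z) z).
  { intros P HP; exact HP. }
  specialize (H z Hf (mkposreal e He)).
  apply (proj2 (locally_C z _)) in H; apply locally_Cmod in H.
  destruct H as (d & Hd & H); exists d; split; auto.
  intros w Hw; specialize (H w Hw).
  replace (f w - f z - l * (w - z)) with (f w - f z - (w - z) * l) by ring.
  exact H.
- intros H; split.
  { apply (is_linear_scal_l (K := C_AbsRing) (V := C_NormedModule) l). }
  intros x Hx e.
  assert (E : z = x).
  { apply (is_filter_lim_locally_unique (K := C_AbsRing)
      (V := AbsRing_NormedModule C_AbsRing)); exact Hx. }
  subst x.
  apply (proj1 (locally_C z _)), locally_Cmod.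
  destruct (H e (cond_pos e)) as (d & Hd & H').
  exists d; split; auto.
  intros w Hw; specialize (H' w Hw).
  replace (f w - f z - l * (w - z)) with (f w - f z - (w - z) * l) in H' by ring.
  exact H'.
Qed.

(** Carathéodory's form: [q] is the difference quotient, filled in with [l] at [z]. Product and
    chain rules then follow by algebra and continuity, without dividing by an increment that may
    vanish. *)
Lemma is_Cderive_caratheodory (f : C -> C) (z l : C) :
  is_Cderive f z l <->
  exists q, Ccont q z /\ q z = l /\ forall w, f w = f z + q w * (w - z).
Proof.
rewrite is_Cderive_eps; split.
- intros H.
  exists (fun w => if Ceq_dec w z then l else (f w - f z) / (w - z)).
  split; [|split].
  + intros e He; destruct (H (e / 2)%R ltac:(lra)) as (d & Hd & H').
    exists d; split; auto; intros w Hw.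
    destruct (Ceq_dec z z) as [_|]; [|tauto].
    destruct (Ceq_dec w z) as [E|E].
    * replace (l - l) with (RtoC 0) by ring; now rewrite Cmod_0.
    * assert (E' : w - z <> 0) by (now apply Cminus_eq_contra).
      replace ((f w - f z) / (w - z) - l) with ((f w - f z - l * (w - z)) / (w - z))
        by (now field).
      rewrite Cmod_div by auto.
      assert (Hm := proj1 (Cmod_gt_0 _) E').
      apply (Rmult_lt_reg_r (Cmod (w - z))); auto.
      unfold Rdiv at 1; rewrite Rmult_assoc, Rinv_l, Rmult_1_r by lra.
      specialize (H' w Hw).
      assert (e / 2 * Cmod (w - z) < e * Cmod (w - z))
        by (apply Rmult_lt_compat_r; lra).
      lra.
  + destruct (Ceq_dec z z); tauto.
  + intros w; destruct (Ceq_dec w z) as [->|E]; [ring|].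
    field; now apply Cminus_eq_contra.
- intros (q & Hq & <- & H) e He.
  destruct (Hq e He) as (d & Hd & H'); exists d; split; auto.
  intros w Hw; rewrite (H w).
  replace (f z + q w * (w - z) - f z - q z * (w - z)) with ((q w - q z) * (w - z)) by ring.
  rewrite Cmod_mult; apply Rmult_le_compat_r; [apply Cmod_ge_0|].
  now apply Rlt_le, H'.
Qed.

Lemma is_Cderive_eq (f : C -> C) (z l l' : C) :
  is_Cderive f z l -> l = l' -> is_Cderive f z l'.
Proof. now intros H <-. Qed.

Lemma is_Cderive_cont (f : C -> C) (z l : C) : is_Cderive f z l -> Ccont f z.
Proof.
rewrite is_Cderive_caratheodory; intros (q & Hq & _ & H).
apply (Ccont_ext_loc (fun w => f z + q w * (w - z)) f z 1); [lra|now intros|].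
apply Ccont_plus; [apply Ccont_const|].
apply Ccont_mult; auto.
apply (Ccont_plus (fun w => w) (fun _ => - z)); [apply Ccont_id|apply Ccont_const].
Qed.

Lemma is_Cderive_ext_loc (f g : C -> C) (z l : C) (d : R) :
  0 < d -> (forall w, Cmod (w - z) < d -> f w = g w) ->
  is_Cderive f z l -> is_Cderive g z l.
Proof.
intros Hd E; rewrite !is_Cderive_eps; intros H e He.
destruct (H e He) as (d' & Hd' & H').
exists (Rmin d d'); split; [now apply Rmin_glb_lt|]; intros w Hw.
destruct (Rmin_Rgt_l _ _ _ Hw) as [H1 H2].
rewrite <- !E; auto.
replace (z - z) with (RtoC 0) by ring; now rewrite Cmod_0.
Qed.

Lemma is_Cderive_ext (f g : C -> C) (z l : C) :
  (forall w, f w = g w) -> is_Cderive f z l -> is_Cderive g z l.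
Proof. intros E; apply (is_Cderive_ext_loc f g z l 1); [lra|auto]. Qed.

Lemma is_Cderive_unique (f : C -> C) (z l l' : C) :
  is_Cderive f z l -> is_Cderive f z l' -> l = l'.
Proof.
intros H H'.
rewrite <- (is_C_derive_unique _ _ _ H); now apply is_C_derive_unique.
Qed.

Lemma is_Cderive_const (c z : C) : is_Cderive (fun _ => c) z 0.
Proof. apply (is_derive_const (V := C_NormedModule)). Qed.

Lemma is_Cderive_id (z : C) : is_Cderive (fun w => w) z 1.
Proof.
apply is_Cderive_caratheodory; exists (fun _ => 1).
repeat split; [apply Ccont_const|intros w; ring].
Qed.

Lemma is_Cderive_plus (f g : C -> C) (z lf lg : C) :
  is_Cderive f z lf -> is_Cderive g z lg -> is_Cderive (fun w => f w + g w) z (lf + lg).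
Proof. apply (is_derive_plus (V := C_NormedModule)). Qed.

Lemma is_Cderive_mult (f g : C -> C) (z lf lg : C) :
  is_Cderive f z lf -> is_Cderive g z lg ->
  is_Cderive (fun w => f w * g w) z (lf * g z + f z * lg).
Proof.
intros Hf Hg; assert (Hc := is_Cderive_cont _ _ _ Hg); revert Hf Hg.
rewrite !is_Cderive_caratheodory.
intros (q & Hq & <- & H) (r & Hr & <- & H').
exists (fun w => q w * g w + f z * r w); repeat split.
- apply Ccont_plus; apply Ccont_mult; auto; apply Ccont_const.
- intros w; rewrite (H w), (H' w); ring.
Qed.

Lemma is_Cderive_comp (f g : C -> C) (z lf lg : C) :
  is_Cderive g z lg -> is_Cderive f (g z) lf -> is_Cderive (fun w => f (g w)) z (lf * lg).
Proof.
intros Hg Hf; assert (Hc := is_Cderive_cont _ _ _ Hg); revert Hf Hg.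
rewrite !is_Cderive_caratheodory.
intros (q & Hq & <- & H) (r & Hr & <- & H').
exists (fun w => q (g w) * r w); repeat split.
- apply Ccont_mult; auto; now apply Ccont_comp.
- intros w; rewrite (H (g w)), (H' w); ring.
Qed.

Lemma is_Cderive_opp (f : C -> C) (z l : C) :
  is_Cderive f z l -> is_Cderive (fun w => - f w) z (- l).
Proof. apply (is_derive_opp (V := C_NormedModule)). Qed.

Lemma is_Cderive_minus (f g : C -> C) (z lf lg : C) :
  is_Cderive f z lf -> is_Cderive g z lg -> is_Cderive (fun w => f w - g w) z (lf - lg).
Proof. intros Hf Hg; apply is_Cderive_plus; [|apply is_Cderive_opp]; auto. Qed.

Lemma is_Cderive_inv (z : C) : z <> 0 -> is_Cderive Cinv z (- / (z * z)).
Proof.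
intros Hz; apply is_Cderive_eps; intros e He.
assert (Hm := proj1 (Cmod_gt_0 z) Hz).
destruct (Ccont_inv z Hz (e * Cmod z)%R) as (d & Hd & H).
{ apply Rmult_lt_0_compat; lra. }
exists (Rmin d (Cmod z)); split; [now apply Rmin_glb_lt|]; intros w Hw.
destruct (Rmin_Rgt_l _ _ _ Hw) as [H1 H2].
assert (Hw0 : w <> 0).
{ intros ->; revert H2; replace (0 - z) with (- z) by ring; rewrite Cmod_opp; lra. }
replace (/ w - / z - - / (z * z) * (w - z)) with (- (/ w - / z) * / z * (w - z))
  by (field; auto).
rewrite !Cmod_mult, Cmod_opp, Cmod_inv by auto.
apply Rmult_le_compat_r; [apply Cmod_ge_0|].
apply (Rmult_le_reg_r (Cmod z)); auto.
rewrite Rmult_assoc, Rinv_l, Rmult_1_r by lra.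
now apply Rlt_le, H.
Qed.

Lemma is_Cderive_Cinv (f : C -> C) (z l : C) :
  f z <> 0 -> is_Cderive f z l -> is_Cderive (fun w => / f w) z (- l / (f z * f z)).
Proof.
intros Hz Hf.
eapply is_Cderive_eq; [apply (is_Cderive_comp Cinv f); [eassumption|]|].
- now apply is_Cderive_inv.
- now field.
Qed.

Lemma is_Cderive_div (f g : C -> C) (z lf lg : C) :
  g z <> 0 -> is_Cderive f z lf -> is_Cderive g z lg ->
  is_Cderive (fun w => f w / g w) z ((lf * g z - f z * lg) / (g z * g z)).
Proof.
intros Hz Hf Hg.
eapply is_Cderive_eq; [apply is_Cderive_mult; [eassumption|]|].
- apply is_Cderive_Cinv; eassumption.
- cbv beta; now field.
Qed.

Lemma is_Cderive_pow (f : C -> C) (n : nat) (z l : C) :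
  is_Cderive f z l -> is_Cderive (fun w => f w ^ n) z (RtoC (INR n) * l * f z ^ pred n).
Proof.
intros Hf; induction n as [|n IH].
- apply (is_Cderive_ext (fun _ => 1)); [reflexivity|].
  eapply is_Cderive_eq; [apply is_Cderive_const|simpl; ring].
- eapply is_Cderive_eq; [apply (is_Cderive_mult f (fun w => f w ^ n)); eassumption|].
  rewrite S_INR, RtoC_plus; destruct n as [|n]; [simpl; ring|].
  simpl pred; rewrite !Cpow_S; ring.
Qed.

(** * The complex exponential *)

Lemma re_Cexp (z : C) : Re (Cexp z) = (exp (Re z) * cos (Im z))%R.
Proof. reflexivity. Qed.

Lemma im_Cexp (z : C) : Im (Cexp z) = (exp (Re z) * sin (Im z))%R.
Proof. reflexivity. Qed.

Lemma Ceq_re_im (a b : C) : Re a = Re b -> Im a = Im b -> a = b.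
Proof. destruct a, b; simpl; now intros -> ->. Qed.

Lemma Cexp_plus (a b : C) : Cexp (a + b) = Cexp a * Cexp b.
Proof.
apply Ceq_re_im; rewrite ?re_mult, ?im_mult, !re_Cexp, !im_Cexp, re_plus, im_plus,
  exp_plus, ?cos_plus, ?sin_plus; ring.
Qed.

Lemma Cexp_0 : Cexp 0 = 1.
Proof. unfold Cexp; simpl; rewrite exp_0, cos_0, sin_0; apply Ceq_re_im; simpl; ring. Qed.

Lemma Cmod_Cexp (z : C) : Cmod (Cexp z) = exp (Re z).
Proof.
assert (H : (Cmod (Cexp z) ^ 2 = exp (Re z) ^ 2)%R).
{ rewrite Cmod2_alt, re_Cexp, im_Cexp.
  pose proof (sin2_cos2 (Im z)) as E; unfold Rsqr in E.
  replace ((exp (Re z) * cos (Im z)) ^ 2 + (exp (Re z) * sin (Im z)) ^ 2)%R with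
    (exp (Re z) ^ 2 * (sin (Im z) * sin (Im z) + cos (Im z) * cos (Im z)))%R by ring.
  rewrite E; ring. }
apply Rsqr_inj; [apply Cmod_ge_0|apply Rlt_le, exp_pos|unfold Rsqr; lra].
Qed.

Lemma Cexp_neq_0 (z : C) : Cexp z <> 0.
Proof. apply Cmod_gt_0; rewrite Cmod_Cexp; apply exp_pos. Qed.

Lemma Cexp_opp (z : C) : Cexp (- z) = / Cexp z.
Proof.
assert (H : Cexp (- z) * Cexp z = 1).
{ rewrite <- Cexp_plus; replace (- z + z) with (RtoC 0) by ring; apply Cexp_0. }
pose proof (Cexp_neq_0 z).
replace (Cexp (- z)) with (Cexp (- z) * Cexp z * / Cexp z) by (now field).
rewrite H; ring.
Qed.

Lemma abs_im_le_Cmod (z : C) : Rabs (Im z) <= Cmod z.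
Proof. eapply Rle_trans; [|apply Rmax_Cmod]; apply Rmax_r. Qed.

Lemma Cmod_le_re_im (z : C) : Cmod z <= Rabs (Re z) + Rabs (Im z).
Proof.
replace z with (RtoC (Re z) + Ci * RtoC (Im z)) at 1
  by (apply Ceq_re_im; unfold Re, Im; simpl; ring).
eapply Rle_trans; [apply Cmod_triangle|].
rewrite Cmod_mult, Cmod_Ci, !Cmod_R; lra.
Qed.

Lemma derivable_pt_lim_eps (f : R -> R) (l : R) :
  derivable_pt_lim f 0 l -> forall e, 0 < e -> exists d, 0 < d /\
  forall h, Rabs h < d -> Rabs (f h - f 0 - l * h) <= e * Rabs h.
Proof.
intros H e He; destruct (H e He) as [d Hd]; exists d; split; [apply cond_pos|].
intros h Hh; destruct (Req_dec h 0) as [->|E].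
- replace (f 0 - f 0 - l * 0)%R with 0%R by ring; rewrite Rabs_R0; lra.
- specialize (Hd h E Hh); rewrite Rplus_0_l in Hd.
  replace (f h - f 0 - l * h)%R with (((f h - f 0) / h - l) * h)%R by (field; auto).
  rewrite Rabs_mult; apply Rmult_le_compat_r; [apply Rabs_pos|lra].
Qed.

Lemma is_Cderive_Cexp_0 : is_Cderive Cexp 0 1.
Proof.
apply is_Cderive_eps; intros e He.
(* The real and imaginary parts of the remainder will cost [4 * e' * m] and [5 * e' * m], so 16 is
   ample; together with [m < 1], [e' <= 1] keeps [exp x] below 3. *)
set (e' := Rmin 1 (e / 16)).
assert (He' : 0 < e') by (apply Rmin_glb_lt; lra).
assert (Hle : e' <= e / 16) by apply Rmin_r.
destruct (derivable_pt_lim_eps exp 1 derivable_pt_lim_exp_0 e' He') as (d1 & Hd1 & H1).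
pose proof (derivable_pt_lim_cos 0) as Hc; rewrite sin_0, Ropp_0 in Hc.
destruct (derivable_pt_lim_eps cos 0 Hc e' He') as (d2 & Hd2 & H2).
pose proof (derivable_pt_lim_sin 0) as Hs; rewrite cos_0 in Hs.
destruct (derivable_pt_lim_eps sin 1 Hs e' He') as (d3 & Hd3 & H3).
exists (Rmin (Rmin 1 e') (Rmin d1 (Rmin d2 d3))).
split; [repeat apply Rmin_glb_lt; lra|]; intros w Hw.
replace (w - 0) with w in * by ring.
assert (E := Rlt_le_trans _ _ _ Hw (Rmin_l _ _)).
assert (Hw0 := Rlt_le_trans _ _ _ E (Rmin_l _ _)).
assert (Hwe := Rlt_le_trans _ _ _ E (Rmin_r _ _)); clear E.
assert (E := Rlt_le_trans _ _ _ Hw (Rmin_r _ _)).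
destruct (Rmin_Rgt_l _ _ _ E) as [Hw1 E'].
assert (Hw2 := Rlt_le_trans _ _ _ E' (Rmin_l _ _)).
assert (Hw3 := Rlt_le_trans _ _ _ E' (Rmin_r _ _)); clear E E'.
pose proof (re_le_Cmod w) as Hre; pose proof (abs_im_le_Cmod w) as Him.
specialize (H1 (Re w) ltac:(lra)); rewrite exp_0 in H1.
specialize (H2 (Im w) ltac:(lra)); rewrite cos_0 in H2.
specialize (H3 (Im w) ltac:(lra)); rewrite sin_0 in H3.
rewrite Cexp_0, Cmult_1_l.
set (m := Cmod w) in *; set (x := Re w) in *; set (y := Im w) in *.
assert (Hm : 0 <= m) by apply Cmod_ge_0.
assert (He1 : e' <= 1) by apply Rmin_l.
assert (X1 : e' * Rabs x <= e' * m) by (apply Rmult_le_compat_l; lra).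
assert (Y1 : e' * Rabs y <= e' * m) by (apply Rmult_le_compat_l; lra).
assert (M1 : e' * m <= m) by (rewrite <- (Rmult_1_l m) at 2; apply Rmult_le_compat_r; lra).
assert (Hex : Rabs (exp x - 1) <= 2 * m).
{ replace (exp x - 1)%R with ((exp x - 1 - 1 * x) + x)%R by ring.
  eapply Rle_trans; [apply Rabs_triang|]; lra. }
assert (Hex3 : Rabs (exp x) <= 3).
{ replace (exp x)%R with ((exp x - 1) + 1)%R by ring.
  eapply Rle_trans; [apply Rabs_triang|]; rewrite Rabs_R1; lra. }
eapply Rle_trans; [apply Cmod_le_re_im|].
assert (R1 : Rabs (Re (Cexp w - 1 - w)) <= 4 * e' * m).
{ replace (Re (Cexp w - 1 - w)) with (exp x * (cos y - 1 - 0 * y) + (exp x - 1 - 1 * x))%R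
    by (unfold Cminus; rewrite !re_plus, !re_opp, re_Cexp, re_RtoC; fold x y; ring).
  eapply Rle_trans; [apply Rabs_triang|]; rewrite Rabs_mult.
  assert (Rabs (exp x) * Rabs (cos y - 1 - 0 * y) <= 3 * (e' * m)).
  { apply Rmult_le_compat; try apply Rabs_pos; lra. }
  lra. }
assert (R2 : Rabs (Im (Cexp w - 1 - w)) <= 5 * e' * m).
{ replace (Im (Cexp w - 1 - w)) with ((exp x - 1) * y + exp x * (sin y - 0 - 1 * y))%R.
  2:{ unfold Cminus; rewrite !im_plus, !im_opp, im_Cexp, im_RtoC; fold x y; ring. }
  eapply Rle_trans; [apply Rabs_triang|]; rewrite !Rabs_mult.
  assert (Rabs (exp x) * Rabs (sin y - 0 - 1 * y) <= 3 * (e' * m)).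
  { apply Rmult_le_compat; try apply Rabs_pos; lra. }
  assert (Rabs (exp x - 1) * Rabs y <= 2 * m * e').
  { apply Rmult_le_compat; try apply Rabs_pos; lra. }
  lra. }
assert (e' * m <= e / 16 * m) by (apply Rmult_le_compat_r; lra).
assert (0 <= e * m) by (apply Rmult_le_pos; lra).
lra.
Qed.

Lemma is_Cderive_Cexp (z : C) : is_Cderive Cexp z (Cexp z).
Proof.
apply (is_Cderive_ext (fun w => Cexp z * Cexp (w - z))).
{ intros w; rewrite <- Cexp_plus; f_equal; ring. }
eapply is_Cderive_eq.
- apply is_Cderive_mult; [apply is_Cderive_const|].
  apply (is_Cderive_comp Cexp (fun w => w - z)).
  + apply is_Cderive_minus; [apply is_Cderive_id|apply is_Cderive_const].
  + replace (z - z) with (RtoC 0) by ring; apply is_Cderive_Cexp_0.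
- cbv beta; ring.
Qed.

Lemma is_Cderive_exp (f : C -> C) (z l : C) :
  is_Cderive f z l -> is_Cderive (fun w => Cexp (f w)) z (Cexp (f z) * l).
Proof. intros H; apply (is_Cderive_comp Cexp f); [auto|apply is_Cderive_Cexp]. Qed.

(* Goals left open: denominators are nonzero, derivatives of functions without hypothesis. *)
Ltac Cderive := lazymatch goal with
  | |- is_Cderive (fun _ => ?c) _ _ => apply is_Cderive_const
  | |- is_Cderive (fun z => z) _ _ => apply is_Cderive_id
  | |- is_Cderive (fun z => @?f z + @?g z) _ _ => apply (is_Cderive_plus f g); Cderive
  | |- is_Cderive (fun z => @?f z - @?g z) _ _ => apply (is_Cderive_minus f g); Cderive
  | |- is_Cderive (fun z => - @?f z) _ _ => apply (is_Cderive_opp f); Cderive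
  | |- is_Cderive (fun z => @?f z * @?g z) _ _ => apply (is_Cderive_mult f g); Cderive
  | |- is_Cderive (fun z => @?f z / @?g z) _ _ => apply (is_Cderive_div f g); Cderive
  | |- is_Cderive (fun z => / @?f z) _ _ => apply (is_Cderive_Cinv f); Cderive
  | |- is_Cderive (fun z => @?f z ^ ?n) _ _ => apply (is_Cderive_pow f n); Cderive
  | |- is_Cderive (fun z => Cexp (@?f z)) _ _ => apply (is_Cderive_exp f); Cderive
  | |- is_Cderive _ _ _ => try eassumption
  | _ => idtac
  end.

Lemma Cexp_2PI : Cexp (2 * RtoC PI * Ci) = 1.
Proof.
assert (E : 2 * RtoC PI * Ci = (0, 2 * PI)%R)
  by (apply Ceq_re_im; unfold Re, Im; simpl; ring).
rewrite E; apply Ceq_re_im; rewrite ?re_Cexp, ?im_Cexp; unfold Re, Im; simpl;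
  rewrite exp_0, ?cos_2PI, ?sin_2PI; ring.
Qed.

Lemma Cexp_pow (z : C) (n : nat) : Cexp z ^ n = Cexp (RtoC (INR n) * z).
Proof.
induction n as [|n IH].
- simpl; now rewrite Cmult_0_l, Cexp_0.
- rewrite Cpow_S, IH, <- Cexp_plus, S_INR, RtoC_plus; f_equal; ring.
Qed.

(** * Curves with a real parameter and the mean value inequality *)

Definition is_Rderive (f : R -> C) (t : R) (l : C) : Prop :=
  is_derive (K := R_AbsRing) (V := C_R_NormedModule) f t l.

Lemma is_derive_curve_eps (f : R -> C) (t : R) (l : C) :
  is_Rderive f t l <->
  forall e, 0 < e -> exists d, 0 < d /\ forall s, Rabs (s - t) < d ->
    Cmod (f s - f t - RtoC (s - t) * l) <= e * Rabs (s - t).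
Proof.
split.
- intros [_ H] e He.
  assert (Ht : is_filter_lim (locally t) t) by (intros P HP; exact HP).
  destruct (H t Ht (mkposreal e He)) as [d Hd].
  exists d; split; [apply cond_pos|]; intros s Hs; specialize (Hd s Hs).
  replace (RtoC (s - t) * l) with
    (@scal R_Ring C_R_ModuleSpace (s - t)%R l) by apply scal_R_Cmult.
  rewrite Cmod_norm; exact Hd.
- intros H; split.
  { apply (is_linear_scal_l (K := R_AbsRing) (V := C_R_NormedModule) l). }
  intros x Hx e.
  assert (E : t = x).
  { apply (is_filter_lim_locally_unique (K := R_AbsRing) (V := R_NormedModule)); exact Hx. }
  subst x.
  destruct (H e (cond_pos e)) as (d & Hd & H').
  exists (mkposreal d Hd); intros s Hs; specialize (H' s Hs).
  replace (RtoC (s - t) * l) with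
    (@scal R_Ring C_R_ModuleSpace (s - t)%R l) in H' by apply scal_R_Cmult.
  rewrite Cmod_norm in H'; exact H'.
Qed.

Lemma is_derive_line (F : C -> C) (z v l : C) (t : R) :
  is_Cderive F (z + RtoC t * v) l ->
  is_Rderive
    (fun s : R => F (z + RtoC s * v)) t (l * v).
Proof.
rewrite is_Cderive_eps, is_derive_curve_eps; intros H e He.
assert (Hv : 0 <= Cmod v) by apply Cmod_ge_0.
destruct (H (e / (Cmod v + 1))%R) as (d & Hd & H').
{ apply Rdiv_lt_0_compat; lra. }
exists (d / (Cmod v + 1))%R; split; [apply Rdiv_lt_0_compat; lra|]; intros s Hs.
assert (E : z + RtoC s * v - (z + RtoC t * v) = RtoC (s - t) * v)
  by (rewrite RtoC_minus; ring).
specialize (H' (z + RtoC s * v)); rewrite E in H'.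
replace (RtoC (s - t) * (l * v)) with (l * (RtoC (s - t) * v)) by ring.
rewrite Cmod_mult, Cmod_R in H'.
assert (Hs' : Rabs (s - t) * (Cmod v + 1) < d).
{ apply (Rmult_lt_compat_r (Cmod v + 1)) in Hs; [|lra].
  unfold Rdiv in Hs; rewrite Rmult_assoc, Rinv_l in Hs; lra. }
pose proof (Rabs_pos (s - t)) as Hp.
eapply Rle_trans; [apply H'; nra|].
assert (e / (Cmod v + 1) * (Cmod v + 1) = e)%R by (field; lra).
assert (0 < e / (Cmod v + 1)) by (apply Rdiv_lt_0_compat; lra).
nra.
Qed.

Lemma is_derive_re (f : R -> C) (t : R) (l : C) :
  is_Rderive f t l ->
  is_derive (fun s => Re (f s)) t (Re l).
Proof.
intros H.
apply (filterdiff_comp f (fst : C_R_NormedModule -> R_NormedModule)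
  (fun y : R => scal y l) fst) in H; [exact H|].
apply filterdiff_linear; apply is_linear_fst.
Qed.

Lemma is_derive_im (f : R -> C) (t : R) (l : C) :
  is_Rderive f t l ->
  is_derive (fun s => Im (f s)) t (Im l).
Proof.
intros H.
apply (filterdiff_comp f (snd : C_R_NormedModule -> R_NormedModule)
  (fun y : R => scal y l) snd) in H; [exact H|].
apply filterdiff_linear; apply is_linear_snd.
Qed.

Lemma is_derive_Cmult_l (f : R -> C) (t : R) (c l : C) :
  is_Rderive f t l ->
  is_Rderive (fun s => c * f s) t (c * l).
Proof.
rewrite !is_derive_curve_eps; intros H e He.
pose proof (Cmod_ge_0 c) as Hc.
destruct (H (e / (Cmod c + 1))%R) as (d & Hd & H').
{ apply Rdiv_lt_0_compat; lra. }
exists d; split; auto; intros s Hs; specialize (H' s Hs).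
replace (c * f s - c * f t - RtoC (s - t) * (c * l)) with
  (c * (f s - f t - RtoC (s - t) * l)) by ring.
rewrite Cmod_mult; pose proof (Rabs_pos (s - t)).
assert (e / (Cmod c + 1) * (Cmod c + 1) = e)%R by (field; lra).
assert (0 < e / (Cmod c + 1)) by (apply Rdiv_lt_0_compat; lra).
apply Rle_trans with (Cmod c * (e / (Cmod c + 1) * Rabs (s - t)))%R.
- now apply Rmult_le_compat_l.
- nra.
Qed.

Lemma derive_nonincreasing (f df : R -> R) (a b : R) :
  a <= b ->
  (forall t, a <= t <= b -> is_derive f t (df t)) ->
  (forall t, a <= t <= b -> df t <= 0) -> f b <= f a.
Proof.
intros Hab Hf Hd.
destruct (MVT_gen f a b df) as (c & Hc & E).
- rewrite Rmin_left, Rmax_right by auto; intros x Hx; apply Hf; lra.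
- rewrite Rmin_left, Rmax_right by auto; intros x Hx.
  apply (continuity_pt_filterlim f x), (ex_derive_continuous f x).
  exists (df x); apply Hf; lra.
- rewrite Rmin_left, Rmax_right in Hc by auto.
  specialize (Hd c Hc); nra.
Qed.

(** The modulus is the largest real part of the rotated values [e * z], attained at
    [e = Cconj z / Cmod z]. This reduces estimates on complex curves to real functions. *)
Lemma Cmod_le_of_Re (z : C) (M : R) :
  (forall e : C, Cmod e = 1%R -> Re (e * z) <= M) -> Cmod z <= M.
Proof.
intros H; destruct (Ceq_dec z 0) as [->|Hz].
- rewrite Cmod_0; specialize (H 1 Cmod_1); rewrite Cmult_0_r in H; exact H.
- assert (Hm := proj1 (Cmod_gt_0 z) Hz).
  specialize (H (Cconj z / RtoC (Cmod z))).
  rewrite Cmod_div, Cmod_conj, Cmod_R, Rabs_right in H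
    by (try lra; intros E; apply RtoC_inj in E; lra).
  assert (E : Cconj z / RtoC (Cmod z) * z = RtoC (Cmod z)).
  { replace (Cconj z / RtoC (Cmod z) * z) with (z * Cconj z / RtoC (Cmod z))
      by (field; intros E; apply RtoC_inj in E; lra).
    rewrite <- Cmod2_conj, RtoC_pow; field; intros E; apply RtoC_inj in E; lra. }
  rewrite E, re_RtoC in H; apply H; field; lra.
Qed.

(** For each unit [e], the real function [Re (e * f) - g] is nonincreasing; [Cmod_le_of_Re] then
    gives the modulus. *)
Lemma mean_value_inequality (f df : R -> C) (g dg : R -> R) (a b : R) :
  a <= b ->
  (forall t, a <= t <= b ->
    is_Rderive f t (df t)) ->
  (forall t, a <= t <= b -> is_derive g t (dg t)) ->
  (forall t, a <= t <= b -> Cmod (df t) <= dg t) ->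
  Cmod (f b - f a) <= g b - g a.
Proof.
intros Hab Hf Hg Hd; apply Cmod_le_of_Re; intros e He.
assert (H : (Re (e * f b) - g b <= Re (e * f a) - g a)%R).
{ apply (derive_nonincreasing (fun t => Re (e * f t) - g t)%R
    (fun t => Re (e * df t) - dg t)%R); auto.
  - intros t Ht; apply (is_derive_minus (fun t => Re (e * f t)) g); [|auto].
    apply (is_derive_re (fun t => e * f t)), is_derive_Cmult_l; auto.
  - intros t Ht; pose proof (re_le_Cmod (e * df t)) as H.
    rewrite Cmod_mult, He in H; specialize (Hd t Ht).
    pose proof (Rle_abs (Re (e * df t))); lra. }
replace (e * (f b - f a)) with (e * f b + - (e * f a)) by ring.
rewrite re_plus, re_opp; lra.
Qed.

Lemma line_mean_value (F dF : C -> C) (z w : C) (M : R) :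
  (forall t, 0 <= t <= 1 -> is_Cderive F (z + RtoC t * (w - z)) (dF (z + RtoC t * (w - z)))) ->
  (forall t, 0 <= t <= 1 -> Cmod (dF (z + RtoC t * (w - z))) <= M) ->
  Cmod (F w - F z) <= M * Cmod (w - z).
Proof.
intros Hd HM.
pose proof (mean_value_inequality (fun t => F (z + RtoC t * (w - z)))
  (fun t => dF (z + RtoC t * (w - z)) * (w - z))
  (fun t => M * Cmod (w - z) * t)%R (fun _ => M * Cmod (w - z))%R 0 1) as H.
cbv beta in H.
replace (z + 1 * (w - z)) with w in H by ring.
replace (z + 0 * (w - z)) with z in H by ring.
rewrite Rmult_1_r, Rmult_0_r, Rminus_0_r in H; apply H; [lra| | |].
- intros t Ht; apply is_derive_line; auto.
- intros t _; auto_derive; auto; ring.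
- intros t Ht; rewrite Cmod_mult; apply Rmult_le_compat_r; [apply Cmod_ge_0|auto].
Qed.

(** * Goursat, the mean value property and Liouville *)

Definition Rcont (f : R -> C) (t : R) : Prop :=
  continuous (U := C_R_NormedModule) f t.

Lemma Rcont_eps (f : R -> C) (t : R) :
  Rcont f t <-> forall e, 0 < e -> exists d, 0 < d /\
    forall s, Rabs (s - t) < d -> Cmod (f s - f t) < e.
Proof.
split.
- intros H e He.
  destruct (H (fun w => Cmod (w - f t) < e)) as [d Hd].
  { apply locally_Cmod; exists e; auto. }
  exists d; split; [apply cond_pos|exact Hd].
- intros H P HP; apply locally_Cmod in HP; destruct HP as (e & He & HP).
  destruct (H e He) as (d & Hd & H'); exists (mkposreal d Hd); intros s Hs.
  apply HP, H'; exact Hs.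
Qed.

Lemma Rcont_line (F : C -> C) (z v : C) (t : R) :
  Ccont F (z + RtoC t * v) -> Rcont (fun s => F (z + RtoC s * v)) t.
Proof.
intros H; apply Rcont_eps; intros e He.
destruct (H e He) as (d & Hd & H').
pose proof (Cmod_ge_0 v).
exists (d / (Cmod v + 1))%R; split; [apply Rdiv_lt_0_compat; lra|]; intros s Hs.
apply H'.
replace (z + RtoC s * v - (z + RtoC t * v)) with (RtoC (s - t) * v)
  by (rewrite RtoC_minus; ring).
rewrite Cmod_mult, Cmod_R.
apply (Rmult_lt_compat_r (Cmod v + 1)) in Hs; [|lra].
unfold Rdiv in Hs; rewrite Rmult_assoc, Rinv_l, Rmult_1_r in Hs by lra.
pose proof (Rabs_pos (s - t)); nra.
Qed.

Definition CInt (f : R -> C) (a b : R) : C := RInt (V := C_R_CompleteNormedModule) f a b.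

Definition ex_CInt (f : R -> C) (a b : R) : Prop :=
  ex_RInt (V := C_R_NormedModule) f a b.

Lemma ex_CInt_Rcont (f : R -> C) (a b : R) : (forall t, Rcont f t) -> ex_CInt f a b.
Proof. intros H; apply (ex_RInt_continuous (V := C_R_CompleteNormedModule)); intros t _; apply H. Qed.

Lemma CInt_ext (f g : R -> C) (a b : R) : (forall t, f t = g t) -> CInt f a b = CInt g a b.
Proof. intros H; apply (RInt_ext (V := C_R_CompleteNormedModule)); intros t _; apply H. Qed.

Lemma CInt_Chasles (f : R -> C) (a b c : R) :
  (forall t, Rcont f t) -> CInt f a c = CInt f a b + CInt f b c.
Proof.
intros H; symmetry.
apply (RInt_Chasles (V := C_R_CompleteNormedModule)); now apply ex_CInt_Rcont.
Qed.

Lemma CInt_plus (f g : R -> C) (a b : R) :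
  (forall t, Rcont f t) -> (forall t, Rcont g t) ->
  CInt (fun t => f t + g t) a b = CInt f a b + CInt g a b.
Proof.
intros Hf Hg.
apply (RInt_plus (V := C_R_CompleteNormedModule)); now apply ex_CInt_Rcont.
Qed.

(** The integral is linear over the reals only; a complex factor mixes the two components, which are
    therefore integrated separately. *)
Lemma CInt_Cmult_l (f : R -> C) (c : C) (a b : R) :
  (forall t, Rcont f t) -> CInt (fun t => c * f t) a b = c * CInt f a b.
Proof.
intros Hf.
assert (H : is_RInt (V := C_R_NormedModule) f a b (CInt f a b)).
{ apply (RInt_correct (V := C_R_CompleteNormedModule)); now apply ex_CInt_Rcont. }
assert (H1 := is_RInt_fct_extend_fst (U := R_NormedModule) (V := R_NormedModule) _ _ _ _ H).
assert (H2 := is_RInt_fct_extend_snd (U := R_NormedModule) (V := R_NormedModule) _ _ _ _ H).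
apply (is_RInt_unique (V := C_R_CompleteNormedModule)).
apply (is_RInt_fct_extend_pair (U := R_NormedModule) (V := R_NormedModule)).
- apply (is_RInt_minus (V := R_NormedModule) (fun t => scal (fst c) (fst (f t)))
    (fun t => scal (snd c) (snd (f t))));
    now apply (is_RInt_scal (V := R_NormedModule)).
- apply (is_RInt_plus (V := R_NormedModule) (fun t => scal (fst c) (snd (f t)))
    (fun t => scal (snd c) (fst (f t))));
    now apply (is_RInt_scal (V := R_NormedModule)).
Qed.

Lemma CInt_bound (f : R -> C) (a b M : R) :
  a <= b -> (forall t, Rcont f t) -> (forall t, a <= t <= b -> Cmod (f t) <= M) ->
  Cmod (CInt f a b) <= (b - a) * M.
Proof.
intros Hab Hf HM; rewrite Cmod_norm.
apply (norm_RInt_le_const (V := C_R_NormedModule) f a b); auto.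
- intros t Ht; specialize (HM t Ht); rewrite Cmod_norm in HM; exact HM.
- apply (RInt_correct (V := C_R_CompleteNormedModule)); now apply ex_CInt_Rcont.
Qed.

Lemma CInt_derive (f df : R -> C) (a b : R) :
  (forall t, is_Rderive f t (df t)) ->
  (forall t, Rcont df t) -> CInt df a b = f b - f a.
Proof.
intros Hf Hd; apply (is_RInt_unique (V := C_R_CompleteNormedModule)).
apply (is_RInt_derive (V := C_R_CompleteNormedModule) f df); intros t _; [apply Hf|apply Hd].
Qed.

Lemma CInt_const (c : C) (a b : R) : CInt (fun _ => c) a b = RtoC (b - a) * c.
Proof.
unfold CInt; rewrite (RInt_const (V := C_R_CompleteNormedModule)); apply scal_R_Cmult.
Qed.

(** * Boundary integrals over rectangles and Goursat's theorem *)

Definition entire (f : C -> C) : Prop := forall z, exists l, is_Cderive f z l.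

Lemma entire_cont (f : C -> C) (z : C) : entire f -> Ccont f z.
Proof. intros H; destruct (H z) as [l Hl]; exact (is_Cderive_cont _ _ _ Hl). Qed.

Lemma pair_h (x y : R) : (x, y) = (0, y)%R + RtoC x * 1.
Proof. apply Ceq_re_im; unfold Re, Im; simpl; ring. Qed.

Lemma pair_v (x y : R) : (x, y) = RtoC x + RtoC y * Ci.
Proof. apply Ceq_re_im; unfold Re, Im; simpl; ring. Qed.

Lemma Rcont_h (F : C -> C) (y t : R) :
  Ccont F (t, y) -> Rcont (fun x => F (x, y)) t.
Proof.
rewrite pair_h; intros H; apply Rcont_line in H; revert H.
apply continuous_ext; intros s; now rewrite (pair_h s).
Qed.

Lemma Rcont_v (F : C -> C) (x t : R) :
  Ccont F (x, t) -> Rcont (fun y => F (x, y)) t.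
Proof.
rewrite pair_v; intros H; apply Rcont_line in H; revert H.
apply continuous_ext; intros s; now rewrite (pair_v x s).
Qed.

(** Counterclockwise integral of [F dz] over the boundary of the rectangle with corners [(a, c)] and
    [(b, d)]; the factor [Ci] is [dz / dy] on vertical sides. *)
Definition rect_int (F : C -> C) (a b c d : R) : C :=
  CInt (fun x => F (x, c)) a b + Ci * CInt (fun y => F (b, y)) c d
  - CInt (fun x => F (x, d)) a b - Ci * CInt (fun y => F (a, y)) c d.

Lemma rect_int_split (F : C -> C) (a m b c n d : R) :
  (forall z, Ccont F z) ->
  rect_int F a b c d = rect_int F a m c n + rect_int F m b c n
    + rect_int F a m n d + rect_int F m b n d.
Proof.
intros HF; unfold rect_int.
rewrite (CInt_Chasles (fun x => F (x, c)) a m b), (CInt_Chasles (fun x => F (x, d)) a m b),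
  (CInt_Chasles (fun y => F (a, y)) c n d), (CInt_Chasles (fun y => F (b, y)) c n d)
  by (intros t; first [now apply Rcont_h | now apply Rcont_v]).
ring.
Qed.

Lemma rect_int_ext (F G : C -> C) (a b c d : R) :
  (forall z, F z = G z) -> rect_int F a b c d = rect_int G a b c d.
Proof.
intros H; unfold rect_int.
rewrite (CInt_ext (fun x => F (x, c)) (fun x => G (x, c))),
  (CInt_ext (fun x => F (x, d)) (fun x => G (x, d))),
  (CInt_ext (fun y => F (a, y)) (fun y => G (a, y))),
  (CInt_ext (fun y => F (b, y)) (fun y => G (b, y))) by (intros t; apply H).
reflexivity.
Qed.

Lemma rect_int_plus (F G : C -> C) (a b c d : R) :
  (forall z, Ccont F z) -> (forall z, Ccont G z) ->
  rect_int (fun z => F z + G z) a b c d = rect_int F a b c d + rect_int G a b c d.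
Proof.
intros HF HG; unfold rect_int.
rewrite !(fun x => CInt_plus (fun y => F (x, y)) (fun y => G (x, y))),
  !(fun y => CInt_plus (fun x => F (x, y)) (fun x => G (x, y)))
  by (intros t; first [now apply Rcont_h | now apply Rcont_v]).
ring.
Qed.

Lemma is_derive_h (P : C -> C) (x y : R) (l : C) :
  is_Cderive P (x, y) l ->
  is_Rderive (fun t => P (t, y)) x l.
Proof.
rewrite pair_h; intros H; apply is_derive_line in H; rewrite Cmult_1_r in H.
revert H; apply is_derive_ext; intros t; f_equal; symmetry; exact (pair_h t y).
Qed.

Lemma is_derive_v (P : C -> C) (x y : R) (l : C) :
  is_Cderive P (x, y) l ->
  is_Rderive (fun t => P (x, t)) y (l * Ci).
Proof.
rewrite pair_v; intros H; apply is_derive_line in H.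
revert H; apply is_derive_ext; intros t; f_equal; symmetry; exact (pair_v x t).
Qed.

Lemma CInt_h_primitive (P F : C -> C) (y a b : R) :
  (forall z, Ccont F z) -> (forall z, is_Cderive P z (F z)) ->
  CInt (fun x => F (x, y)) a b = P (b, y) - P (a, y).
Proof.
intros HF HP; apply (CInt_derive (fun x => P (x, y))); intros t.
- now apply is_derive_h.
- now apply Rcont_h.
Qed.

Lemma CInt_v_primitive (P F : C -> C) (x c d : R) :
  (forall z, Ccont F z) -> (forall z, is_Cderive P z (F z)) ->
  Ci * CInt (fun y => F (x, y)) c d = P (x, d) - P (x, c).
Proof.
intros HF HP; rewrite <- CInt_Cmult_l by (intros t; now apply Rcont_v).
apply (CInt_derive (fun y => P (x, y))); intros t.
- rewrite Cmult_comm; now apply is_derive_v.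
- apply (Rcont_v (fun z => Ci * F z)); apply Ccont_mult; [apply Ccont_const|auto].
Qed.

Lemma rect_int_primitive (P F : C -> C) (a b c d : R) :
  (forall z, Ccont F z) -> (forall z, is_Cderive P z (F z)) -> rect_int F a b c d = 0.
Proof.
intros HF HP; unfold rect_int.
rewrite !(CInt_h_primitive P), !(CInt_v_primitive P) by auto; ring.
Qed.

Lemma Cmod_pair_le (x y : R) : Cmod (x, y) <= Rabs x + Rabs y.
Proof. apply (Cmod_le_re_im (x, y)). Qed.

Lemma Ci_Cmod_mult (z : C) : Cmod (Ci * z) = Cmod z.
Proof. rewrite Cmod_mult, Cmod_Ci; ring. Qed.

Lemma rect_int_bound (F : C -> C) (a b c d M : R) :
  a <= b -> c <= d -> (forall z, Ccont F z) ->
  (forall x y, a <= x <= b -> c <= y <= d -> Cmod (F (x, y)) <= M) ->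
  Cmod (rect_int F a b c d) <= 2 * M * ((b - a) + (d - c)).
Proof.
intros Hab Hcd HF HM; unfold rect_int.
assert (H1 : Cmod (CInt (fun x => F (x, c)) a b) <= (b - a) * M)
  by (apply CInt_bound; auto; intros t; [now apply Rcont_h|intros; apply HM; lra]).
assert (H2 : Cmod (CInt (fun x => F (x, d)) a b) <= (b - a) * M)
  by (apply CInt_bound; auto; intros t; [now apply Rcont_h|intros; apply HM; lra]).
assert (H3 : Cmod (CInt (fun y => F (a, y)) c d) <= (d - c) * M)
  by (apply CInt_bound; auto; intros t; [now apply Rcont_v|intros; apply HM; lra]).
assert (H4 : Cmod (CInt (fun y => F (b, y)) c d) <= (d - c) * M)
  by (apply CInt_bound; auto; intros t; [now apply Rcont_v|intros; apply HM; lra]).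
unfold Cminus.
eapply Rle_trans; [apply Cmod_triangle|]; rewrite Cmod_opp, Ci_Cmod_mult.
eapply Rle_trans; [apply Rplus_le_compat_r, Cmod_triangle|]; rewrite Cmod_opp.
eapply Rle_trans; [do 2 apply Rplus_le_compat_r; apply Cmod_triangle|].
rewrite Ci_Cmod_mult; lra.
Qed.

(* The linear part of [F] at [z0] has a primitive, so only the remainder, which is
   [e] times smaller than the distance to [z0], contributes. *)
Lemma goursat_local (F : C -> C) (x0 y0 e : R) :
  entire F -> 0 < e -> exists delta, 0 < delta /\
  forall a b c d, a <= x0 <= b -> c <= y0 <= d -> (b - a) + (d - c) < delta ->
    Cmod (rect_int F a b c d) <= 2 * e * ((b - a) + (d - c)) ^ 2.
Proof.
intros HF He; destruct (HF (x0, y0)) as [l Hl].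
destruct (proj1 (is_Cderive_eps _ _ _) Hl e He) as (delta & Hd & H).
exists delta; split; auto; intros a b c d Hx Hy Hs.
set (z0 := (x0, y0) : C) in *.
set (L := fun z => F z0 + l * (z - z0)).
set (G := fun z => F z - L z).
assert (HcF : forall z, Ccont F z) by (intros; now apply entire_cont).
assert (HL : forall z, is_Cderive (fun z => F z0 * z + l * ((z - z0) ^ 2 / 2)) z (L z)).
{ intros z; eapply is_Cderive_eq.
  - Cderive; intros E; apply RtoC_inj in E; lra.
  - unfold L; cbv beta; change (pred 2) with 1%nat; rewrite Cpow_1_r.
    replace (RtoC (INR 2)) with (RtoC 2) by (f_equal; simpl; ring).
    field; intros E; apply RtoC_inj in E; lra. }
assert (HdL : forall z, is_Cderive L z l).
{ intros z; unfold L; eapply is_Cderive_eq; [Cderive|cbv beta; ring]. }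
assert (HcL : forall z, Ccont L z) by (intros; eapply is_Cderive_cont; apply HdL).
assert (HcG : forall z, Ccont G z).
{ intros z; destruct (HF z) as [k Hk]; eapply is_Cderive_cont.
  apply is_Cderive_minus; eauto. }
replace (rect_int F a b c d) with (rect_int (fun z => L z + G z) a b c d).
2:{ apply rect_int_ext; intros z; unfold G; ring. }
rewrite rect_int_plus by auto.
rewrite (rect_int_primitive _ L _ _ _ _ HcL HL), Cplus_0_l.
set (s := ((b - a) + (d - c))%R) in *.
replace (2 * e * s ^ 2)%R with (2 * (e * s) * s)%R by ring.
apply rect_int_bound; try lra; auto.
intros x y Hx' Hy'.
assert (Hz : Cmod ((x, y) - z0) <= s).
{ replace ((x, y) - z0) with ((x - x0, y - y0)%R : C)
    by (apply Ceq_re_im; unfold z0, Re, Im; simpl; ring).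
  eapply Rle_trans; [apply Cmod_pair_le|].
  apply Rplus_le_compat; apply Rabs_le; lra. }
unfold G, L.
replace (F (x, y) - (F z0 + l * ((x, y) - z0))) with (F (x, y) - F z0 - l * ((x, y) - z0))
  by ring.
eapply Rle_trans; [apply H; lra|].
apply Rmult_le_compat_l; lra.
Qed.

(** One of the four quarters carries at least a quarter of the modulus. The corner is a computed
    witness (a [sig] type rather than [exists]), so that [goursat] can iterate the choice by a
    [fix]. *)
Lemma rect_int_quarter (F : C -> C) (w h : R) (p : R * R) :
  (forall z, Ccont F z) ->
  {q : R * R | (fst q = fst p \/ fst q = fst p + w)%R /\
    (snd q = snd p \/ snd q = snd p + h)%R /\
    Cmod (rect_int F (fst p) (fst p + 2 * w) (snd p) (snd p + 2 * h)) <=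
    4 * Cmod (rect_int F (fst q) (fst q + w) (snd q) (snd q + h))}.
Proof.
intros HF; destruct p as [x y]; simpl.
pose (Q := fun x y => Cmod (rect_int F x (x + w) y (y + h))).
set (T := Cmod (rect_int F x (x + 2 * w) y (y + 2 * h))).
assert (HT : T <= Q x y + Q (x + w)%R y + Q x (y + h)%R + Q (x + w)%R (y + h)%R).
{ unfold T, Q.
  rewrite (rect_int_split F x (x + w) (x + 2 * w) y (y + h) (y + 2 * h)) by auto.
  replace (x + w + w)%R with (x + 2 * w)%R by ring.
  replace (y + h + h)%R with (y + 2 * h)%R by ring.
  eapply Rle_trans; [apply Cmod_triangle|]; apply Rplus_le_compat_r.
  eapply Rle_trans; [apply Cmod_triangle|]; apply Rplus_le_compat_r.
  apply Cmod_triangle. }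
destruct (Rle_dec T (4 * Q x y)); [exists (x, y); simpl; auto|].
destruct (Rle_dec T (4 * Q (x + w)%R y)); [exists (x + w, y)%R; simpl; auto|].
destruct (Rle_dec T (4 * Q x (y + h)%R)); [exists (x, y + h)%R; simpl; auto|].
exists (x + w, y + h)%R; simpl; split; [auto|split; [auto|]].
fold (Q (x + w)%R (y + h)%R); lra.
Qed.

(** Each interval is the left or right half of the previous one; the supremum of the left endpoints
    lies in all of them. *)
Lemma nested_point (u : nat -> R) (w : R) :
  0 <= w ->
  (forall n, u (S n) = u n \/ u (S n) = u n + w / 2 ^ S n)%R ->
  exists x, forall n, u n <= x <= u n + w / 2 ^ n.
Proof.
intros Hw Hu.
assert (Hp : forall n, 0 <= w / 2 ^ S n)
  by (intros n; apply Rdiv_le_0_compat; [lra|apply pow_lt; lra]).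
assert (Hs : forall n, (w / 2 ^ n = 2 * (w / 2 ^ S n))%R)
  by (intros n; simpl; field; apply pow_nonzero; lra).
assert (H1 : forall n, u n <= u (S n))
  by (intros n; specialize (Hp n); destruct (Hu n) as [->| ->]; lra).
assert (H2 : forall n, u (S n) + w / 2 ^ S n <= u n + w / 2 ^ n)
  by (intros n; specialize (Hp n); rewrite (Hs n); destruct (Hu n) as [->| ->]; lra).
assert (H3 : forall n k, u n <= u (n + k)%nat).
{ intros n k; induction k; [rewrite Nat.add_0_r; lra|].
  rewrite Nat.add_succ_r; eapply Rle_trans; [eassumption|apply H1]. }
assert (H4 : forall n k, u (n + k)%nat + w / 2 ^ (n + k) <= u n + w / 2 ^ n).
{ intros n k; induction k; [rewrite Nat.add_0_r; lra|].
  rewrite Nat.add_succ_r; eapply Rle_trans; [apply H2|eassumption]. }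
assert (H0 : forall n, 0 <= w / 2 ^ n)
  by (intros n; apply Rdiv_le_0_compat; [lra|apply pow_lt; lra]).
assert (H5 : forall n m, u n <= u m + w / 2 ^ m).
{ intros n m; destruct (Nat.le_ge_cases n m) as [H|H].
  - replace m with (n + (m - n))%nat by lia.
    specialize (H3 n (m - n)%nat); specialize (H0 (n + (m - n))%nat); lra.
  - specialize (H4 m (n - m)%nat); replace (m + (n - m))%nat with n in H4 by lia.
    specialize (H0 n); lra. }
destruct (completeness (fun x => exists n, x = u n)) as [x [Hx1 Hx2]].
- exists (u 0%nat + w / 2 ^ 0)%R; intros y [n ->]; apply H5.
- exists (u 0%nat), 0%nat; reflexivity.
- exists x; intros n; split; [apply Hx1; eauto|].
  apply Hx2; intros y [m ->]; apply H5.
Qed.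

Lemma half_pow_small (s d : R) : 0 < d -> exists n, s / 2 ^ n < d.
Proof.
intros Hd; destruct (Rle_or_lt s 0) as [Hs|Hs].
- exists 0%nat; simpl; lra.
- destruct (Pow_x_infinity 2) with (b := (2 * s / d)%R) as [n Hn].
  { rewrite Rabs_right; lra. }
  exists n; specialize (Hn n (le_n n)).
  assert (Hp : 0 < 2 ^ n) by (apply pow_lt; lra).
  rewrite Rabs_right in Hn by lra.
  apply (Rmult_lt_reg_r (2 ^ n)); auto.
  unfold Rdiv; rewrite Rmult_assoc, Rinv_l, Rmult_1_r by lra.
  assert (2 * s / d * d = 2 * s)%R by (field; lra).
  nra.
Qed.

Lemma goursat (F : C -> C) (a b c d : R) :
  entire F -> a <= b -> c <= d -> rect_int F a b c d = 0.
Proof.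
intros HF Hab Hcd.
assert (HcF : forall z, Ccont F z) by (intros; now apply entire_cont).
set (w := (b - a)%R); set (h := (d - c)%R).
(* [seq n] is the lower left corner of a rectangle of sides [w / 2 ^ n] and [h / 2 ^ n]. *)
pose (seq := fix seq (n : nat) : R * R := match n with
  | O => (a, c)
  | S n => proj1_sig (rect_int_quarter F (w / 2 ^ S n) (h / 2 ^ S n) (seq n) HcF)
  end).
pose (T := fun n => Cmod (rect_int F (fst (seq n)) (fst (seq n) + w / 2 ^ n)
  (snd (seq n)) (snd (seq n) + h / 2 ^ n))).
assert (Hseq : forall n,
  (fst (seq (S n)) = fst (seq n) \/ fst (seq (S n)) = fst (seq n) + w / 2 ^ S n)%R /\
  (snd (seq (S n)) = snd (seq n) \/ snd (seq (S n)) = snd (seq n) + h / 2 ^ S n)%R /\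
  T n <= 4 * T (S n)).
{ intros n; unfold T.
  change (seq (S n)) with
    (proj1_sig (rect_int_quarter F (w / 2 ^ S n) (h / 2 ^ S n) (seq n) HcF)).
  destruct (rect_int_quarter F (w / 2 ^ S n) (h / 2 ^ S n) (seq n) HcF) as (q & H1 & H2 & H3).
  simpl proj1_sig; repeat split; auto.
  replace (w / 2 ^ n)%R with (2 * (w / 2 ^ S n))%R
    by (simpl; field; apply pow_nonzero; lra).
  replace (h / 2 ^ n)%R with (2 * (h / 2 ^ S n))%R
    by (simpl; field; apply pow_nonzero; lra).
  exact H3. }
destruct (nested_point (fun n => fst (seq n)) w) as [x0 Hx0];
  [unfold w; lra|intros n; apply Hseq|].
destruct (nested_point (fun n => snd (seq n)) h) as [y0 Hy0];
  [unfold h; lra|intros n; apply Hseq|].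
assert (HT : forall n, T 0%nat <= 4 ^ n * T n).
{ induction n as [|n IH]; [simpl; lra|].
  destruct (Hseq n) as (_ & _ & H).
  assert (0 < 4 ^ n) by (apply pow_lt; lra).
  simpl; nra. }
assert (HT0 : T 0%nat = Cmod (rect_int F a b c d)).
{ unfold T; simpl; f_equal; f_equal; unfold w, h; field. }
set (s := (w + h)%R).
assert (Hs : 0 <= s) by (unfold s, w, h; lra).
(* The rectangle of rank [n] contributes at most [2 * e * (s / 2 ^ n) ^ 2], which cancels exactly
   the factor [4 ^ n] lost in the subdivisions. *)
assert (Hsmall : forall e, 0 < e -> T 0%nat <= 2 * e * s ^ 2).
{ intros e He.
  destruct (goursat_local F x0 y0 e HF He) as (delta & Hd & H).
  destruct (half_pow_small s delta Hd) as [n Hn].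
  assert (Hp : 0 < 2 ^ n) by (apply pow_lt; lra).
  specialize (H _ _ _ _ (Hx0 n) (Hy0 n)); cbv beta in H.
  replace (fst (seq n) + w / 2 ^ n - fst (seq n) + (snd (seq n) + h / 2 ^ n - snd (seq n)))%R
    with (s / 2 ^ n)%R in H by (unfold s; field; lra).
  specialize (H Hn); fold (T n) in H.
  eapply Rle_trans; [apply (HT n)|].
  replace (4 ^ n)%R with (2 ^ n * 2 ^ n)%R by (rewrite <- Rpow_mult_distr; f_equal; ring).
  replace (2 * e * s ^ 2)%R with (2 ^ n * 2 ^ n * (2 * e * (s / 2 ^ n) ^ 2))%R
    by (field; lra).
  apply Rmult_le_compat_l; auto.
  apply Rlt_le, Rmult_lt_0_compat; auto. }
apply Cmod_eq_0; rewrite <- HT0.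
apply Rle_antisym; [|apply Cmod_ge_0].
apply le_epsilon; intros e He; rewrite Rplus_0_l.
specialize (Hsmall (e / (2 * (s ^ 2 + 1)))%R).
assert (Hs2 : 0 <= s ^ 2) by (apply pow_le; auto).
eapply Rle_trans; [apply Hsmall, Rdiv_lt_0_compat; lra|].
replace (2 * (e / (2 * (s ^ 2 + 1))) * s ^ 2)%R with (e * (s ^ 2 / (s ^ 2 + 1)))%R
  by (field; lra).
assert (s ^ 2 / (s ^ 2 + 1) <= 1).
{ apply (Rmult_le_reg_r (s ^ 2 + 1)); [lra|].
  unfold Rdiv; rewrite Rmult_assoc, Rinv_l by lra; lra. }
nra.
Qed.

Lemma entire_comp (f g : C -> C) : entire f -> entire g -> entire (fun z => f (g z)).
Proof.
intros Hf Hg z; destruct (Hg z) as [l Hl], (Hf (g z)) as [k Hk].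
exists (k * l); now apply is_Cderive_comp.
Qed.

Lemma entire_shift_exp (w : C) : entire (fun z => w + Cexp (- z)).
Proof.
intros z; eexists; Cderive.
Qed.

Lemma Cexp_add_2PI (x y : R) : Cexp (x, y + 2 * PI)%R = Cexp (x, y).
Proof.
apply Ceq_re_im; rewrite ?re_Cexp, ?im_Cexp; unfold Re, Im; simpl; f_equal.
- rewrite cos_plus, cos_2PI, sin_2PI; ring.
- rewrite sin_plus, cos_2PI, sin_2PI; ring.
Qed.

(** By periodicity the horizontal sides of the rectangle cancel, and Goursat's theorem compares the
    vertical ones. *)
Lemma circle_mean_const (F : C -> C) (r1 r2 : R) :
  entire F -> r1 <= r2 -> (forall x, F (x, 2 * PI)%R = F (x, 0)%R) ->
  CInt (fun y => F (r1, y)) 0 (2 * PI) = CInt (fun y => F (r2, y)) 0 (2 * PI).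
Proof.
intros HF Hr Hper.
pose proof PI_RGT_0 as Hpi.
pose proof (goursat F r1 r2 0 (2 * PI) HF Hr ltac:(lra)) as H; unfold rect_int in H.
rewrite (CInt_ext (fun x => F (x, 2 * PI)%R) (fun x => F (x, 0)%R)) in H by auto.
set (A := CInt (fun x => F (x, 0)%R) r1 r2) in H.
set (I1 := CInt (fun y => F (r1, y)) 0 (2 * PI)) in *.
set (I2 := CInt (fun y => F (r2, y)) 0 (2 * PI)) in *.
assert (E : Ci * (I2 - I1) = 0) by (rewrite <- H; ring).
apply Ceq_minus.
replace (I1 - I2) with (Ci * (Ci * (I2 - I1))) by (
  replace (Ci * (Ci * (I2 - I1))) with (Ci * Ci * (I2 - I1)) by ring;
  replace (Ci * Ci) with (- (1)) by (apply Ceq_re_im; unfold Re, Im; simpl; ring); ring).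
rewrite E; ring.
Qed.

(* Goursat's theorem in the coordinate [- log (z - w)], in which circles about [w] are
   vertical segments. *)
Lemma mean_value_property (g : C -> C) (w : C) (r : R) :
  entire g -> CInt (fun y => g (w + Cexp (- (r, y)%R))) 0 (2 * PI) = RtoC (2 * PI) * g w.
Proof.
intros Hg.
pose proof PI_RGT_0 as Hpi.
set (F := fun z => g (w + Cexp (- z))).
assert (HF : entire F) by (apply (entire_comp g); [auto|apply entire_shift_exp]).
assert (Hper : forall x, F (x, 2 * PI)%R = F (x, 0)%R).
{ intros x; unfold F; do 2 f_equal.
  replace (- (x, 0)%R) with ((- x, - (2 * PI) + 2 * PI)%R : C)
    by (apply Ceq_re_im; unfold Re, Im; simpl; ring).
  rewrite Cexp_add_2PI; f_equal; apply Ceq_re_im; unfold Re, Im; simpl; ring. }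
assert (HcF : forall x t, Rcont (fun y => F (x, y)) t)
  by (intros; apply Rcont_v; now apply entire_cont).
apply Ceq_minus, Cmod_eq_0, Rle_antisym; [|apply Cmod_ge_0].
apply le_epsilon; intros e He; rewrite Rplus_0_l.
destruct (entire_cont g w Hg (e / (2 * PI))%R) as (d & Hd & H).
{ apply Rdiv_lt_0_compat; lra. }
(* [s] is minus the logarithm of a radius: beyond [- ln (d / 2)] the circle lies in the disk where
   [g] is within [e / (2 * PI)] of [g w]. *)
set (s := Rmax r (- ln (d / 2))).
assert (E : CInt (fun y => g (w + Cexp (- (r, y)%R))) 0 (2 * PI) =
  CInt (fun y => F (s, y)) 0 (2 * PI)).
{ apply (circle_mean_const F r s HF); [apply Rmax_l|exact Hper]. }
rewrite E.
replace (RtoC (2 * PI) * g w) with (CInt (fun _ => g w) 0 (2 * PI))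
  by (rewrite CInt_const; f_equal; f_equal; ring).
replace (CInt (fun y => F (s, y)) 0 (2 * PI) - CInt (fun _ => g w) 0 (2 * PI)) with
  (CInt (fun y => F (s, y) + (- (1)) * g w) 0 (2 * PI)).
2:{ rewrite CInt_plus, CInt_Cmult_l; auto; try ring; intros t; apply continuous_const. }
replace e with ((2 * PI - 0) * (e / (2 * PI)))%R by (field; lra).
apply CInt_bound; [lra| |].
- intros t; apply (Rcont_v (fun z => F z + (- (1)) * g w)).
  apply Ccont_plus; [now apply entire_cont|apply Ccont_const].
- intros t _; apply Rlt_le.
  replace (F (s, t) + - (1) * g w) with (F (s, t) - g w) by ring.
  apply H; replace (w + Cexp (- (s, t)%R) - w) with (Cexp (- (s, t)%R)) by ring.
  rewrite Cmod_Cexp, re_opp; simpl.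
  assert (Hle : exp (- s) <= exp (ln (d / 2))).
  { destruct (Req_dec (- s) (ln (d / 2))) as [->|Hne]; [lra|].
    apply Rlt_le, exp_increasing; pose proof (Rmax_r r (- ln (d / 2))) as Hle; fold s in Hle; lra. }
  rewrite exp_ln in Hle; lra.
Qed.

(** The value at [w] is a mean over one large circle about [w], on which [g] is at most [e]; no
    estimate of derivatives comes in. *)
Lemma liouville (g : C -> C) :
  entire g ->
  (forall e, 0 < e -> exists M, forall z, M < Cmod z -> Cmod (g z) <= e) ->
  forall w, g w = 0.
Proof.
intros Hg Hlim w; pose proof PI_RGT_0 as Hpi.
apply Cmod_eq_0, Rle_antisym; [|apply Cmod_ge_0].
apply le_epsilon; intros e He; rewrite Rplus_0_l.
destruct (Hlim e He) as [M HM].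
(* Radius of the circle about [w]: its points have modulus at least [K - Cmod w], which exceeds
   [M]. *)
pose (K := (Rabs M + Cmod w + 1)%R).
assert (HK : 0 < K) by (unfold K; pose proof (Rabs_pos M); pose proof (Cmod_ge_0 w); lra).
pose proof (mean_value_property g w (- ln K) Hg) as E.
assert (B : Cmod (RtoC (2 * PI) * g w) <= (2 * PI - 0) * e).
{ rewrite <- E; apply CInt_bound; [lra| |].
  - intros t; apply (Rcont_v (fun z => g (w + Cexp (- z)))).
    apply entire_cont, (entire_comp g); [auto|apply entire_shift_exp].
  - intros t _; apply HM.
    pose proof (Cmod_triangle_rev (Cexp (- (- ln K, t)%R)) (- w)) as H.
    rewrite Cmod_opp, Cmod_Cexp, re_opp in H; simpl in H.
    rewrite Ropp_involutive, exp_ln in H by auto.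
    replace (Cexp (- (- ln K, t)%R) - - w) with (w + Cexp (- (- ln K, t)%R)) in H by ring.
    assert (M < K - Cmod w) by (pose proof (Rle_abs M); unfold K; lra); lra. }
rewrite Cmod_mult, Cmod_R, Rabs_right in B by lra.
nra.
Qed.

(** * Primitives of entire functions *)

Lemma CInt_swap (f : R -> C) (a b : R) : (forall t, Rcont f t) -> CInt f b a = - CInt f a b.
Proof.
intros Hf; symmetry; apply (opp_RInt_swap (V := C_R_CompleteNormedModule)).
now apply ex_CInt_Rcont.
Qed.

Lemma CInt_bound_abs (f : R -> C) (a b M : R) :
  (forall t, Rcont f t) -> (forall t, Rmin a b <= t <= Rmax a b -> Cmod (f t) <= M) ->
  Cmod (CInt f a b) <= Rabs (b - a) * M.
Proof.
intros Hf HM; destruct (Rle_or_lt a b) as [H|H].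
- rewrite Rabs_right by lra; rewrite Rmin_left, Rmax_right in HM by lra.
  now apply CInt_bound.
- rewrite CInt_swap, Cmod_opp, Rabs_left by (auto; lra).
  rewrite Rmin_right, Rmax_left in HM by lra.
  replace (- (b - a))%R with (a - b)%R by ring; apply CInt_bound; auto; lra.
Qed.

Lemma goursat_oriented (F : C -> C) (a b c d : R) : entire F -> rect_int F a b c d = 0.
Proof.
intros HF.
assert (HcF : forall z, Ccont F z) by (intros; now apply entire_cont).
assert (Hh : forall y t, Rcont (fun x => F (x, y)) t) by (intros; now apply Rcont_h).
assert (Hv : forall x t, Rcont (fun y => F (x, y)) t) by (intros; now apply Rcont_v).
assert (H1 : forall a b c d, c <= d -> rect_int F a b c d = 0).
{ intros a' b' c' d' H; destruct (Rle_or_lt a' b') as [H'|H']; [now apply goursat|].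
  replace (rect_int F a' b' c' d') with (- rect_int F b' a' c' d');
    [rewrite goursat; auto; [ring|lra]|].
  unfold rect_int; rewrite (CInt_swap (fun x => F (x, c')) a' b'),
    (CInt_swap (fun x => F (x, d')) a' b') by auto; ring. }
destruct (Rle_or_lt c d) as [H|H]; [now apply H1|].
replace (rect_int F a b c d) with (- rect_int F a b d c);
  [rewrite H1; [ring|lra]|].
unfold rect_int; rewrite (CInt_swap (fun y => F (a, y)) c d),
  (CInt_swap (fun y => F (b, y)) c d) by auto; ring.
Qed.

(** [P] integrates along the real axis up to [Re z], then vertically. By Goursat's theorem
    [P w - P z] is the integral over such a broken line from [z] to [w], whose two sides are no
    longer than [Cmod (w - z)]. *)
Lemma entire_primitive (F : C -> C) :
  entire F -> exists P, forall z, is_Cderive P z (F z).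
Proof.
intros HF.
assert (HcF : forall z, Ccont F z) by (intros; now apply entire_cont).
assert (Hh : forall y t, Rcont (fun x => F (x, y)) t) by (intros; now apply Rcont_h).
assert (Hv : forall x t, Rcont (fun y => F (x, y)) t) by (intros; now apply Rcont_v).
set (P := fun z => CInt (fun x => F (x, 0)%R) 0 (Re z) +
  Ci * CInt (fun y => F (Re z, y)) 0 (Im z)).
exists P; intros z.
assert (HP : forall w, P w - P z = CInt (fun x => F (x, Im z)) (Re z) (Re w) +
  Ci * CInt (fun y => F (Re w, y)) (Im z) (Im w)).
{ intros w; unfold P.
  rewrite (CInt_Chasles (fun x => F (x, 0)%R) 0 (Re z) (Re w)) by auto.
  rewrite (CInt_Chasles (fun y => F (Re w, y)) 0 (Im z) (Im w)) by auto.
  pose proof (goursat_oriented F (Re z) (Re w) 0 (Im z) HF) as E; unfold rect_int in E.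
  set (A1 := CInt (fun x => F (x, 0)%R) 0 (Re z)) in *.
  set (A2 := CInt (fun x => F (x, 0)%R) (Re z) (Re w)) in *.
  set (B1 := CInt (fun y => F (Re w, y)) 0 (Im z)) in *.
  set (B2 := CInt (fun y => F (Re w, y)) (Im z) (Im w)) in *.
  set (B3 := CInt (fun y => F (Re z, y)) 0 (Im z)) in *.
  set (A3 := CInt (fun x => F (x, Im z)) (Re z) (Re w)) in *.
  apply Ceq_minus; rewrite <- E; ring. }
apply is_Cderive_eps; intros e He.
destruct (HcF z (e / 2)%R ltac:(lra)) as (d & Hd & H).
exists d; split; auto; intros w Hw.
rewrite HP.
pose proof (re_le_Cmod (w - z)) as Hr; pose proof (abs_im_le_Cmod (w - z)) as Hi.
unfold Cminus in Hr at 1; unfold Cminus in Hi at 1.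
rewrite re_plus, re_opp in Hr; rewrite im_plus, im_opp in Hi.
set (Fz := F z).
replace (CInt (fun x => F (x, Im z)) (Re z) (Re w) +
  Ci * CInt (fun y => F (Re w, y)) (Im z) (Im w) - Fz * (w - z)) with
  (CInt (fun x => F (x, Im z) + (- (1)) * Fz) (Re z) (Re w) +
  Ci * CInt (fun y => F (Re w, y) + (- (1)) * Fz) (Im z) (Im w)).
2:{ rewrite !CInt_plus by (intros; try apply continuous_const; auto).
  rewrite !CInt_Cmult_l by (intros; apply continuous_const).
  rewrite !CInt_const.
  assert (E : w - z = RtoC (Re w - Re z) + Ci * RtoC (Im w - Im z))
    by (apply Ceq_re_im; unfold Re, Im; simpl; ring).
  rewrite E; ring. }
assert (Hc2 : forall u, Ccont (fun v => F v + (- (1)) * Fz) u)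
  by (intros u; apply Ccont_plus; [auto|apply Ccont_const]).
(* Points of the broken line are no farther from [z] than [w] is, since both coordinates of the
   difference are smaller in absolute value. *)
assert (Hbox : forall x y, Rmin (Re z) (Re w) <= x <= Rmax (Re z) (Re w) ->
  Rmin (Im z) (Im w) <= y <= Rmax (Im z) (Im w) -> Cmod (F (x, y) + (- (1)) * Fz) <= e / 2).
{ intros x y Hx Hy; apply Rlt_le.
  replace (F (x, y) + - (1) * Fz) with (F (x, y) - F z) by (unfold Fz; ring).
  apply H; eapply Rle_lt_trans; [|exact Hw].
  assert (X : Rabs (x - Re z) <= Rabs (Re w - Re z)).
  { revert Hx; unfold Rmin, Rmax, Rabs; destruct (Rle_dec (Re z) (Re w));
      destruct (Rcase_abs (x - Re z)), (Rcase_abs (Re w - Re z)); lra. }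
  assert (Y : Rabs (y - Im z) <= Rabs (Im w - Im z)).
  { revert Hy; unfold Rmin, Rmax, Rabs; destruct (Rle_dec (Im z) (Im w));
      destruct (Rcase_abs (y - Im z)), (Rcase_abs (Im w - Im z)); lra. }
  apply sqrt_le_1_alt.
  change (fst ((x, y) - z)) with (x - Re z)%R; change (snd ((x, y) - z)) with (y - Im z)%R.
  change (fst (w - z)) with (Re w - Re z)%R; change (snd (w - z)) with (Im w - Im z)%R.
  apply Rplus_le_compat; rewrite <- !Rsqr_pow2; now apply Rsqr_le_abs_1. }
eapply Rle_trans; [apply Cmod_triangle|]; rewrite Ci_Cmod_mult.
assert (I1 : Cmod (CInt (fun x => F (x, Im z) + (- (1)) * Fz) (Re z) (Re w)) <=
  Rabs (Re w - Re z) * (e / 2)).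
{ apply CInt_bound_abs.
  - intros t; now apply (Rcont_h (fun v => F v + (- (1)) * Fz)).
  - intros t Ht; apply Hbox; auto; split; [apply Rmin_l|apply Rmax_l]. }
assert (I2 : Cmod (CInt (fun y => F (Re w, y) + (- (1)) * Fz) (Im z) (Im w)) <=
  Rabs (Im w - Im z) * (e / 2)).
{ apply CInt_bound_abs.
  - intros t; now apply (Rcont_v (fun v => F v + (- (1)) * Fz)).
  - intros t Ht; apply Hbox; auto; split; [apply Rmin_r|apply Rmax_r]. }
unfold Rminus in I1, I2.
assert (Rabs (Re w + - Re z) * (e / 2) <= Cmod (w - z) * (e / 2))
  by (apply Rmult_le_compat_r; lra).
assert (Rabs (Im w + - Im z) * (e / 2) <= Cmod (w - z) * (e / 2))
  by (apply Rmult_le_compat_r; lra).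
lra.
Qed.

(** * Decay along segments of the covering *)

Lemma is_Cderive_zero_const (F : C -> C) (m : R) (z w : C) :
  (forall zeta, Re zeta < m -> is_Cderive F zeta 0) -> Re z < m -> Re w < m -> F w = F z.
Proof.
intros HF Hz Hw; apply Ceq_minus, Cmod_eq_0, Rle_antisym; [|apply Cmod_ge_0].
rewrite <- (Rmult_0_l (Cmod (w - z))).
apply (line_mean_value F (fun _ => 0)).
- intros t Ht; apply HF.
  unfold Cminus; rewrite re_plus, re_scal_l, re_plus, re_opp.
  apply Rle_lt_trans with (Rmax (Re z) (Re w)); [|now apply Rmax_lub_lt].
  pose proof (Rmax_l (Re z) (Re w)); pose proof (Rmax_r (Re z) (Re w)); nra.
- intros t _; rewrite Cmod_0; lra.
Qed.

(* [psi] decays like [exp (- K t)] along the segment, because the logarithmic derivative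
   of its modulus is the real part of [L * v]. *)
Lemma segment_bound (phi psi L : C -> C) (z v : C) (K T : R) :
  0 < K -> 0 <= T ->
  (forall t, 0 <= t <= T -> let zeta := z + RtoC t * v in
    is_Cderive phi zeta (psi zeta) /\ is_Cderive psi zeta (L zeta * psi zeta) /\
    Re (L zeta * v) <= - K) ->
  Cmod (psi (z + RtoC T * v)) <= Cmod (psi z) /\
  Cmod (phi (z + RtoC T * v) - phi z) <= Cmod v * Cmod (psi z) / K.
Proof.
intros HK HT H.
set (p := fun t : R => psi (z + RtoC t * v)).
assert (Hp0 : p 0%R = psi z) by (unfold p; f_equal; ring).
assert (Hdp : forall t, 0 <= t <= T ->
  is_Rderive p t (L (z + RtoC t * v) * p t * v)).
{ intros t Ht; apply is_derive_line, H, Ht. }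
assert (Hdec : forall t, 0 <= t <= T -> Cmod (p t) <= Cmod (psi z) * exp (- K * t)).
{ intros t Ht.
  (* The squared modulus is differentiable even where [psi] vanishes; the derivative of [N] is a
     nonnegative multiple of [Re (L * v) + K]. *)
  set (N := fun t => ((Re (p t) * Re (p t) + Im (p t) * Im (p t)) * exp (2 * K * t))%R).
  assert (HN : forall s, (N s = (Cmod (p s) * exp (K * s)) ^ 2)%R).
  { intros s; unfold N; rewrite Rpow_mult_distr, Cmod2_alt.
    replace (exp (K * s) ^ 2)%R with (exp (2 * K * s)); [ring|].
    replace (2 * K * s)%R with (K * s + K * s)%R by ring; rewrite exp_plus; ring. }
  assert (Hle : N t <= N 0%R).
  { apply (derive_nonincreasing N (fun s => (2 * (Re (p s) * Re (p s) + Im (p s) * Im (p s))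
      * (Re (L (z + RtoC s * v)%C * v) + K) * exp (2 * K * s))%R)); [lra| |].
    - intros s Hs; unfold N.
      set (l := L (z + RtoC s * v)).
      assert (Hd := Hdp s ltac:(lra)); fold l in Hd.
      assert (Hr := is_derive_re _ _ _ Hd); assert (Hi := is_derive_im _ _ _ Hd).
      replace (2 * (Re (p s) * Re (p s) + Im (p s) * Im (p s)) * (Re (l * v) + K) *
        exp (2 * K * s))%R with
        ((Re (l * p s * v) * Re (p s) + Re (p s) * Re (l * p s * v) +
          (Im (l * p s * v) * Im (p s) + Im (p s) * Im (l * p s * v))) * exp (2 * K * s) +
        (Re (p s) * Re (p s) + Im (p s) * Im (p s)) * (2 * K * exp (2 * K * s)))%R
        by (rewrite !re_mult, !im_mult, !re_mult; ring).
      apply (is_derive_mult (fun s => Re (p s) * Re (p s) + Im (p s) * Im (p s))%R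
        (fun s => exp (2 * K * s))); [| |intros; apply Rmult_comm].
      + apply (is_derive_plus (fun s => Re (p s) * Re (p s))%R
          (fun s => Im (p s) * Im (p s))%R).
        * apply (is_derive_mult (fun s => Re (p s)) (fun s => Re (p s))); auto.
          intros; apply Rmult_comm.
        * apply (is_derive_mult (fun s => Im (p s)) (fun s => Im (p s))); auto.
          intros; apply Rmult_comm.
      + auto_derive; auto; ring.
    - intros s Hs.
      destruct (H s ltac:(lra)) as (_ & _ & Hs').
      assert (0 < exp (2 * K * s)) by apply exp_pos.
      assert (0 <= Re (p s) * Re (p s) + Im (p s) * Im (p s)) by nra.
      assert (0 <= (Re (p s) * Re (p s) + Im (p s) * Im (p s)) * exp (2 * K * s)) by nra.
      nra. }
  rewrite !HN, Hp0, Rmult_0_r, exp_0, Rmult_1_r in Hle.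
  assert (He : 0 < exp (K * t)) by apply exp_pos.
  assert (Hle' : Cmod (p t) * exp (K * t) <= Cmod (psi z)).
  { apply Rsqr_incr_0_var; [rewrite !Rsqr_pow2; exact Hle|apply Cmod_ge_0]. }
  replace (- K * t)%R with (- (K * t))%R by ring; rewrite exp_Ropp.
  apply (Rmult_le_reg_r (exp (K * t))); auto.
  rewrite Rmult_assoc, Rinv_l by lra; lra. }
split.
- eapply Rle_trans; [apply (Hdec T); lra|].
  rewrite <- (Rmult_1_r (Cmod (psi z))) at 2.
  apply Rmult_le_compat_l; [apply Cmod_ge_0|].
  rewrite <- exp_0; destruct (Req_dec T 0) as [->|HT0]; [rewrite Rmult_0_r; lra|].
  apply Rlt_le, exp_increasing; nra.
- set (A := (Cmod v * Cmod (psi z))%R).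
  assert (HA : 0 <= A) by (apply Rmult_le_pos; apply Cmod_ge_0).
  pose proof (mean_value_inequality (fun t => phi (z + RtoC t * v)) (fun t => p t * v)
    (fun t => - (A / K) * exp (- K * t))%R (fun t => A * exp (- K * t))%R 0 T HT) as M.
  cbv beta in M.
  replace (z + 0 * v) with z in M by ring.
  rewrite Rmult_0_r, exp_0 in M.
  eapply Rle_trans; [apply M|].
  + intros t Ht; apply is_derive_line, H, Ht.
  + intros t _; auto_derive; auto; field; lra.
  + intros t Ht; rewrite Cmod_mult; specialize (Hdec t Ht); unfold A.
    pose proof (Cmod_ge_0 v); nra.
  + assert (0 < exp (- K * T)) by apply exp_pos.
    assert (0 <= A / K) by (apply Rdiv_le_0_compat; lra).
    nra.
Qed.

Lemma cos_minus_sin_le (w : R) : PI / 2 <= w <= PI -> cos w - sin w <= - 1.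
Proof.
intros Hw; pose proof PI_RGT_0.
assert (cos w <= 0) by (apply cos_le_0; lra).
assert (0 <= sin w) by (apply sin_ge_0; lra).
pose proof (sin2_cos2 w) as E; unfold Rsqr in E; nra.
Qed.

Lemma cos_plus_sin_ge (w : R) : 0 <= w <= PI / 2 -> 1 <= cos w + sin w.
Proof.
intros Hw; pose proof PI_RGT_0.
assert (0 <= cos w) by (apply cos_ge_0; lra).
assert (0 <= sin w) by (apply sin_ge_0; lra).
pose proof (sin2_cos2 w) as E; unfold Rsqr in E; nra.
Qed.

(* In the strip [theta0 - PI <= Im zeta <= theta0 + PI], the point [zeta] is joined to the
   half-line [Im zeta = theta0] by segments of directions [(1, -1)] (where the real part
   of [a * exp (- zeta)] is negative) and [(-1, -1)], up to the symmetry about this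
   half-line; [|psi|] decreases fast along these segments. *)
Lemma strip_estimate (phi psi L : C -> C) (a u : C) (th0 al B m xi w s : R) :
  0 < al ->
  (forall zeta, Re zeta < m -> is_Cderive phi zeta (psi zeta) /\
    is_Cderive psi zeta (L zeta * psi zeta) /\ Cmod (L zeta - a * Cexp (- zeta)) <= B) ->
  a * Cexp (- (Ci * RtoC th0)) = RtoC al ->
  (forall e, 0 < e -> exists M, forall x, x < M -> Cmod (phi (x, th0) - u) < e) ->
  (s = 1 \/ s = - 1)%R -> 0 <= w <= PI -> xi + 2 < m -> 4 * B <= al * exp (- xi - 2) ->
  Cmod (phi (xi, th0 + s * w)%R - u) <=
  12 / al * exp (xi + 2) * Cmod (psi (xi, th0 + s * w)%R).
Proof.
intros Hal HL Ha Hlim Hs Hw Hm HB.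
pose proof PI_RGT_0 as Hpi; pose proof PI2_3_2 as Hpi3; pose proof PI_4 as Hpi4.
(* Half of the least modulus of the leading term of [L] where [Re zeta <= xi + 2]; the other half
   absorbs the remainder [B], multiplied by the bound 2 on directions. *)
set (K := (al * exp (- xi - 2) / 2)%R).
assert (HK : 0 < K).
{ unfold K; apply Rdiv_lt_0_compat; [|lra].
  apply Rmult_lt_0_compat; [auto|apply exp_pos]. }
assert (HB0 : 0 <= B).
{ destruct (HL (xi, 0)%R) as (_ & _ & H); [simpl; lra|].
  pose proof (Cmod_ge_0 (L (xi, 0)%R - a * Cexp (- (xi, 0)%R))); lra. }
assert (Hdir : forall x y p q, x <= xi + 2 -> Cmod (p, q) <= 2 ->
  p * cos y + q * sin y <= - 1 -> Re (L (x, th0 + y)%R * (p, q)) <= - K).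
{ intros x y p q Hx Hpq Hcs.
  set (zeta := (x, th0 + y)%R : C).
  destruct (HL zeta) as (_ & _ & HR); [simpl; lra|].
  assert (E : a * Cexp (- zeta) = RtoC (al * exp (- x)) * (cos y, - sin y)%R).
  { assert (Ez : - zeta = - (Ci * RtoC th0) + (- x, - y)%R)
      by (apply Ceq_re_im; unfold zeta, Re, Im; simpl; ring).
    rewrite Ez, Cexp_plus, Cmult_assoc, Ha, RtoC_mult, <- Cmult_assoc; f_equal.
    unfold Cexp; apply Ceq_re_im; unfold Re, Im; simpl; rewrite ?cos_neg, ?sin_neg; ring. }
  replace (L zeta * (p, q)) with
    (a * Cexp (- zeta) * (p, q) + (L zeta - a * Cexp (- zeta)) * (p, q)) by ring.
  rewrite re_plus.
  assert (H1 : Re (a * Cexp (- zeta) * (p, q)) = (al * exp (- x) * (p * cos y + q * sin y))%R)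
    by (rewrite E; unfold Re; simpl; ring).
  pose proof (Rle_trans _ _ _ (Rle_abs _) (re_le_Cmod ((L zeta - a * Cexp (- zeta)) * (p, q))))
    as H2.
  rewrite Cmod_mult in H2; rewrite H1.
  assert (Hex : exp (- xi - 2) <= exp (- x)).
  { destruct (Req_dec (- xi - 2) (- x)) as [->|Hne]; [lra|].
    apply Rlt_le, exp_increasing; lra. }
  assert (0 < exp (- xi - 2)) by apply exp_pos.
  assert (Cmod (L zeta - a * Cexp (- zeta)) * Cmod (p, q) <= B * 2)
    by (apply Rmult_le_compat; auto; apply Cmod_ge_0).
  assert (al * exp (- xi - 2) <= al * exp (- x)) by (apply Rmult_le_compat_l; lra).
  assert (al * exp (- x) * (p * cos y + q * sin y) <= al * exp (- x) * (-1))
    by (apply Rmult_le_compat_l; lra).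
  unfold K; lra. }
assert (Hseg : forall x y p q T, 0 <= T -> x <= xi + 2 -> x + T * p <= xi + 2 ->
  Cmod (p, q) <= 2 -> (forall t, 0 <= t <= T -> p * cos (y + t * q) + q * sin (y + t * q) <= - 1) ->
  Cmod (psi (x + T * p, th0 + (y + T * q))%R) <= Cmod (psi (x, th0 + y)%R) /\
  Cmod (phi (x + T * p, th0 + (y + T * q))%R - phi (x, th0 + y)%R) <=
    2 * Cmod (psi (x, th0 + y)%R) / K).
{ intros x y p q T HT Hx HxT Hpq Hcs.
  assert (E : forall t, (x, th0 + y)%R + RtoC t * (p, q) = (x + t * p, th0 + (y + t * q))%R)
    by (intros t; apply Ceq_re_im; unfold Re, Im; simpl; ring).
  destruct (segment_bound phi psi L (x, th0 + y)%R (p, q) K T) as [S1 S2]; auto.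
  - intros t Ht; cbv zeta; rewrite E.
    assert (Hxt : x + t * p <= xi + 2) by (destruct (Rle_or_lt p 0); nra).
    destruct (HL (x + t * p, th0 + (y + t * q))%R) as (D1 & D2 & _); [simpl; lra|].
    split; [|split]; auto.
  - rewrite E in S1, S2; split; auto.
    eapply Rle_trans; [exact S2|].
    unfold Rdiv; apply Rmult_le_compat_r; [apply Rlt_le, Rinv_0_lt_compat; auto|].
    apply Rmult_le_compat_r; [apply Cmod_ge_0|auto]. }
assert (Hss : (s * s = 1)%R) by (destruct Hs as [->| ->]; ring).
assert (Hcos : forall y, cos (s * y) = cos y)
  by (intros y; destruct Hs as [->| ->]; [f_equal; ring|];
      replace (- 1 * y)%R with (- y)%R by ring; apply cos_neg).
assert (Hsin : forall y, sin (s * y) = (s * sin y)%R)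
  by (intros y; destruct Hs as [->| ->]; [rewrite !Rmult_1_l; reflexivity|];
      replace (- 1 * y)%R with (- y)%R by ring; rewrite sin_neg; ring).
assert (Hmod : forall p q, (p = 1 \/ p = - 1)%R -> Cmod (p, s * q)%R <= 1 + Rabs q).
{ intros p q Hp; eapply Rle_trans; [apply Cmod_pair_le|].
  rewrite Rabs_mult.
  replace (Rabs s) with 1%R by (destruct Hs as [->| ->]; unfold Rabs; destruct Rcase_abs; lra).
  replace (Rabs p) with 1%R by (destruct Hp as [->| ->]; unfold Rabs; destruct Rcase_abs; lra).
  lra. }
assert (Hm1 : Rabs (- 1) = 1%R) by (unfold Rabs; destruct Rcase_abs; lra).
set (N := Cmod (psi (xi, th0 + s * w)%R)).
assert (HN : 0 <= N) by apply Cmod_ge_0.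
assert (HKi : 0 < / K) by (now apply Rinv_0_lt_compat).
(* If [w > PI / 2], a segment of direction [(1, - s)] leads to the line at angle [s * (PI / 2)] from
   the axis. It moves to the right by at most [PI / 2 < 2], whence the margin [xi + 2]. *)
assert (P1 : exists x1 w1, x1 <= xi + 2 /\ 0 <= w1 <= PI / 2 /\
  Cmod (psi (x1, th0 + s * w1)%R) <= N /\
  Cmod (phi (x1, th0 + s * w1)%R - phi (xi, th0 + s * w)%R) <= 2 * N / K).
{ destruct (Rle_or_lt w (PI / 2)) as [Hw2|Hw2].
  - exists xi, w; repeat split; try lra; [unfold N; lra|].
    replace (phi (xi, th0 + s * w)%R - phi (xi, th0 + s * w)%R) with (RtoC 0) by ring.
    rewrite Cmod_0; apply Rdiv_le_0_compat; lra.
  - destruct (Hseg xi (s * w)%R 1%R (s * - 1)%R (w - PI / 2)%R) as [S1 S2]; try lra.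
    + specialize (Hmod 1%R (- 1)%R); lra.
    + intros t Ht.
      replace (s * w + t * (s * -1))%R with (s * (w - t))%R by ring.
      rewrite Hcos, Hsin.
      replace (1 * cos (w - t) + s * -1 * (s * sin (w - t)))%R with
        (cos (w - t) - (s * s) * sin (w - t))%R by ring.
      rewrite Hss; pose proof (cos_minus_sin_le (w - t)); lra.
    + exists (xi + (w - PI / 2) * 1)%R, (PI / 2)%R; repeat split; try lra.
      * replace (s * (PI / 2))%R with (s * w + (w - PI / 2) * (s * -1))%R by ring; exact S1.
      * replace (s * (PI / 2))%R with (s * w + (w - PI / 2) * (s * -1))%R by ring; exact S2. }
destruct P1 as (x1 & w1 & Hx1 & Hw1 & HN1 & D1).
assert (P2 : exists x2, x2 <= xi + 2 /\ Cmod (psi (x2, th0 + 0)%R) <= N /\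
  Cmod (phi (x2, th0 + 0)%R - phi (x1, th0 + s * w1)%R) <= 2 * N / K).
{ destruct (Hseg x1 (s * w1)%R (- 1)%R (s * - 1)%R w1) as [S1 S2]; try lra.
  - specialize (Hmod (- 1)%R (- 1)%R); lra.
  - intros t Ht.
    replace (s * w1 + t * (s * -1))%R with (s * (w1 - t))%R by ring.
    rewrite Hcos, Hsin.
    replace (-1 * cos (w1 - t) + s * -1 * (s * sin (w1 - t)))%R with
      (- (cos (w1 - t) + (s * s) * sin (w1 - t)))%R by ring.
    rewrite Hss; pose proof (cos_plus_sin_ge (w1 - t)); lra.
  - exists (x1 + w1 * -1)%R.
    replace 0%R with (s * w1 + w1 * (s * -1))%R by ring.
    repeat split; try lra.
    eapply Rle_trans; [exact S2|]; unfold Rdiv; apply Rmult_le_compat_r; lra. }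
destruct P2 as (x2 & Hx2 & HN2 & D2).
(* The last segment follows the half-line itself to a point where [phi] is within [e] of [u]; its
   cost does not depend on its length [T]. *)
assert (P3 : forall e, 0 < e -> Cmod (u - phi (x2, th0 + 0)%R) <= 2 * N / K + e).
{ intros e He; destruct (Hlim e He) as [M HM].
  set (T := (Rmax 0 (x2 - M) + 1)%R).
  assert (HT0 : 0 <= T) by (unfold T; pose proof (Rmax_l 0 (x2 - M)); lra).
  assert (HTM : x2 - T < M) by (unfold T; pose proof (Rmax_r 0 (x2 - M)); lra).
  destruct (Hseg x2 0%R (- 1)%R 0%R T) as [S1 S2]; try lra.
  - specialize (Hmod (- 1)%R 0%R); rewrite Rmult_0_r, Rabs_R0 in Hmod; lra.
  - intros t Ht; rewrite Rmult_0_r, Rplus_0_l, cos_0; lra.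
  - specialize (HM (x2 + T * -1)%R ltac:(lra)).
    replace (th0 + (0 + T * 0))%R with th0 in S2 by ring.
    set (pT := phi (x2 + T * -1, th0)%R) in *.
    eapply Rle_trans; [apply (Cmod_minus_triangle u pT)|].
    rewrite (Cmod_minus_sym u).
    assert (2 * Cmod (psi (x2, th0 + 0)%R) / K <= 2 * N / K)
      by (unfold Rdiv; apply Rmult_le_compat_r; lra).
    lra. }
assert (P4 : Cmod (u - phi (x2, th0 + 0)%R) <= 2 * N / K) by (apply le_epsilon, P3).
assert (D : Cmod (phi (xi, th0 + s * w)%R - u) <= 6 * N / K).
{ rewrite Cmod_minus_sym.
  eapply Rle_trans; [apply (Cmod_minus_triangle _ (phi (x2, th0 + 0)%R))|].
  pose proof (Cmod_minus_triangle (phi (x2, th0 + 0)%R) (phi (x1, th0 + s * w1)%R)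
    (phi (xi, th0 + s * w)%R)).
  lra. }
eapply Rle_trans; [exact D|].
(* Three segments at [2 * N / K] each: this is the origin of the constant [12 / al]. *)
assert (EK : (/ K = 2 / al * exp (xi + 2))%R).
{ unfold K; replace (- xi - 2)%R with (- (xi + 2))%R by ring; rewrite exp_Ropp.
  assert (exp (xi + 2) <> 0)%R by (apply Rgt_not_eq, exp_pos).
  field; repeat split; auto; lra. }
unfold Rdiv at 1; rewrite EK; fold N; right; field; lra.
Qed.

(** * Laurent coefficients along a circle *)

Lemma Cmod_INR (n : nat) : Cmod (RtoC (INR n)) = INR n.
Proof. rewrite Cmod_R, Rabs_right; [reflexivity|]; pose proof (pos_INR n); lra. Qed.

(* Such a sequence grows like a factorial unless it vanishes. *)
Lemma factorial_recurrence (f : nat -> C) (a s : C) (M rho : R) :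
  a <> 0 -> 0 < rho -> (forall n, s <> RtoC (INR n)) ->
  (forall n, a * f (S n) = (s - RtoC (INR n)) * f n) ->
  (forall n, Cmod (f n) <= M * rho ^ n) -> f 0%nat = 0.
Proof.
intros Ha Hrho Hs Hrec HM.
destruct (Ceq_dec (f 0%nat) 0) as [E|E]; [exact E|exfalso].
assert (Hne : forall n, f n <> 0).
{ induction n as [|n IH]; [exact E|]; intros E'.
  apply (Cmult_neq_0 (s - RtoC (INR n)) (f n)); auto.
  - apply Cminus_eq_contra, Hs.
  - rewrite <- Hrec, E'; ring. }
assert (Ham := proj1 (Cmod_gt_0 a) Ha).
(* From rank [N] on, [Cmod (s - n)] exceeds [2 * rho * Cmod a], so the terms grow at least like
   [(2 * rho) ^ m], against an upper bound in [rho ^ m]. *)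
destruct (INR_unbounded (2 * rho * Cmod a + Cmod s)) as [N HN].
assert (Hstep : forall n, (N <= n)%nat -> 2 * rho * Cmod (f n) <= Cmod (f (S n))).
{ intros n Hn; apply (Rmult_le_reg_l (Cmod a)); auto.
  rewrite <- (Cmod_mult a), Hrec, Cmod_mult.
  apply le_INR in Hn.
  pose proof (Cmod_triangle_rev (RtoC (INR n)) s) as H; rewrite Cmod_INR in H.
  rewrite (Cmod_minus_sym s).
  pose proof (Cmod_ge_0 (f n)).
  replace (Cmod a * (2 * rho * Cmod (f n)))%R with (2 * rho * Cmod a * Cmod (f n))%R by ring.
  apply Rmult_le_compat_r; lra. }
assert (Hgrow : forall m, (2 * rho) ^ m * Cmod (f N) <= Cmod (f (N + m)%nat)).
{ induction m as [|m IH]; [rewrite Nat.add_0_r; simpl; lra|].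
  rewrite Nat.add_succ_r; eapply Rle_trans; [|apply Hstep; lia].
  simpl; nra. }
assert (HfN := proj1 (Cmod_gt_0 (f N)) (Hne N)).
destruct (Pow_x_infinity 2) with (b := (M * rho ^ N / Cmod (f N) + 1)%R) as [m Hm].
{ rewrite Rabs_right; lra. }
specialize (Hm m (le_n m)).
assert (0 < 2 ^ m) by (apply pow_lt; lra).
assert (Hr : 0 < rho ^ m) by (apply pow_lt; lra).
rewrite Rabs_right in Hm by lra.
pose proof (Rle_trans _ _ _ (Hgrow m) (HM (N + m)%nat)) as H2.
rewrite Rpow_mult_distr, pow_add in H2.
assert (H3 : 2 ^ m * Cmod (f N) <= M * rho ^ N).
{ apply (Rmult_le_reg_r (rho ^ m)); auto; lra. }
assert (H4 : (M * rho ^ N / Cmod (f N) * Cmod (f N) = M * rho ^ N)%R) by (field; lra).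
nra.
Qed.

(* In the coordinate [y = 1 / w], where [w = z - beta] and [z = exp (- zeta)], the solution
   [k] of [k' = 1 - L k] becomes a vector field [H] with [H' = 1 - (a / y ^ 2 - res / y) H].
   Integrating the derivative of [H * y ^ (- j)] over a circle gives a recurrence between
   the Laurent coefficients of [H], which forces a factorial growth.  The coefficient that
   must vanish for this reason then leaves an identity between the residue [2 i PI] of
   [dy / y] and a quantity which is small when [H = O(y ^ 2)]. *)
Section Laurent.

Variables (k : C -> C) (a res beta : C) (m th K : R).

Let L (zeta : C) : C :=
  a * Cexp (- zeta) + (1 - res) + (2 - res) * beta / (Cexp (- zeta) - beta).

Hypothesis Ha : a <> 0.
Hypothesis Hres : forall n, res - 2 <> RtoC (INR n).
Hypothesis Hw : forall zeta, Re zeta < m -> Cexp (- zeta) - beta <> 0.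
Hypothesis Hk : forall zeta, Re zeta < m -> is_Cderive k zeta (1 - L zeta * k zeta).
Hypothesis Hper : forall xi, xi < m -> k (xi, th + 2 * PI)%R = k (xi, th).
Hypothesis HK : forall xi t, xi < m -> th <= t <= th + 2 * PI -> Cmod (k (xi, t)) <= K * exp xi.

Let z (zeta : C) : C := Cexp (- zeta).
Let w (zeta : C) : C := z zeta - beta.

Lemma z_derive (zeta : C) : is_Cderive z zeta (- z zeta).
Proof.
unfold z; eapply is_Cderive_eq; [Cderive|ring].
Qed.

Lemma w_derive (zeta : C) : is_Cderive w zeta (- z zeta).
Proof.
eapply is_Cderive_eq; [apply is_Cderive_minus; [apply z_derive|Cderive]|ring].
Qed.

Lemma z_period (xi : R) : z (xi, th + 2 * PI)%R = z (xi, th).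
Proof.
unfold z.
replace (- (xi, th + 2 * PI)%R) with ((- xi, - (th + 2 * PI))%R : C)
  by (apply Ceq_re_im; unfold Re, Im; simpl; ring).
rewrite <- (Cexp_add_2PI (- xi) (- (th + 2 * PI))).
f_equal; apply Ceq_re_im; unfold Re, Im; simpl; ring.
Qed.

Lemma w_period (xi : R) : w (xi, th + 2 * PI)%R = w (xi, th).
Proof. unfold w; now rewrite z_period. Qed.

Lemma CInt_period (E dE : C -> C) (xi : R) :
  (forall t, is_Cderive E (xi, t) (dE (xi, t))) ->
  (forall t, Ccont dE (xi, t)) ->
  E (xi, th + 2 * PI)%R = E (xi, th) ->
  CInt (fun t => dE (xi, t)) th (th + 2 * PI) = 0.
Proof.
intros HE Hc Hp.
assert (H : CInt (fun t => dE (xi, t) * Ci) th (th + 2 * PI) = 0).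
{ rewrite (CInt_derive (fun t => E (xi, t))).
  - rewrite Hp; ring.
  - intros t; apply is_derive_v, HE.
  - intros t; apply (Rcont_v (fun v => dE v * Ci)).
    apply Ccont_mult; [apply Hc|apply Ccont_const]. }
rewrite (CInt_ext _ (fun t => Ci * dE (xi, t))) in H by (intros; ring).
rewrite CInt_Cmult_l in H by (intros; apply Rcont_v, Hc).
set (I := CInt (fun t => dE (xi, t)) th (th + 2 * PI)) in *.
replace I with (- Ci * (Ci * I)); [rewrite H; ring|].
replace (- Ci * (Ci * I)) with (- (Ci * Ci) * I) by ring.
replace (Ci * Ci) with (- (1)) by (apply Ceq_re_im; unfold Re, Im; simpl; ring); ring.
Qed.

Lemma k_cont (xi t : R) : xi < m -> Ccont k (xi, t).
Proof. intros H; eapply is_Cderive_cont, Hk; exact H. Qed.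

Lemma z_cont (zeta : C) : Ccont z zeta.
Proof. eapply is_Cderive_cont, z_derive. Qed.

Lemma winv_cont (xi t : R) : xi < m -> Ccont (fun v => / w v) (xi, t).
Proof.
intros H; eapply is_Cderive_cont, is_Cderive_Cinv; [apply Hw; exact H|apply w_derive].
Qed.

Lemma wpow_cont (n : nat) (zeta : C) : Ccont (fun v => w v ^ n) zeta.
Proof. eapply is_Cderive_cont, is_Cderive_pow, w_derive. Qed.

(** Up to normalization, the coefficient of [y ^ (n + 2)] in the vector field [H = k * z / w ^ 2],
    since [z / w ^ 2] is the derivative of [y] with respect to [zeta]. *)
Let f (xi : R) (n : nat) : C :=
  CInt (fun t => k (xi, t) * (z (xi, t) * z (xi, t)) * / w (xi, t) * w (xi, t) ^ n)
    th (th + 2 * PI).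

Lemma coeff_integrand_cont (xi t : R) (n : nat) : xi < m ->
  Ccont (fun v => k v * (z v * z v) * / w v * w v ^ n) (xi, t).
Proof.
intros H; repeat apply Ccont_mult; auto using k_cont, z_cont, winv_cont, wpow_cont.
Qed.

(** [z * w ^ n] is the derivative of [- w ^ (n + 1) / (n + 1)]. It is the contribution of the
    constant 1 in the equation of [k], so the recurrence on [f] is homogeneous. The exponent -1
    admits no such primitive, hence the nonzero term in [residue_identity]. *)
Lemma z_w_pow_int (xi : R) (n : nat) :
  CInt (fun t => z (xi, t) * w (xi, t) ^ n) th (th + 2 * PI) = 0.
Proof.
assert (HS : RtoC (INR (S n)) <> 0)
  by (intros E; apply RtoC_inj in E; apply (not_0_INR (S n)) in E; auto).
apply (CInt_period (fun v => - / RtoC (INR (S n)) * w v ^ S n) (fun v => z v * w v ^ n)).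
- intros t; eapply is_Cderive_eq.
  + apply is_Cderive_mult; [Cderive|apply is_Cderive_pow, w_derive].
  + cbv beta; simpl pred; field; exact HS.
- intros t; apply Ccont_mult; [apply z_cont|apply wpow_cont].
- now rewrite w_period.
Qed.

(** Integrates the derivative of [k * z * w ^ n], that is of [H * y ^ (- n - 2)]; the terms in
    [beta] are absorbed by [1 + beta / w = z / w]. *)
Lemma coeff_recurrence (xi : R) (n : nat) : xi < m ->
  a * f xi (S n) = (res - 2 - RtoC (INR n)) * f xi n.
Proof.
intros Hxi.
pose (g n v := k v * (z v * z v) * / w v * w v ^ n).
assert (Hg : forall n t, Ccont (g n) (xi, t)) by (intros; now apply coeff_integrand_cont).
pose (dE v := z v * w v ^ n + (- a * g (S n) v + (res - 2 - RtoC (INR n)) * g n v)).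
assert (H : CInt (fun t => dE (xi, t)) th (th + 2 * PI) = 0).
{ apply (CInt_period (fun v => k v * (z v * w v ^ n)) dE).
  - intros t; eapply is_Cderive_eq.
    + apply is_Cderive_mult; [apply Hk; exact Hxi|].
      apply is_Cderive_mult; [apply z_derive|apply is_Cderive_pow, w_derive].
    + unfold dE, g, L; cbv beta.
      assert (Hw0 := Hw (xi, t) Hxi).
      fold (z (xi, t)); fold (z (xi, t)) in Hw0.
      fold (w (xi, t)); fold (w (xi, t)) in Hw0.
      assert (Ez : z (xi, t) = w (xi, t) + beta) by (unfold w; ring).
      rewrite Ez; rewrite Cpow_S.
      destruct n as [|p]; simpl pred.
      * simpl (INR 0); simpl Cpow; field; exact Hw0.
      * rewrite Cpow_S; field; exact Hw0.
  - intros t; apply Ccont_plus; [apply Ccont_mult; [apply z_cont|apply wpow_cont]|].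
    apply Ccont_plus; (apply Ccont_mult; [apply Ccont_const|apply Hg]).
  - rewrite Hper, z_period, w_period; auto. }
unfold dE in H.
rewrite CInt_plus, z_w_pow_int, Cplus_0_l, CInt_plus, !CInt_Cmult_l in H.
- fold (f xi (S n)) (f xi n) in H.
  change (CInt (fun t => g (S n) (xi, t)) th (th + 2 * PI)) with (f xi (S n)) in H.
  change (CInt (fun t => g n (xi, t)) th (th + 2 * PI)) with (f xi n) in H.
  apply Ceq_minus; rewrite <- (Copp_0), <- H; ring.
- intros t; apply Rcont_v, Hg.
- intros t; apply Rcont_v, Hg.
- intros t; apply (Rcont_v (fun v => - a * g (S n) v)).
  apply Ccont_mult; [apply Ccont_const|apply Hg].
- intros t; apply (Rcont_v (fun v => (res - 2 - RtoC (INR n)) * g n v)).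
  apply Ccont_mult; [apply Ccont_const|apply Hg].
- intros t; apply (Rcont_v (fun v => z v * w v ^ n)).
  apply Ccont_mult; [apply z_cont|apply wpow_cont].
- intros t; apply (Rcont_v (fun v => - a * g (S n) v + (res - 2 - RtoC (INR n)) * g n v)).
  apply Ccont_plus; (apply Ccont_mult; [apply Ccont_const|apply Hg]).
Qed.

Lemma k_bound_nonneg : 0 <= K.
Proof.
pose proof PI_RGT_0.
pose proof (HK (m - 1) th ltac:(lra) ltac:(lra)) as H1.
pose proof (Cmod_ge_0 (k (m - 1, th)%R)).
pose proof (exp_pos (m - 1)); nra.
Qed.

Lemma z_mod (xi t : R) : Cmod (z (xi, t)) = exp (- xi).
Proof. unfold z; rewrite Cmod_Cexp; reflexivity. Qed.

(** On a fixed circle [Cmod w <= 2 * exp (- xi)], so the integrals grow at most geometrically in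
    [n], whereas the recurrence forces a factorial growth. *)
Lemma coeff_0 (xi : R) : xi < m -> 2 * Cmod beta <= exp (- xi) -> f xi 0 = 0.
Proof.
intros Hxi Hb; pose proof PI_RGT_0; pose proof k_bound_nonneg as HK0.
pose proof (exp_pos xi) as He; pose proof (exp_pos (- xi)) as He'.
apply (factorial_recurrence (f xi) a (res - 2)
  (2 * PI * (K * exp xi * (exp (- xi) * exp (- xi)) * (2 * exp xi))) (2 * exp (- xi)));
  auto; [lra|intros n; now apply coeff_recurrence|].
intros n; unfold f.
replace (2 * PI * (K * exp xi * (exp (- xi) * exp (- xi)) * (2 * exp xi)) *
  (2 * exp (- xi)) ^ n)%R with ((th + 2 * PI - th) *
  (K * exp xi * (exp (- xi) * exp (- xi)) * (2 * exp xi) * (2 * exp (- xi)) ^ n))%R by ring.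
apply CInt_bound; [lra| |].
- intros t; apply (Rcont_v (fun v => k v * (z v * z v) * / w v * w v ^ n)).
  now apply coeff_integrand_cont.
- intros t Ht; rewrite !Cmod_mult, Cmod_pow, !z_mod.
  rewrite Cmod_inv by (apply Hw; exact Hxi).
  pose proof (Cmod_triangle_rev (z (xi, t)) beta) as H1; fold (w (xi, t)) in H1.
  pose proof (Cmod_triangle (z (xi, t)) (- beta)) as H2; rewrite Cmod_opp in H2.
  fold (z (xi, t) - beta) in H2; fold (w (xi, t)) in H2.
  rewrite z_mod in H1, H2.
  assert (Hinv : / Cmod (w (xi, t)) <= 2 * exp xi).
  { replace (2 * exp xi)%R with (/ (exp (- xi) / 2))%R
      by (rewrite exp_Ropp; field; lra).
    apply Rinv_le_contravar; lra. }
  assert (0 < / Cmod (w (xi, t))) by (apply Rinv_0_lt_compat; lra).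
  assert (0 <= exp (- xi) * exp (- xi)) by nra.
  assert (0 <= K * exp xi) by nra.
  repeat apply Rmult_le_compat; auto using Cmod_ge_0; try lra; try (now apply HK);
    try (apply pow_incr; split; [apply Cmod_ge_0|lra]); try apply pow_le, Cmod_ge_0;
    repeat apply Rmult_le_pos; auto using Cmod_ge_0; lra.
Qed.

Let g0 (v : C) : C := k v * (z v * z v) * / w v.
Let g1 (v : C) : C := k v * (z v * z v) * (/ w v * / w v).

(** With [h_j] the coefficients of [H], the derivative of [H / y] gives
    [a * h_2 + (1 - res) * h_1 = 1], and [h_2] vanishes by [coeff_0]. *)
Lemma residue_identity (xi : R) : xi < m -> 2 * Cmod beta <= exp (- xi) ->
  CInt (fun t => z (xi, t) * / w (xi, t)) th (th + 2 * PI) =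
  (1 - res) * CInt (fun t => g1 (xi, t)) th (th + 2 * PI).
Proof.
intros Hxi Hb.
assert (Hg0 : forall t, Ccont g0 (xi, t))
  by (intros; unfold g0; repeat apply Ccont_mult; auto using k_cont, z_cont, winv_cont).
assert (Hg1 : forall t, Ccont g1 (xi, t))
  by (intros; unfold g1; repeat apply Ccont_mult; auto using k_cont, z_cont, winv_cont).
assert (Hzw : forall t, Ccont (fun v => z v * / w v) (xi, t))
  by (intros; apply Ccont_mult; auto using z_cont, winv_cont).
pose (dE v := z v * / w v + (- a * g0 v + (res - 1) * g1 v)).
assert (H : CInt (fun t => dE (xi, t)) th (th + 2 * PI) = 0).
{ apply (CInt_period (fun v => k v * (z v * / w v)) dE).
  - intros t; eapply is_Cderive_eq.
    + apply is_Cderive_mult; [apply Hk; exact Hxi|].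
      apply is_Cderive_mult; [apply z_derive|].
      apply is_Cderive_Cinv; [apply Hw; exact Hxi|apply w_derive].
    + unfold dE, g0, g1, L; cbv beta.
      assert (Hw0 := Hw (xi, t) Hxi).
      fold (z (xi, t)); fold (z (xi, t)) in Hw0.
      fold (w (xi, t)); fold (w (xi, t)) in Hw0.
      assert (Ez : z (xi, t) = w (xi, t) + beta) by (unfold w; ring).
      rewrite Ez; field; exact Hw0.
  - intros t; apply Ccont_plus; [apply Hzw|].
    apply Ccont_plus; (apply Ccont_mult; [apply Ccont_const|auto]).
  - rewrite Hper, z_period, w_period; auto. }
unfold dE in H.
rewrite CInt_plus, CInt_plus, !CInt_Cmult_l in H.
- replace (CInt (fun t => g0 (xi, t)) th (th + 2 * PI)) with (RtoC 0) in H.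
  2:{ rewrite <- (coeff_0 xi Hxi Hb); apply CInt_ext; intros t; unfold g0; simpl; ring. }
  apply Ceq_minus; rewrite <- H; ring.
- intros t; now apply Rcont_v.
- intros t; now apply Rcont_v.
- intros t; apply (Rcont_v (fun v => - a * g0 v)).
  apply Ccont_mult; [apply Ccont_const|auto].
- intros t; apply (Rcont_v (fun v => (res - 1) * g1 v)).
  apply Ccont_mult; [apply Ccont_const|auto].
- intros t; now apply (Rcont_v (fun v => z v * / w v)).
- intros t; apply (Rcont_v (fun v => - a * g0 v + (res - 1) * g1 v)).
  apply Ccont_plus; (apply Ccont_mult; [apply Ccont_const|auto]).
Qed.

(** As [xi] tends to minus infinity, [g1] is [O (exp xi)] while the mean of [z / w] tends to 1. The
    constants of both errors are collected in [A], and [T] is taken so large that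
    [exp (- T) * (A + 1) < 1 / 2]. *)
Lemma laurent_contradiction : False.
Proof.
pose proof PI_RGT_0; pose proof k_bound_nonneg as HK0.
set (A := (Cmod (1 - res) * (4 * K) + 2 * Cmod beta)%R).
assert (HA : 0 <= A).
{ unfold A; pose proof (Cmod_ge_0 (1 - res)); pose proof (Cmod_ge_0 beta); nra. }
set (T := (Rabs m + 1 + 2 * (A + 1))%R).
assert (HT0 : 0 < T) by (unfold T; pose proof (Rabs_pos m); lra).
assert (HeT : T < exp T) by (pose proof (exp_ineq1 T ltac:(lra)); lra).
set (xi := (- T)%R).
assert (Hxi : xi < m).
{ unfold xi, T; pose proof (Rle_abs (- m)); rewrite Rabs_Ropp in *; lra. }
assert (Hz : exp (- xi) = exp T) by (unfold xi; f_equal; ring).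
assert (HTA : 2 * (A + 1) <= T) by (unfold T; pose proof (Rabs_pos m); lra).
assert (Hb : 2 * Cmod beta <= exp (- xi)).
{ rewrite Hz; assert (2 * Cmod beta <= A); [|lra].
  unfold A; pose proof (Cmod_ge_0 (1 - res)); nra. }
assert (Hsmall : exp xi * (A + 1) < 1 / 2).
{ unfold xi; rewrite exp_Ropp.
  apply (Rmult_lt_reg_l (exp T)); [apply exp_pos|].
  rewrite <- Rmult_assoc, Rinv_r by (apply Rgt_not_eq, exp_pos); lra. }
pose proof (exp_pos xi) as He.
assert (Hinv : forall t, Cmod (/ w (xi, t)) <= 2 * exp xi).
{ intros t; rewrite Cmod_inv by (apply Hw; exact Hxi).
  pose proof (Cmod_triangle_rev (z (xi, t)) beta) as H1; fold (w (xi, t)) in H1.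
  rewrite z_mod in H1.
  pose proof (exp_pos (- xi)).
  replace (2 * exp xi)%R with (/ (exp (- xi) / 2))%R
    by (rewrite exp_Ropp; field; lra).
  apply Rinv_le_contravar; lra. }
pose proof (residue_identity xi Hxi Hb) as E.
assert (Hg1 : forall t, Ccont g1 (xi, t))
  by (intros; unfold g1; repeat apply Ccont_mult; auto using k_cont, z_cont, winv_cont).
assert (B1 : Cmod (CInt (fun t => g1 (xi, t)) th (th + 2 * PI)) <=
  (th + 2 * PI - th) * (4 * K * exp xi)).
{ apply CInt_bound; [lra|intros t; now apply Rcont_v|].
  intros t Ht; unfold g1; rewrite !Cmod_mult, z_mod.
  specialize (HK xi t Hxi Ht); specialize (Hinv t).
  pose proof (Cmod_ge_0 (/ w (xi, t))); pose proof (Cmod_ge_0 (k (xi, t))).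
  replace (4 * K * exp xi)%R with
    (K * exp xi * (exp (- xi) * exp (- xi)) * ((2 * exp xi) * (2 * exp xi)))%R
    by (rewrite exp_Ropp; field; lra).
  pose proof (exp_pos (- xi)).
  assert (0 <= exp (- xi) * exp (- xi)) by nra.
  repeat apply Rmult_le_compat; auto; try lra; nra. }
assert (B2 : Cmod (CInt (fun t => z (xi, t) * / w (xi, t)) th (th + 2 * PI) - RtoC (2 * PI)) <=
  (th + 2 * PI - th) * (2 * Cmod beta * exp xi)).
{ replace (RtoC (2 * PI)) with (CInt (fun _ => 1) th (th + 2 * PI))
    by (rewrite CInt_const, Cmult_1_r; f_equal; ring).
  replace (CInt (fun t => z (xi, t) * / w (xi, t)) th (th + 2 * PI) -
    CInt (fun _ => 1) th (th + 2 * PI)) with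
    (CInt (fun t => z (xi, t) * / w (xi, t) + (- (1)) * 1) th (th + 2 * PI)).
  2:{ rewrite CInt_plus, CInt_Cmult_l; try ring; intros t; try apply continuous_const.
      apply (Rcont_v (fun v => z v * / w v)), Ccont_mult; auto using z_cont, winv_cont. }
  apply CInt_bound; [lra| |].
  - intros t; apply (Rcont_v (fun v => z v * / w v + (- (1)) * 1)).
    apply Ccont_plus; [|apply Ccont_const].
    apply Ccont_mult; auto using z_cont, winv_cont.
  - intros t Ht.
    assert (Hw0 : w (xi, t) <> 0) by (apply Hw; exact Hxi).
    replace (z (xi, t) * / w (xi, t) + - (1) * 1) with (beta * / w (xi, t)).
    2:{ replace (z (xi, t)) with (w (xi, t) + beta) by (unfold w; ring).
        field; exact Hw0. }
    rewrite Cmod_mult; specialize (Hinv t); pose proof (Cmod_ge_0 beta); nra. }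
rewrite E in B2.
set (I := CInt (fun t => g1 (xi, t)) th (th + 2 * PI)) in *.
pose proof (Cmod_triangle_rev (RtoC (2 * PI)) ((1 - res) * I)) as B3.
rewrite Cmod_minus_sym, Cmod_R, Rabs_right, Cmod_mult in B3 by lra.
pose proof (Cmod_ge_0 (1 - res)) as Hr0.
assert (Cmod (1 - res) * Cmod I <= Cmod (1 - res) * ((th + 2 * PI - th) * (4 * K * exp xi)))
  by (apply Rmult_le_compat_l; auto).
assert (2 * PI <= 2 * PI * (exp xi * A)) by (unfold A; lra).
nra.
Qed.

End Laurent.

(** * Asymptotic values with at most one simple pole *)

Lemma exp_gt_self (x : R) : x < exp x.
Proof.
destruct (Req_dec x 0) as [->|H]; [rewrite exp_0; lra|].
pose proof (exp_ineq1 x H); lra.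
Qed.

Lemma exp_le_mono (x y : R) : x <= y -> exp x <= exp y.
Proof.
intros H; destruct (Req_dec x y) as [->|Hne]; [lra|].
apply Rlt_le, exp_increasing; lra.
Qed.

(** This is [q < exp q] for [q = al * t / (n + 1)], raised to the power [n + 1]. The factor [/ t] is
    what gives decay later, with [t = exp (- Re zeta)]. *)
Lemma pow_exp_bound (al t : R) (n : nat) :
  0 < al -> 0 < t -> t ^ n * exp (- (al * t)) <= (INR (S n) / al) ^ S n / t.
Proof.
intros Hal Ht.
assert (HS : 0 < INR (S n)) by (apply lt_0_INR; lia).
set (c := (INR (S n) / al)%R).
assert (Hc : 0 < c) by (apply Rdiv_lt_0_compat; lra).
set (q := (t * / c)%R).
assert (Hq : 0 < q) by (apply Rmult_lt_0_compat; [|apply Rinv_0_lt_compat]; lra).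
assert (E : q ^ S n <= exp (al * t)).
{ replace (al * t)%R with (INR (S n) * q)%R by (unfold q, c; field; lra).
  apply Rle_trans with (exp q ^ S n)%R.
  - apply pow_incr; split; [lra|]; apply Rlt_le, exp_gt_self.
  - rewrite <- Rpower_pow by apply exp_pos.
    unfold Rpower; rewrite ln_exp; lra. }
rewrite exp_Ropp.
assert (Hqp : 0 < q ^ S n) by (apply pow_lt; auto).
assert (Htp : 0 < t ^ n) by (apply pow_lt; auto).
apply Rle_trans with (t ^ n * / q ^ S n)%R.
- apply Rmult_le_compat_l; [lra|]; apply Rinv_le_contravar; auto.
- assert (Hcp : 0 < c ^ S n) by (apply pow_lt; auto).
  right; unfold q; rewrite Rpow_mult_distr, pow_inv.
  set (C := (c ^ S n)%R) in *; simpl; field; lra.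
Qed.

Lemma exp_large (X xi : R) : xi < - X -> X < exp (- xi).
Proof. intros H; pose proof (exp_gt_self (- xi)); lra. Qed.

Lemma asymptotic_value_radial (eps th : R) (phi : C -> C) (v : C) :
  asymptotic_value eps phi th v ->
  forall e, 0 < e -> exists M, forall x, x < M -> Cmod (phi (x, th) - v) < e.
Proof.
intros H.
set (x0 := (ln eps - 1)%R).
(* Paths are indexed by the whole real line and have to stay in the cover: [- Rabs t] folds the line
   onto a half-line. *)
assert (Hf : filterlim (fun t => phi (x0 - Rabs t, th)%R) (Rbar_locally p_infty) (locally v)).
{ apply (H (fun t => (x0 - Rabs t, th)%R)).
  - intros t; apply (proj2 (Rcont_eps _ t)); intros e He; exists e; split; auto; intros s Hs.
    replace ((x0 - Rabs s, th)%R - (x0 - Rabs t, th)%R) with (RtoC (Rabs t - Rabs s))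
      by (apply Ceq_re_im; unfold Re, Im; simpl; ring).
    rewrite Cmod_R; eapply Rle_lt_trans; [apply Rabs_triang_inv2|].
    now rewrite Rabs_minus_sym.
  - intros t; unfold in_cover; simpl; pose proof (Rabs_pos t); unfold x0; lra.
  - apply filterlim_Cmod; intros e He.
    exists (Rabs (x0 - ln e)); intros t Ht.
    replace (Cexp (x0 - Rabs t, th)%R - 0) with (Cexp (x0 - Rabs t, th)%R) by ring.
    rewrite Cmod_Cexp; simpl.
    apply Rlt_le_trans with (exp (ln e)); [apply exp_increasing|rewrite exp_ln; lra].
    pose proof (Rle_abs (x0 - ln e)); pose proof (Rle_abs t); lra.
  - simpl; apply filterlim_const. }
intros e He.
destruct (proj1 (filterlim_Cmod _ _) Hf e He) as [M HM].
exists (x0 - Rabs M)%R; intros x Hx.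
specialize (HM (x0 - x)%R).
replace (x0 - Rabs (x0 - x))%R with x in HM.
- apply HM; pose proof (Rle_abs M); lra.
- rewrite Rabs_right; [ring|]; pose proof (Rabs_pos M); lra.
Qed.

(** [psi] is the derivative with respect to [zeta]; its extra factor [Cexp zeta] adds 1 to the
    logarithmic derivative. *)
Lemma developing_map_derivative (Gamma : C -> C) (eps : R) (phi : C -> C) :
  developing_map Gamma eps phi ->
  exists psi : C -> C, forall zeta, Re zeta < ln eps ->
    is_Cderive phi zeta (psi zeta) /\ psi zeta <> 0 /\
    is_Cderive psi zeta ((Gamma (Cexp zeta) * Cexp zeta + 1) * psi zeta).
Proof.
intros (p1 & p2 & H); exists (fun zeta => p1 zeta * Cexp zeta); intros zeta Hz.
destruct (H zeta Hz) as (H1 & H2 & H3 & H4).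
split; [exact H1|split].
- apply Cmult_neq_0; auto using Cexp_neq_0.
- eapply is_Cderive_eq; [apply is_Cderive_mult; [exact H3|apply is_Cderive_Cexp]|].
  rewrite <- H4; field; auto.
Qed.

Definition period : C := (0, 2 * PI)%R.

Lemma Cexp_period (zeta : C) : Cexp (zeta + period) = Cexp zeta.
Proof.
destruct zeta as [x y]; rewrite <- Cexp_add_2PI; f_equal.
apply Ceq_re_im; unfold Re, Im; simpl; ring.
Qed.

Lemma Cexp_period_Z (x y : R) (k : Z) : Cexp (x, y + 2 * PI * IZR k)%R = Cexp (x, y).
Proof.
induction k as [|k IH|k IH] using Z.peano_ind.
- f_equal; f_equal; ring.
- rewrite <- IH, <- (Cexp_add_2PI x (y + 2 * PI * IZR k)), succ_IZR; f_equal; f_equal; ring.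
- rewrite <- IH, <- (Cexp_add_2PI x (y + 2 * PI * IZR (Z.pred k))), <- Z.sub_1_r, minus_IZR.
  f_equal; f_equal; ring.
Qed.

Lemma pair_period (x y : R) : ((x, y) : C) + period = (x, y + 2 * PI)%R.
Proof. apply Ceq_re_im; unfold Re, Im; simpl; ring. Qed.

Lemma is_Cderive_shift (f : C -> C) (z c l : C) :
  is_Cderive f (z + c) l -> is_Cderive (fun w => f (w + c)) z l.
Proof.
intros H; eapply is_Cderive_eq; [apply (is_Cderive_comp f (fun w => w + c));
  [Cderive|exact H]|ring].
Qed.

(** The quotient of two solutions has zero derivative on a half-plane. With [primitive_unique], this
    is the uniqueness of developing maps up to affine maps. *)
Lemma log_derivative_unique (psi psi' L : C -> C) (m : R) :
  (forall zeta, Re zeta < m -> psi zeta <> 0 /\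
    is_Cderive psi zeta (L zeta * psi zeta) /\ is_Cderive psi' zeta (L zeta * psi' zeta)) ->
  exists c, forall zeta, Re zeta < m -> psi' zeta = c * psi zeta.
Proof.
intros H.
set (z0 := (m - 1, 0)%R : C).
assert (Hz0 : Re z0 < m) by (simpl; lra).
exists (psi' z0 / psi z0); intros zeta Hz.
assert (E : psi' zeta / psi zeta = psi' z0 / psi z0).
{ apply (is_Cderive_zero_const (fun v => psi' v / psi v) m); auto; intros v Hv.
  destruct (H v Hv) as (H1 & H2 & H3).
  eapply is_Cderive_eq; [apply is_Cderive_div; eauto|]; cbv beta; field; auto. }
rewrite <- E; field; apply H; auto.
Qed.

Lemma primitive_unique (phi phi' psi : C -> C) (c : C) (m : R) :
  (forall zeta, Re zeta < m -> is_Cderive phi zeta (psi zeta)) ->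
  (forall zeta, Re zeta < m -> is_Cderive phi' zeta (c * psi zeta)) ->
  exists b, forall zeta, Re zeta < m -> phi' zeta = c * phi zeta + b.
Proof.
intros H H'.
set (z0 := (m - 1, 0)%R : C).
assert (Hz0 : Re z0 < m) by (simpl; lra).
exists (phi' z0 - c * phi z0); intros zeta Hz.
assert (E : phi' zeta - c * phi zeta = phi' z0 - c * phi z0).
{ apply (is_Cderive_zero_const (fun v => phi' v - c * phi v) m); auto; intros v Hv.
  eapply is_Cderive_eq; [Cderive; eauto|cbv beta; ring]. }
rewrite <- E; ring.
Qed.

Lemma limit_unique (f g : R -> C) (u v : C) :
  (forall e, 0 < e -> exists M, forall x, x < M -> Cmod (f x - u) < e) ->
  (forall e, 0 < e -> exists M, forall x, x < M -> Cmod (g x - v) < e) ->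
  (exists M, forall x, x < M -> f x = g x) -> u = v.
Proof.
intros Hf Hg [M0 H0]; apply Ceq_minus, Cmod_eq_0, Rle_antisym; [|apply Cmod_ge_0].
apply le_epsilon; intros e He; rewrite Rplus_0_l.
destruct (Hf (e / 2)%R ltac:(lra)) as [M1 H1], (Hg (e / 2)%R ltac:(lra)) as [M2 H2].
set (x := (Rmin M0 (Rmin M1 M2) - 1)%R).
assert (x < M0) by (unfold x; pose proof (Rmin_l M0 (Rmin M1 M2)); lra).
assert (x < Rmin M1 M2) by (unfold x; pose proof (Rmin_r M0 (Rmin M1 M2)); lra).
pose proof (Rmin_l M1 M2); pose proof (Rmin_r M1 M2).
specialize (H0 x ltac:(lra)); specialize (H1 x ltac:(lra)); specialize (H2 x ltac:(lra)).
rewrite <- H0 in H2; rewrite Cmod_minus_sym in H1.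
pose proof (Cmod_minus_triangle u (f x) v); lra.
Qed.

Lemma limit_affine (f : R -> C) (u c b : C) :
  (forall e, 0 < e -> exists M, forall x, x < M -> Cmod (f x - u) < e) ->
  forall e, 0 < e -> exists M, forall x, x < M -> Cmod (c * f x + b - (c * u + b)) < e.
Proof.
intros H e He; pose proof (Cmod_ge_0 c) as Hc.
destruct (H (e / (Cmod c + 1))%R) as [M HM]; [apply Rdiv_lt_0_compat; lra|].
exists M; intros x Hx; specialize (HM x Hx).
replace (c * f x + b - (c * u + b)) with (c * (f x - u)) by ring.
rewrite Cmod_mult; pose proof (Cmod_ge_0 (f x - u)).
assert (e / (Cmod c + 1) * (Cmod c + 1) = e)%R by (field; lra).
nra.
Qed.

(* The Christoffel symbols at a double pole that occur with at most one simple pole: with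
   [y = x / (1 - beta * x)], this is [a / y ^ 2 - res / y] in the coordinate [y]. *)
Definition one_pole_form (Gamma : C -> C) (a res beta : C) (rho : R) : Prop :=
  a <> 0 /\ 0 < rho /\ forall x : C, x <> 0 -> Cmod x < rho ->
  Gamma x = a / x ^ 2 - res / x + (2 - res) * beta / (1 - beta * x).

(** The condition makes [Cmod (Cexp (- zeta))] exceed [/ rho + Cmod beta + 1]: the first term places
    [Cexp zeta] in the disk of validity, the others keep it away from the simple pole. *)
Lemma one_pole_form_cover (Gamma : C -> C) (a res beta : C) (rho : R) (zeta : C) :
  one_pole_form Gamma a res beta rho -> Re zeta < - (/ rho + Cmod beta + 1) ->
  1 <= Cmod (Cexp (- zeta) - beta) /\
  Gamma (Cexp zeta) * Cexp zeta + 1 =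
  a * Cexp (- zeta) + (1 - res) + (2 - res) * beta / (Cexp (- zeta) - beta).
Proof.
intros (Ha & Hrho & HG) Hz.
apply exp_large in Hz.
assert (Hir := Rinv_0_lt_compat _ Hrho).
pose proof (Cmod_ge_0 beta).
assert (H1 : 1 <= Cmod (Cexp (- zeta) - beta)).
{ pose proof (Cmod_triangle_rev (Cexp (- zeta)) beta) as H1.
  rewrite Cmod_Cexp, re_opp in H1; lra. }
split; auto.
assert (Hx : Cmod (Cexp zeta) < rho).
{ rewrite Cmod_Cexp; rewrite <- (Rinv_inv rho), <- (Ropp_involutive (Re zeta)), exp_Ropp.
  apply Rinv_lt_contravar; [|lra].
  apply Rmult_lt_0_compat; [auto|lra]. }
rewrite (HG _ (Cexp_neq_0 zeta) Hx).
assert (Hw : Cexp (- zeta) - beta <> 0) by (apply Cmod_gt_0; lra).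
rewrite Cexp_opp in *.
set (x := Cexp zeta) in *.
assert (Hx0 : x <> 0) by apply Cexp_neq_0.
assert (Hx1 : 1 - beta * x <> 0).
{ intros E; apply Hw; replace (/ x - beta) with ((1 - beta * x) / x) by (field; auto).
  rewrite E; unfold Cdiv; ring. }
field; auto.
Qed.

(** By the sign in [repelling_arg], [a * Cexp (- zeta)] is real and positive on the half-line
    [Im zeta = th], so that [psi] decays there towards the pole. *)
Lemma asymptotic_family_one_pole (Gamma : C -> C) (a res beta : C) (rho : R) (u : Z -> C) :
  one_pole_form Gamma a res beta rho ->
  (forall b, principal_part Gamma 0 2 b -> b 2%nat = a) ->
  asymptotic_family Gamma u ->
  exists (phi psi : C -> C) (al th m : R),
    0 < al /\ a * Cexp (- (Ci * RtoC th)) = RtoC al /\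
    (forall n e, 0 < e -> exists M, forall x, x < M ->
      Cmod (phi (x, th + 2 * PI * IZR n)%R - u n) < e) /\
    (forall zeta, Re zeta < m ->
      let L := a * Cexp (- zeta) + (1 - res) + (2 - res) * beta / (Cexp (- zeta) - beta) in
      1 <= Cmod (Cexp (- zeta) - beta) /\ is_Cderive phi zeta (psi zeta) /\
      psi zeta <> 0 /\ is_Cderive psi zeta (L * psi zeta)).
Proof.
intros HG Ha (b & eps & th & phi & Hpp & _ & _ & Hdev & Hrep & Hval).
destruct (developing_map_derivative _ _ _ Hdev) as [psi Hpsi].
rewrite (Ha b Hpp) in Hrep; destruct Hrep as [Hi Hr].
set (W := Cexp (- (Ci * RtoC th))) in *.
exists phi, psi, (Re (a * W)), th, (Rmin (ln eps) (- (/ rho + Cmod beta + 1))).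
assert (E : - a * W = - (a * W)) by ring; rewrite E in Hi, Hr.
rewrite im_opp in Hi; rewrite re_opp in Hr.
split; [lra|split]; [|split].
- fold W; apply Ceq_re_im; rewrite ?re_RtoC, ?im_RtoC; lra.
- intros n; apply (asymptotic_value_radial eps), Hval.
- intros zeta Hz L.
  pose proof (Rmin_l (ln eps) (- (/ rho + Cmod beta + 1))) as M1.
  pose proof (Rmin_r (ln eps) (- (/ rho + Cmod beta + 1))) as M2.
  destruct (one_pole_form_cover _ _ _ _ _ zeta HG) as [H1 H2]; [lra|].
  destruct (Hpsi zeta) as (P1 & P2 & P3); [lra|].
  rewrite H2 in P3; auto.
Qed.

Lemma one_pole_constant_integer (Gamma : C -> C) (a res beta : C) (rho : R) (u : Z -> C) :
  one_pole_form Gamma a res beta rho ->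
  (forall b, principal_part Gamma 0 2 b -> b 2%nat = a) ->
  asymptotic_family Gamma u -> (forall n, u n = u 0%Z) ->
  exists n, res - 2 = RtoC (INR n).
Proof.
intros HG HA Hu Hconst.
destruct (asymptotic_family_one_pole _ _ _ _ _ _ HG HA Hu)
  as (phi & psi & al & th & m & Hal & Hth & Hlim & H).
destruct (Classical_Prop.classic (exists n, res - 2 = RtoC (INR n))) as [|Hn]; [auto|exfalso].
assert (Ha : a <> 0) by apply HG.
pose proof PI_RGT_0 as Hpi.
set (L := fun zeta => a * Cexp (- zeta) + (1 - res) + (2 - res) * beta / (Cexp (- zeta) - beta)).
assert (Lper : forall zeta, L (zeta + period) = L zeta).
{ intros zeta; unfold L; now rewrite !Cexp_opp, !Cexp_period. }
assert (Rper : forall zeta, Re (zeta + period) = Re zeta)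
  by (intros; rewrite re_plus; simpl; ring).
destruct (log_derivative_unique psi (fun v => psi (v + period)) L m) as [mu Hmu].
{ intros zeta Hz; destruct (H zeta Hz) as (_ & _ & H2 & H3); split; [auto|split; [auto|]].
  rewrite <- Lper; apply is_Cderive_shift, H; now rewrite Rper. }
destruct (primitive_unique phi (fun v => phi (v + period)) psi mu m) as [b Hb].
{ intros zeta Hz; apply H, Hz. }
{ intros zeta Hz; rewrite <- Hmu by auto; apply is_Cderive_shift, H; now rewrite Rper. }
set (U := u 0%Z) in *.
assert (Hlim0 : forall e, 0 < e -> exists M, forall x, x < M -> Cmod (phi (x, th) - U) < e).
{ intros e He; destruct (Hlim 0%Z e He) as [M HM]; exists M; intros x Hx.
  specialize (HM x Hx); replace (th + 2 * PI * 0)%R with th in HM by ring; exact HM. }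
(* Comparing the limits on two consecutive half-lines. Hence a period multiplies [phi - U] by [mu],
   as it does [psi], and the quotient of the two is periodic. *)
assert (HU : U = mu * U + b).
{ apply (limit_unique (fun x => phi (x, th + 2 * PI * 1)%R) (fun x => mu * phi (x, th) + b)).
  - intros e He; destruct (Hlim 1%Z e He) as [M HM]; rewrite Hconst in HM; eauto.
  - apply (limit_affine (fun x => phi (x, th))); auto.
  - exists m; intros x Hx.
    rewrite <- Hb by auto; rewrite pair_period, Rmult_1_r; reflexivity. }
(* [Bd] bounds the terms of [L] other than [a * Cexp (- zeta)], since [Cexp (- zeta) - beta] has
   modulus at least 1. To the left of [- X], the condition [4 * Bd <= al * exp (- xi - 2)] of
   [strip_estimate] holds. *)
set (Bd := (Cmod (1 - res) + Cmod ((2 - res) * beta))%R).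
assert (HBd : 0 <= Bd) by (unfold Bd; pose proof (Cmod_ge_0 (1 - res));
  pose proof (Cmod_ge_0 ((2 - res) * beta)); lra).
set (X := (4 * Bd * exp 2 / al)%R).
assert (HX : 0 <= X) by (apply Rdiv_le_0_compat; [pose proof (exp_pos 2); nra|lra]).
set (m' := Rmin (m - 2) (- X)).
assert (Hm'1 : m' <= m - 2) by apply Rmin_l.
assert (Hm'2 : m' <= - X) by apply Rmin_r.
assert (Hest : forall xi t, xi < m' -> th - PI <= t <= th - PI + 2 * PI ->
  Cmod (phi (xi, t) - U) <= 12 / al * exp (xi + 2) * Cmod (psi (xi, t))).
{ intros xi t Hxi Ht.
  assert (Hs : exists s w, (s = 1 \/ s = - 1)%R /\ 0 <= w <= PI /\ (t = th + s * w)%R).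
  { destruct (Rle_or_lt th t).
    - exists 1%R, (t - th)%R; repeat split; try lra; auto.
    - exists (- 1)%R, (th - t)%R; repeat split; try lra; auto. }
  destruct Hs as (s & w & Hs & Hw & ->).
  apply (strip_estimate phi psi L a U th al Bd m xi w s); auto; try lra.
  - intros zeta Hz; destruct (H zeta Hz) as (H1 & H2 & _ & H3); split; [auto|split; [auto|]].
    replace (L zeta - a * Cexp (- zeta)) with
      ((1 - res) + (2 - res) * beta / (Cexp (- zeta) - beta)) by (unfold L; ring).
    assert (Hw0 : Cexp (- zeta) - beta <> 0) by (apply Cmod_gt_0; lra).
    eapply Rle_trans; [apply Cmod_triangle|]; apply Rplus_le_compat_l.
    rewrite Cmod_div by auto.
    rewrite <- (Rdiv_1_r (Cmod ((2 - res) * beta))) at 2.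
    apply Rmult_le_compat_l; [apply Cmod_ge_0|apply Rinv_le_contravar; lra].
  - pose proof (exp_large X xi ltac:(lra)) as Hex.
    replace (- xi - 2)%R with (- xi + - (2))%R by ring; rewrite exp_plus, (exp_Ropp 2).
    pose proof (exp_pos 2) as He2.
    apply (Rmult_le_reg_r (exp 2 / al)); [apply Rdiv_lt_0_compat; lra|].
    replace (al * (exp (- xi) * / exp 2) * (exp 2 / al))%R with (exp (- xi)) by (field; lra).
    unfold X in Hex; lra. }
assert (Hk : forall zeta, Re zeta < m' ->
  is_Cderive (fun v => (phi v - U) / psi v) zeta (1 - L zeta * ((phi zeta - U) / psi zeta))).
{ intros zeta Hz; destruct (H zeta) as (_ & H1 & H2 & H3); [lra|].
  eapply is_Cderive_eq.
  - Cderive; exact H2.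
  - fold (L zeta); cbv beta; field; auto. }
apply (laurent_contradiction (fun v => (phi v - U) / psi v) a res beta m' (th - PI)
  (12 / al * exp 2)); auto.
- intros n E; apply Hn; eauto.
- intros zeta Hz; destruct (H zeta) as (H1 & _); [lra|].
  apply Cmod_gt_0; lra.
- intros xi Hxi; rewrite <- pair_period.
  assert (Hre : Re (xi, th - PI)%R < m) by (simpl; lra).
  rewrite (Hb (xi, th - PI)%R Hre), (Hmu (xi, th - PI)%R Hre).
  destruct (H (xi, th - PI)%R Hre) as (_ & _ & H2 & _).
  assert (Hmu0 : mu <> 0).
  { intros E; destruct (H ((xi, th - PI)%R + period)) as (_ & _ & H4 & _);
      [rewrite Rper; auto|].
    apply H4; rewrite (Hmu (xi, th - PI)%R Hre), E; ring. }
  rewrite HU at 1; field; auto.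
- intros xi t Hxi Ht.
  destruct (H (xi, t)) as (_ & _ & H2 & _); [simpl; lra|].
  rewrite Cmod_div by auto.
  assert (Hp := proj1 (Cmod_gt_0 _) H2).
  apply (Rmult_le_reg_r (Cmod (psi (xi, t)))); auto.
  unfold Rdiv at 1; rewrite Rmult_assoc, Rinv_l, Rmult_1_r by lra.
  replace (12 / al * exp 2 * exp xi)%R with (12 / al * exp (xi + 2))%R
    by (rewrite exp_plus; ring).
  auto.
Qed.

(** Integration by parts for the integral of [exp (- a * s) * (s - beta) ^ n] from [z] to infinity,
    in a direction where it converges; hence the sign of its derivative. *)
Fixpoint exp_poly (a beta : C) (n : nat) (z : C) : C :=
  match n with
  | O => / a * Cexp (- (a * z))
  | S p => / a * (Cexp (- (a * z)) * (z - beta) ^ S p + RtoC (INR (S p)) * exp_poly a beta p z)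
  end.

Lemma is_Cderive_exp_poly (a beta : C) (n : nat) (z : C) :
  a <> 0 ->
  is_Cderive (exp_poly a beta n) z (- (Cexp (- (a * z)) * (z - beta) ^ n)).
Proof.
intros Ha.
assert (HE : is_Cderive (fun z => Cexp (- (a * z))) z (Cexp (- (a * z)) * - a)).
{ eapply is_Cderive_eq; [Cderive|cbv beta; ring]. }
induction n as [|n IH].
- simpl exp_poly; eapply is_Cderive_eq; [Cderive|cbv beta; simpl; field; auto].
- cbn [exp_poly]; eapply is_Cderive_eq; [Cderive|cbv beta; simpl pred; field; auto].
Qed.

(** On a repelling half-line [a * z] is [al * exp (- x)], real and positive, so the exponential
    beats all powers of [z - beta]. *)
Lemma exp_poly_limit (a beta : C) (al th : R) (n : nat) :
  0 < al -> a * Cexp (- (Ci * RtoC th)) = RtoC al -> forall e, 0 < e ->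
  exists M, forall x, x < M -> Cmod (exp_poly a beta n (Cexp (- (x, th)%R))) < e.
Proof.
intros Hal Hth.
assert (Hz : forall x, a * Cexp (- (x, th)%R) = RtoC (al * exp (- x))).
{ intros x.
  replace (- (x, th)%R) with (- (Ci * RtoC th) + RtoC (- x))
    by (apply Ceq_re_im; unfold Re, Im; simpl; ring).
  rewrite Cexp_plus, Cmult_assoc, Hth, RtoC_mult; f_equal.
  apply Ceq_re_im; rewrite ?re_Cexp, ?im_Cexp, ?re_RtoC, ?im_RtoC, ?cos_0, ?sin_0; ring. }
assert (Ha : a <> 0).
{ intros E; rewrite E, Cmult_0_l in Hth; apply RtoC_inj in Hth; lra. }
assert (Hterm : forall p e, 0 < e -> exists M, forall x, x < M ->
  Cmod (Cexp (- (a * Cexp (- (x, th)%R))) * (Cexp (- (x, th)%R) - beta) ^ p) < e).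
{ intros p e He.
  set (K := ((INR (S p) / al) ^ S p * 2 ^ p)%R).
  assert (HK : 0 <= K).
  { unfold K; apply Rmult_le_pos; apply pow_le; [|lra].
    apply Rdiv_le_0_compat; [apply pos_INR|lra]. }
  exists (- (Cmod beta + (K + 1) / e))%R; intros x Hx; apply exp_large in Hx.
  pose proof (Cmod_ge_0 beta).
  assert (HKe : 0 < (K + 1) / e) by (apply Rdiv_lt_0_compat; lra).
  set (t := exp (- x)) in *.
  assert (Ht : 0 < t) by apply exp_pos.
  rewrite Cmod_mult, Cmod_pow, Cmod_Cexp, Hz, re_opp, re_RtoC; fold t.
  assert (Hw : Cmod (Cexp (- (x, th)%R) - beta) <= 2 * t).
  { eapply Rle_trans; [apply Cmod_triangle|]; rewrite Cmod_opp, Cmod_Cexp; simpl; fold t; lra. }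
  apply Rle_lt_trans with (exp (- (al * t)) * (2 * t) ^ p)%R.
  - apply Rmult_le_compat_l; [apply Rlt_le, exp_pos|].
    apply pow_incr; split; [apply Cmod_ge_0|auto].
  - rewrite Rpow_mult_distr.
    replace (exp (- (al * t)) * (2 ^ p * t ^ p))%R with
      (2 ^ p * (t ^ p * exp (- (al * t))))%R by ring.
    pose proof (pow_exp_bound al t p Hal Ht) as Hb.
    assert (0 < 2 ^ p) by (apply pow_lt; lra).
    apply Rle_lt_trans with (2 ^ p * ((INR (S p) / al) ^ S p / t))%R.
    + apply Rmult_le_compat_l; lra.
    + replace (2 ^ p * ((INR (S p) / al) ^ S p / t))%R with (K / t)%R by (unfold K, Rdiv; ring).
      apply (Rmult_lt_reg_r t); auto.
      unfold Rdiv; rewrite Rmult_assoc, Rinv_l, Rmult_1_r by lra.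
      assert ((K + 1) / e * e = K + 1)%R by (field; lra).
      nra. }
assert (Hai : 0 < Cmod (/ a))
  by (apply Cmod_gt_0; intros E; apply C1_nz; rewrite <- (Cinv_r a Ha), E; ring).
induction n as [|n IH]; intros e He.
- destruct (Hterm 0%nat (e / Cmod (/ a))%R) as [M HM]; [apply Rdiv_lt_0_compat; auto|].
  exists M; intros x Hx; specialize (HM x Hx).
  simpl in HM; rewrite Cmult_1_r in HM.
  simpl exp_poly; rewrite Cmod_mult.
  apply (Rmult_lt_compat_l (Cmod (/ a))) in HM; auto.
  replace (Cmod (/ a) * (e / Cmod (/ a)))%R with e in HM by (field; lra); exact HM.
- set (q := INR (S n)).
  assert (Hq : 0 < q) by (apply lt_0_INR; lia).
  destruct (Hterm (S n) (e / 2 / Cmod (/ a))%R) as [M1 HM1];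
    [repeat apply Rdiv_lt_0_compat; lra|].
  destruct (IH (e / 2 / Cmod (/ a) / q)%R) as [M2 HM2];
    [repeat apply Rdiv_lt_0_compat; lra|].
  exists (Rmin M1 M2); intros x Hx.
  pose proof (Rmin_l M1 M2); pose proof (Rmin_r M1 M2).
  specialize (HM1 x ltac:(lra)); specialize (HM2 x ltac:(lra)).
  cbn [exp_poly]; rewrite Cmod_mult.
  set (T1 := Cexp (- (a * Cexp (- (x, th)%R))) * (Cexp (- (x, th)%R) - beta) ^ S n) in *.
  set (T2 := exp_poly a beta n (Cexp (- (x, th)%R))) in *.
  fold q.
  apply Rle_lt_trans with (Cmod (/ a) * (Cmod T1 + q * Cmod T2))%R.
  + apply Rmult_le_compat_l; [lra|].
    eapply Rle_trans; [apply Cmod_triangle|].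
    rewrite Cmod_mult, Cmod_R, (Rabs_right q) by lra; lra.
  + assert (E2 : q * Cmod T2 < e / 2 / Cmod (/ a)).
    { apply (Rmult_lt_compat_l q) in HM2; auto.
      replace (q * (e / 2 / Cmod (/ a) / q))%R with (e / 2 / Cmod (/ a))%R in HM2
        by (field; lra); exact HM2. }
    replace e with (Cmod (/ a) * (e / 2 / Cmod (/ a) + e / 2 / Cmod (/ a)))%R at 1
      by (field; lra).
    apply Rmult_lt_compat_l; lra.
Qed.

(** An explicit map with derivative [psi0] tends to 0 on all the half-lines. It is an affine
    function of [phi], so all the [u k] solve the same equation [c * u k + b = 0], where [c] is
    nonzero. *)
Lemma one_pole_integer_constant (Gamma : C -> C) (a res beta : C) (rho : R) (u : Z -> C) (n : nat) :
  one_pole_form Gamma a res beta rho ->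
  (forall b, principal_part Gamma 0 2 b -> b 2%nat = a) ->
  asymptotic_family Gamma u -> res = 2 + RtoC (INR n) -> forall k l, u k = u l.
Proof.
intros HG HA Hu Hres.
destruct (asymptotic_family_one_pole _ _ _ _ _ _ HG HA Hu)
  as (phi & psi & al & th & m & Hal & Hth & Hlim & H).
assert (Ha : a <> 0) by apply HG.
set (L := fun zeta => a * Cexp (- zeta) + (1 - res) + (2 - res) * beta / (Cexp (- zeta) - beta)).
pose (z := fun zeta => Cexp (- zeta)).
assert (Hz : forall zeta, is_Cderive z zeta (- z zeta)).
{ intros; unfold z; eapply is_Cderive_eq; [Cderive|ring]. }
pose (psi0 := fun zeta => Cexp (- (a * z zeta)) * (z zeta - beta) ^ n * z zeta).
assert (Hphi0 : forall zeta, is_Cderive (fun v => exp_poly a beta n (z v)) zeta (psi0 zeta)).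
{ intros zeta; eapply is_Cderive_eq; [apply (is_Cderive_comp (exp_poly a beta n) z)|].
  - apply Hz.
  - now apply is_Cderive_exp_poly.
  - unfold psi0; ring. }
destruct (log_derivative_unique psi psi0 L m) as [c Hc].
{ intros zeta Hzeta; destruct (H zeta Hzeta) as (H1 & _ & H2 & H3); split; [auto|split; [auto|]].
  assert (Hw : z zeta - beta <> 0) by (apply Cmod_gt_0; unfold z; lra).
  eapply is_Cderive_eq.
  - unfold psi0; Cderive; apply Hz.
  - unfold psi0, L; fold (z zeta); cbv beta; rewrite Hres.
    destruct n as [|p]; simpl pred.
    + simpl (INR 0); simpl Cpow; field; auto.
    + rewrite Cpow_S; field; auto. }
destruct (primitive_unique phi (fun v => exp_poly a beta n (z v)) psi c m) as [b Hb].
{ intros zeta Hzeta; apply H, Hzeta. }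
{ intros zeta Hzeta; rewrite <- Hc by auto; apply Hphi0. }
assert (Hu0 : forall k, c * u k + b = 0).
{ intros k.
  apply (limit_unique (fun x => c * phi (x, th + 2 * PI * IZR k)%R + b)
    (fun x => exp_poly a beta n (z (x, th + 2 * PI * IZR k)%R))).
  - apply (limit_affine (fun x => phi (x, th + 2 * PI * IZR k)%R)), Hlim.
  - intros e He.
    destruct (exp_poly_limit a beta al (th + 2 * PI * IZR k) n Hal) with (e := e)
      as [M HM]; auto.
    + rewrite <- Hth, !Cexp_opp; do 2 f_equal.
      replace (Ci * RtoC (th + 2 * PI * IZR k)) with ((0, th + 2 * PI * IZR k)%R : C)
        by (apply Ceq_re_im; unfold Re, Im; simpl; ring).
      rewrite Cexp_period_Z; f_equal; apply Ceq_re_im; unfold Re, Im; simpl; ring.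
    + exists M; intros x Hx; unfold z.
      replace (exp_poly a beta n (Cexp (- (x, th + 2 * PI * IZR k)%R)) - 0) with
        (exp_poly a beta n (Cexp (- (x, th + 2 * PI * IZR k)%R))) by ring.
      auto.
  - exists m; intros x Hx; rewrite <- Hb; auto. }
assert (Hc0 : c <> 0).
{ intros E.
  destruct (H (m - 1, 0)%R) as (H1 & _); [simpl; lra|].
  assert (Hp : psi0 (m - 1, 0)%R = 0) by (rewrite Hc, E; [ring|simpl; lra]).
  revert Hp; unfold psi0, z; repeat apply Cmult_neq_0; auto using Cexp_neq_0.
  apply Cpow_nz, Cmod_gt_0; lra. }
intros k l.
assert (E : c * (u k - u l) = 0).
{ replace (c * (u k - u l)) with ((c * u k + b) - (c * u l + b)) by ring.
  rewrite !Hu0; ring. }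
apply Ceq_minus; destruct (Ceq_dec (u k - u l) 0) as [E'|E']; auto.
exfalso; now apply (Cmult_neq_0 c (u k - u l)).
Qed.

(** * Principal parts *)

Definition polar_sum (a : nat -> C) (n : nat) (x : C) : C :=
  sum_n_m (G := C_AbelianMonoid) (fun k => a k / x ^ k) 1 n.

Lemma polar_sum_0 (a : nat -> C) (x : C) : polar_sum a 0 x = 0.
Proof. unfold polar_sum; now rewrite sum_n_m_zero by lia. Qed.

Lemma polar_sum_S (a : nat -> C) (n : nat) (x : C) :
  polar_sum a (S n) x = polar_sum a n x + a (S n) / x ^ S n.
Proof. unfold polar_sum; rewrite sum_n_Sm by lia; reflexivity. Qed.

Lemma polar_sum_1 (a : nat -> C) (x : C) : polar_sum a 1 x = a 1%nat / x.
Proof. rewrite polar_sum_S, polar_sum_0, Cpow_1_r; ring. Qed.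

Lemma polar_sum_2 (a : nat -> C) (x : C) :
  polar_sum a 2 x = a 2%nat / x ^ 2 + a 1%nat / x.
Proof. rewrite polar_sum_S, polar_sum_1; ring. Qed.

(** [principal_part] leaves the values of [a] beyond the order arbitrary; replacing them by 0 lets
    expansions of different orders be compared at a common length. *)
Definition truncate (a : nat -> C) (n k : nat) : C := if Nat.leb k n then a k else 0.

Lemma polar_sum_truncate (a : nat -> C) (n m : nat) (x : C) :
  polar_sum (truncate a n) (n + m) x = polar_sum a n x.
Proof.
induction m as [|m IH].
- rewrite Nat.add_0_r.
  assert (H : forall k, (k <= n)%nat -> polar_sum (truncate a n) k x = polar_sum a k x).
  { induction k as [|k IH]; intros Hk; [now rewrite !polar_sum_0|].
    rewrite !polar_sum_S, IH by lia; unfold truncate.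
    now rewrite (proj2 (Nat.leb_le (S k) n)) by lia. }
  now apply H.
- rewrite Nat.add_succ_r, polar_sum_S, IH; unfold truncate.
  rewrite (proj2 (Nat.leb_gt (S (n + m)) n)) by lia; unfold Cdiv; ring.
Qed.

Lemma polar_sum_minus (a b : nat -> C) (n : nat) (x : C) :
  polar_sum (fun k => a k - b k) n x = polar_sum a n x - polar_sum b n x.
Proof.
induction n as [|n IH]; [rewrite !polar_sum_0; ring|].
rewrite !polar_sum_S, IH; unfold Cdiv; ring.
Qed.

Lemma polar_sum_opp (a : nat -> C) (n : nat) (x : C) :
  polar_sum (fun k => - a k) n x = - polar_sum a n x.
Proof.
induction n as [|n IH]; [rewrite !polar_sum_0; ring|].
rewrite !polar_sum_S, IH; unfold Cdiv; ring.
Qed.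

Lemma polar_sum_growth (a : nat -> C) (n : nat) :
  exists B, 0 <= B /\ forall x : C, x <> 0 -> Cmod x <= 1 -> Cmod (x ^ n * polar_sum a n x) <= B.
Proof.
induction n as [|n (B & HB & IH)].
- exists 0%R; split; [lra|]; intros x _ _; rewrite polar_sum_0, Cmult_0_r, Cmod_0; lra.
- exists (B + Cmod (a (S n)))%R; split; [pose proof (Cmod_ge_0 (a (S n))); lra|].
  intros x Hx Hx1.
  replace (x ^ S n * polar_sum a (S n) x) with (x * (x ^ n * polar_sum a n x) + a (S n)).
  2:{ rewrite polar_sum_S, Cpow_S; field; split; auto; now apply Cpow_nz. }
  eapply Rle_trans; [apply Cmod_triangle|]; apply Rplus_le_compat_r.
  rewrite Cmod_mult; specialize (IH x Hx Hx1).
  pose proof (Cmod_ge_0 x); pose proof (Cmod_ge_0 (x ^ n * polar_sum a n x)); nra.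
Qed.

(** Multiplying by [x ^ (n + 1)] and letting [x] tend to 0 isolates the top coefficient; once it
    vanishes, the induction hypothesis applies to the rest. *)
Lemma polar_sum_bounded_zero (a : nat -> C) (n : nat) (d M : R) :
  0 < d -> (forall x : C, x <> 0 -> Cmod x < d -> Cmod (polar_sum a n x) <= M) ->
  forall k, (1 <= k <= n)%nat -> a k = 0.
Proof.
revert M; induction n as [|n IH]; intros M Hd HM; [intros; lia|].
assert (Hlast : a (S n) = 0).
{ destruct (polar_sum_growth a n) as (B & HB & HG).
  assert (HM0 : 0 <= M).
  { eapply Rle_trans; [apply Cmod_ge_0|apply (HM (RtoC (d / 2)))].
    - intros E; apply RtoC_inj in E; lra.
    - rewrite Cmod_R, Rabs_right; lra. }
  apply Cmod_eq_0, Rle_antisym; [|apply Cmod_ge_0].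
  apply le_epsilon; intros e He; rewrite Rplus_0_l.
  set (t := Rmin (Rmin 1 (d / 2)) (e / (M + B + 1))).
  assert (Ht : 0 < t).
  { repeat apply Rmin_glb_lt; try lra; apply Rdiv_lt_0_compat; lra. }
  assert (Ht1 : t <= 1) by (unfold t; eapply Rle_trans; [apply Rmin_l|apply Rmin_l]).
  assert (Ht2 : t <= d / 2) by (unfold t; eapply Rle_trans; [apply Rmin_l|apply Rmin_r]).
  assert (Ht3 : t <= e / (M + B + 1)) by (unfold t; apply Rmin_r).
  assert (Ht4 : t * (M + B + 1) <= e).
  { apply (Rmult_le_compat_r (M + B + 1)) in Ht3; [|lra].
    replace (e / (M + B + 1) * (M + B + 1))%R with e in Ht3 by (field; lra); exact Ht3. }
  set (x := RtoC t).
  assert (Hx : x <> 0) by (intros E; apply RtoC_inj in E; lra).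
  assert (Hxm : Cmod x = t) by (unfold x; rewrite Cmod_R, Rabs_right; lra).
  specialize (HM x Hx ltac:(lra)); specialize (HG x Hx ltac:(lra)).
  replace (a (S n)) with (x ^ S n * polar_sum a (S n) x - x * (x ^ n * polar_sum a n x)).
  2:{ rewrite polar_sum_S, Cpow_S; field; split; auto; now apply Cpow_nz. }
  eapply Rle_trans; [apply Cmod_triangle|].
  rewrite Cmod_opp, !(Cmod_mult x), Cmod_mult, Cmod_pow, Hxm.
  assert (Hp : t ^ S n <= t).
  { simpl; rewrite <- (Rmult_1_r t) at 3; apply Rmult_le_compat_l; [lra|].
    rewrite <- (pow1 n); apply pow_incr; lra. }
  assert (0 <= t ^ S n) by (apply pow_le; lra).
  pose proof (Cmod_ge_0 (polar_sum a (S n) x)).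
  assert (t ^ S n * Cmod (polar_sum a (S n) x) <= t * M) by (apply Rmult_le_compat; lra).
  assert (t * Cmod (x ^ n * polar_sum a n x) <= t * B) by (apply Rmult_le_compat_l; lra).
  lra. }
intros k Hk; destruct (Nat.eq_dec k (S n)) as [->|Hne]; [auto|].
apply (IH M Hd); [|lia].
intros x Hx Hxd; specialize (HM x Hx Hxd).
rewrite polar_sum_S, Hlast in HM.
replace (polar_sum a n x + 0 / x ^ S n) with (polar_sum a n x) in HM
  by (unfold Cdiv; ring); exact HM.
Qed.

Definition Cdiff (f : C -> C) (z : C) : Prop := exists l, is_Cderive f z l.

Lemma holomorphic_at_eps (f : C -> C) (p : C) :
  holomorphic_at f p <-> exists d, 0 < d /\ forall z, Cmod (z - p) < d -> Cdiff f z.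
Proof. apply locally_Cmod. Qed.

Lemma holomorphic_at_Cdiff (f : C -> C) (p : C) : holomorphic_at f p -> Cdiff f p.
Proof.
intros H; apply holomorphic_at_eps in H; destruct H as (d & Hd & H); apply H.
replace (p - p) with (RtoC 0) by ring; now rewrite Cmod_0.
Qed.

Lemma Cdiff_bounded (f : C -> C) (p : C) :
  Cdiff f p -> exists d, 0 < d /\ forall z, Cmod (z - p) < d -> Cmod (f z) <= Cmod (f p) + 1.
Proof.
intros [l H]; apply is_Cderive_cont in H.
destruct (H 1%R ltac:(lra)) as (d & Hd & H'); exists d; split; auto.
intros z Hz; specialize (H' z Hz); pose proof (Cmod_triangle_rev (f z) (f p)); lra.
Qed.

Lemma principal_part_eps (f : C -> C) (p : C) (n : nat) (a : nat -> C) :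
  principal_part f p n a -> exists h d, 0 < d /\ holomorphic_at h p /\
    forall x : C, x <> 0 -> Cmod x < d -> f (p + x) = h (p + x) + polar_sum a n x.
Proof.
intros (h & Hh & H); apply locally'_Cmod in H; destruct H as (d & Hd & H).
exists h, d; split; [auto|split; [auto|]]; intros x Hx Hxd.
assert (E : p + x - p = x) by ring.
specialize (H (p + x)); rewrite E in H; apply H; auto.
intros E'; apply Hx; rewrite <- E, E'; ring.
Qed.

Lemma principal_part_intro (f h : C -> C) (p : C) (n : nat) (a : nat -> C) (d : R) :
  0 < d -> holomorphic_at h p ->
  (forall x : C, x <> 0 -> Cmod x < d -> f (p + x) = h (p + x) + polar_sum a n x) ->
  principal_part f p n a.
Proof.
intros Hd Hh H; exists h; split; auto.
apply locally'_Cmod; exists d; split; auto; intros w Hw Hwd.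
replace w with (p + (w - p)) at 1 2 by ring.
apply H; auto; now apply Cminus_eq_contra.
Qed.

(** The difference of the two polar sums is a difference of holomorphic functions near [p], hence
    bounded. *)
Lemma principal_part_unique (f : C -> C) (p : C) (n m : nat) (a b : nat -> C) :
  principal_part f p n a -> principal_part f p m b ->
  forall k, (1 <= k)%nat -> truncate a n k = truncate b m k.
Proof.
intros Ha Hb k Hk.
destruct (principal_part_eps _ _ _ _ Ha) as (h & d1 & Hd1 & Hh & E1).
destruct (principal_part_eps _ _ _ _ Hb) as (g & d2 & Hd2 & Hg & E2).
destruct (Cdiff_bounded h p) as (d3 & Hd3 & B1); [now apply holomorphic_at_Cdiff|].
destruct (Cdiff_bounded g p) as (d4 & Hd4 & B2); [now apply holomorphic_at_Cdiff|].
apply Ceq_minus.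
destruct (Nat.le_gt_cases k (n + m)) as [Hkn|Hkn].
2:{ unfold truncate; rewrite !(proj2 (Nat.leb_gt _ _)) by lia; ring. }
apply (polar_sum_bounded_zero (fun k => truncate a n k - truncate b m k) (n + m)
  (Rmin (Rmin d1 d2) (Rmin d3 d4)) (Cmod (h p) + 1 + (Cmod (g p) + 1))); [| |lia].
- repeat apply Rmin_glb_lt; auto.
- intros x Hx Hxd.
  destruct (Rmin_Rgt_l _ _ _ Hxd) as [H12 H34].
  destruct (Rmin_Rgt_l _ _ _ H12) as [H1 H2].
  destruct (Rmin_Rgt_l _ _ _ H34) as [H3 H4].
  rewrite polar_sum_minus, polar_sum_truncate.
  rewrite (Nat.add_comm n m), polar_sum_truncate.
  specialize (E1 x Hx H1); specialize (E2 x Hx H2).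
  assert (E : p + x - p = x) by ring.
  specialize (B1 (p + x)); specialize (B2 (p + x)); rewrite E in B1, B2.
  replace (polar_sum a n x - polar_sum b m x) with (g (p + x) - h (p + x)).
  2:{ assert (E3 : h (p + x) + polar_sum a n x = g (p + x) + polar_sum b m x)
        by (rewrite <- E1, <- E2; reflexivity).
      replace (polar_sum a n x) with (h (p + x) + polar_sum a n x - h (p + x)) by ring.
      rewrite E3; ring. }
  eapply Rle_trans; [apply Cmod_triangle|]; rewrite Cmod_opp.
  specialize (B1 H3); specialize (B2 H4); lra.
Qed.

Lemma holomorphic_principal_part (f : C -> C) (p : C) (n : nat) :
  holomorphic_at f p -> principal_part f p n (fun _ => 0).
Proof.
intros H; apply (principal_part_intro f f p n _ 1); [lra|auto|].
intros x _ _; replace (polar_sum (fun _ => 0) n x) with (RtoC 0); [ring|].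
induction n as [|n IH]; [now rewrite polar_sum_0|].
rewrite polar_sum_S, <- IH; unfold Cdiv; ring.
Qed.

Lemma pole_not_holomorphic (f : C -> C) (p : C) (n : nat) :
  pole f p n -> ~ holomorphic_at f p.
Proof.
intros (Hn & a & Ha & Hn0) H; apply Hn0.
pose proof (principal_part_unique _ _ _ _ _ _ Ha (holomorphic_principal_part f p n H) n Hn) as E.
unfold truncate in E; now rewrite Nat.leb_refl in E.
Qed.

Lemma holomorphic_at_open (f : C -> C) (p : C) :
  holomorphic_at f p -> exists d, 0 < d /\ forall z, Cmod (z - p) < d -> holomorphic_at f z.
Proof.
intros H; apply holomorphic_at_eps in H; destruct H as (d & Hd & H).
exists (d / 2)%R; split; [lra|]; intros z Hz; apply holomorphic_at_eps.
exists (d / 2)%R; split; [lra|]; intros w Hw; apply H.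
pose proof (Cmod_minus_triangle w z p); lra.
Qed.

Lemma Cdiff_polar_sum (a : nat -> C) (n : nat) (p z : C) :
  z <> p -> Cdiff (fun w => polar_sum a n (w - p)) z.
Proof.
intros Hz; induction n as [|n [l IH]].
- exists 0; apply (is_Cderive_ext (fun _ => 0));
    [intros; now rewrite polar_sum_0|apply is_Cderive_const].
- eexists; apply (is_Cderive_ext (fun w => polar_sum a n (w - p) + a (S n) / (w - p) ^ S n)).
  { intros; now rewrite polar_sum_S. }
  Cderive; apply Cpow_nz; now apply Cminus_eq_contra.
Qed.

Lemma Cdiff_ext_loc (f g : C -> C) (z : C) (d : R) :
  0 < d -> (forall w, Cmod (w - z) < d -> f w = g w) -> Cdiff f z -> Cdiff g z.
Proof. intros Hd E [l H]; exists l; eapply is_Cderive_ext_loc; eauto. Qed.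

Lemma principal_part_punctured (f : C -> C) (p : C) (n : nat) (a : nat -> C) :
  principal_part f p n a ->
  exists d, 0 < d /\ forall z, z <> p -> Cmod (z - p) < d -> holomorphic_at f z.
Proof.
intros H; destruct (principal_part_eps _ _ _ _ H) as (h & d & Hd & Hh & E).
apply holomorphic_at_eps in Hh; destruct Hh as (d' & Hd' & Hh).
exists (Rmin d d'); split; [now apply Rmin_glb_lt|]; intros z Hz Hzd.
apply holomorphic_at_eps.
set (r := Rmin (Cmod (z - p)) (Rmin d d' - Cmod (z - p))).
assert (Hm : 0 < Cmod (z - p)) by (apply Cmod_gt_0; now apply Cminus_eq_contra).
assert (Hr : 0 < r) by (apply Rmin_glb_lt; lra).
exists r; split; auto; intros w Hw.
assert (Hr1 : r <= Cmod (z - p)) by apply Rmin_l.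
assert (Hr2 : r <= Rmin d d' - Cmod (z - p)) by apply Rmin_r.
pose proof (Cmod_minus_triangle w z p) as Hwp.
pose proof (Cmod_minus_triangle z w p) as Hzp; rewrite (Cmod_minus_sym z w) in Hzp.
pose proof (Rmin_l d d'); pose proof (Rmin_r d d').
assert (Hwne : w <> p).
{ intros ->; revert Hzp; replace (p - p) with (RtoC 0) by ring; rewrite Cmod_0; lra. }
assert (Hwp0 : 0 < Cmod (w - p)) by (apply Cmod_gt_0; now apply Cminus_eq_contra).
apply (Cdiff_ext_loc (fun v => h v + polar_sum a n (v - p)) f w
  (Rmin (Cmod (w - p)) (Rmin d d' - Cmod (w - p)))).
- apply Rmin_glb_lt; lra.
- intros v Hv.
  destruct (Rmin_Rgt_l _ _ _ Hv) as [Hv1 Hv2].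
  pose proof (Cmod_minus_triangle v w p).
  specialize (E (v - p)); replace (p + (v - p)) with v in E by ring.
  symmetry; apply E; [|lra].
  intros E0; apply (Rlt_irrefl (Cmod (w - p))).
  replace (Cmod (w - p)) with (Cmod (v - w)) at 1; auto.
  rewrite Cmod_minus_sym; f_equal.
  replace w with (w - p + p) at 1 by ring.
  replace v with (v - p + p) by ring; rewrite E0; ring.
- destruct (Hh w ltac:(lra)) as [l1 D1].
  destruct (Cdiff_polar_sum a n p w Hwne) as [l2 D2].
  exists (l1 + l2); now apply is_Cderive_plus.
Qed.

Lemma meromorphic_punctured (f : C -> C) (p : C) :
  meromorphic f ->
  exists d, 0 < d /\ forall z, z <> p -> Cmod (z - p) < d -> holomorphic_at f z.
Proof.
intros H; destruct (H p) as [Hh|(n & _ & a & Ha & _)].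
- destruct (holomorphic_at_open f p Hh) as (d & Hd & Hd'); exists d; split; auto.
- eapply principal_part_punctured; eauto.
Qed.

Lemma holomorphic_at_shift (h : C -> C) (p c : C) :
  holomorphic_at h (p + c) -> holomorphic_at (fun x => h (x + c)) p.
Proof.
intros H; apply holomorphic_at_eps in H; destruct H as (d & Hd & H).
apply holomorphic_at_eps; exists d; split; auto; intros z Hz.
destruct (H (z + c)) as [l Hl].
{ replace (z + c - (p + c)) with (z - p) by ring; auto. }
exists l; now apply is_Cderive_shift.
Qed.

Lemma principal_part_translate (f g : C -> C) (p c : C) (n : nat) (a : nat -> C) (d : R) :
  0 < d -> (forall x : C, x <> 0 -> Cmod x < d -> g (p + x) = f (p + x + c)) ->
  principal_part f (p + c) n a -> principal_part g p n a.
Proof.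
intros Hd Hg H; destruct (principal_part_eps _ _ _ _ H) as (h & d' & Hd' & Hh & E).
apply (principal_part_intro g (fun x => h (x + c)) p n a (Rmin d d')).
- now apply Rmin_glb_lt.
- now apply holomorphic_at_shift.
- intros x Hx Hxd; destruct (Rmin_Rgt_l _ _ _ Hxd) as [H1 H2].
  rewrite Hg by auto; replace (p + x + c) with (p + c + x) by ring; auto.
Qed.

Lemma principal_part_shift (f g : C -> C) (c : C) (n : nat) (a : nat -> C) (d : R) :
  0 < d -> (forall x : C, x <> 0 -> Cmod x < d -> g x = f (x + c)) ->
  principal_part f c n a <-> principal_part g 0 n a.
Proof.
intros Hd Hg; split; intros H.
- apply (principal_part_translate f g 0 c n a d Hd); [|now rewrite Cplus_0_l].
  intros x; rewrite Cplus_0_l; apply Hg.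
- apply (principal_part_translate g f c (- c) n a d Hd); [|now rewrite Cplus_opp_r].
  intros x Hx Hxd; replace (c + x + - c) with x by ring; rewrite Hg by auto; f_equal; ring.
Qed.

Lemma principal_part_opp (f : C -> C) (p : C) (n : nat) (a : nat -> C) :
  principal_part f p n a -> principal_part (fun x => - f x) p n (fun k => - a k).
Proof.
intros H; destruct (principal_part_eps _ _ _ _ H) as (h & d & Hd & Hh & E).
apply (principal_part_intro _ (fun x => - h x) _ _ _ d Hd).
- apply holomorphic_at_eps in Hh; destruct Hh as (d' & Hd' & Hh).
  apply holomorphic_at_eps; exists d'; split; auto; intros z Hz.
  destruct (Hh z Hz) as [l Hl]; exists (- l); now apply is_Cderive_opp.
- intros x Hx Hxd; rewrite (E x Hx Hxd), polar_sum_opp; ring.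
Qed.

(** The transformation law is available where the symbol is holomorphic, hence on a punctured disk,
    which is all that principal parts see. *)
Lemma finite_chart_law (nabla : connection) (c : C) :
  exists d, 0 < d /\ forall x : C, x <> 0 -> Cmod x < d ->
  christoffel nabla (fin c) x = christoffel nabla (fin 0) (x + c).
Proof.
destruct (meromorphic_punctured _ 0 (christoffel_mero nabla (fin c))) as (d & Hd & H).
exists d; split; auto; intros x Hx Hxd.
rewrite (christoffel_law nabla (fin c) (fin 0) x (fun _ => 1) 0).
- unfold transition; simpl; replace (x + c - 0) with (x + c) by ring.
  unfold Cdiv; ring.
- simpl; discriminate.
- apply H; auto; now replace (x - 0) with x by ring.
- apply locally_Cmod; exists 1%R; split; [lra|]; intros y _.
  unfold transition; simpl; eapply is_Cderive_eq; [Cderive|ring].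
- apply is_Cderive_const.
Qed.

(** For the transition [/ w], the term [psi'' / psi'] is [- 2 / w]. It makes the residues of a
    connection on the sphere add up to 2 instead of 0. *)
Lemma infinite_chart_law (nabla : connection) :
  exists d, 0 < d /\ forall w : C, w <> 0 -> Cmod w < d ->
  christoffel nabla infty w = - (christoffel nabla (fin 0) (/ w) / w ^ 2) - 2 / w.
Proof.
destruct (meromorphic_punctured _ 0 (christoffel_mero nabla infty)) as (d & Hd & H).
exists d; split; auto; intros w Hw Hwd.
assert (Htr : forall y : C, y <> 0 -> transition infty (fin 0) y = / y).
{ intros y Hy; unfold transition; simpl; destruct (Ceq_dec y 0); [tauto|]; simpl; ring. }
rewrite (christoffel_law nabla infty (fin 0) w (fun y => - / (y * y)) (2 / (w * w * w))).
- rewrite Htr by auto; field; auto.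
- simpl; destruct (Ceq_dec w 0); [tauto|discriminate].
- apply H; auto; now replace (w - 0) with w by ring.
- apply locally_Cmod; exists (Cmod w); split; [now apply Cmod_gt_0|]; intros y Hy.
  assert (Hy0 : y <> 0).
  { intros ->; revert Hy; replace (0 - w) with (- w) by ring; rewrite Cmod_opp; lra. }
  apply (is_Cderive_ext_loc Cinv _ y _ (Cmod y)); [now apply Cmod_gt_0| |now apply is_Cderive_inv].
  intros v Hv; symmetry; apply Htr; intros ->; revert Hv.
  replace (0 - y) with (- y) by ring; rewrite Cmod_opp; lra.
- eapply is_Cderive_eq; [Cderive; now apply Cmult_neq_0|cbv beta; field; auto].
Qed.

(** * Connections with at most one simple pole *)

Lemma remove_polar_part (f : C -> C) (c : C) (n : nat) (a : nat -> C) :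
  principal_part f c n a ->
  exists g, Cdiff g c /\ (forall z, z <> c -> g z = f z - polar_sum a n (z - c)) /\
    forall z, z <> c -> Cdiff f z -> Cdiff g z.
Proof.
intros H; destruct (principal_part_eps _ _ _ _ H) as (h & d & Hd & Hh & E).
exists (fun z => if Ceq_dec z c then h c else f z - polar_sum a n (z - c)).
assert (Hg : forall z, z <> c ->
  (if Ceq_dec z c then h c else f z - polar_sum a n (z - c)) = f z - polar_sum a n (z - c)).
{ intros z Hz; destruct (Ceq_dec z c); tauto. }
split; [|split].
- apply (Cdiff_ext_loc h _ c d); auto; [|now apply holomorphic_at_Cdiff].
  intros w Hw; destruct (Ceq_dec w c) as [->|Hne]; auto.
  specialize (E (w - c) (Cminus_eq_contra _ _ Hne) Hw).
  replace (c + (w - c)) with w in E by ring; rewrite E; ring.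
- exact Hg.
- intros z Hz [l Hl]; destruct (Cdiff_polar_sum a n c z Hz) as [k Hk].
  apply (Cdiff_ext_loc (fun z => f z - polar_sum a n (z - c)) _ z (Cmod (z - c))).
  + apply Cmod_gt_0; now apply Cminus_eq_contra.
  + intros w Hw; symmetry; apply Hg; intros ->.
    rewrite (Cmod_minus_sym c z) in Hw; lra.
  + exists (l - k); now apply is_Cderive_minus.
Qed.

Lemma polar_sum_at_infinity (a : nat -> C) (n : nat) (c : C) (e : R) :
  0 < e -> exists M, forall z, M < Cmod z -> Cmod (polar_sum a n (z - c)) <= e.
Proof.
revert e; induction n as [|n IH]; intros e He.
- exists 0%R; intros z _; rewrite polar_sum_0, Cmod_0; lra.
- destruct (IH (e / 2)%R ltac:(lra)) as [M HM].
  pose proof (Cmod_ge_0 (a (S n))) as Ha.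
  set (K := (2 * Cmod (a (S n)) / e)%R).
  assert (HK : 0 <= K) by (apply Rdiv_le_0_compat; lra).
  exists (Rmax M (Cmod c + 1 + K)); intros z Hz.
  pose proof (Rmax_l M (Cmod c + 1 + K)); pose proof (Rmax_r M (Cmod c + 1 + K)).
  specialize (HM z ltac:(lra)).
  rewrite polar_sum_S; eapply Rle_trans; [apply Cmod_triangle|].
  pose proof (Cmod_triangle_rev z c) as Hzc.
  set (m := Cmod (z - c)) in *.
  assert (Hne : z - c <> 0) by (apply Cmod_gt_0; fold m; lra).
  rewrite Cmod_div, Cmod_pow by (now apply Cpow_nz); fold m.
  assert (Hmp : m <= m ^ S n).
  { simpl; rewrite <- (Rmult_1_r m) at 1; apply Rmult_le_compat_l; [lra|].
    apply pow_R1_Rle; lra. }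
  assert (Cmod (a (S n)) / m ^ S n <= e / 2); [|lra].
  apply (Rmult_le_reg_r (m ^ S n)); [lra|].
  unfold Rdiv at 1; rewrite Rmult_assoc, Rinv_l, Rmult_1_r by lra.
  assert (K * (e / 2) = Cmod (a (S n)))%R by (unfold K; field; lra).
  nra.
Qed.

Lemma rational_of_poles (G : C -> C) (c q e0 : C) (n m : nat) (a b : nat -> C) :
  c <> q -> principal_part G c n a -> principal_part G q m b ->
  (forall z, z <> c -> z <> q -> Cdiff G z) ->
  (forall e, 0 < e -> exists M, forall z, M < Cmod z -> Cmod (G z - e0) <= e) ->
  forall z, z <> c -> z <> q -> G z = e0 + polar_sum a n (z - c) + polar_sum b m (z - q).
Proof.
intros Hcq Ha Hb HG Hlim.
destruct (remove_polar_part G c n a Ha) as (g & Hgc & Hg & Hgd).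
(* Since [c <> q], removing the polar part at [c] leaves the one at [q] unchanged. *)
assert (Hb' : exists b', principal_part g q m b' /\
  forall x, polar_sum b' m x = polar_sum b m x).
{ exists b; split; auto.
  destruct (principal_part_eps _ _ _ _ Hb) as (h & d & Hd & Hh & E).
  assert (Hm : 0 < Cmod (q - c)) by (apply Cmod_gt_0, Cminus_eq_contra; auto).
  apply (principal_part_intro g (fun z => h z - polar_sum a n (z - c)) q m b
    (Rmin d (Cmod (q - c)))); [now apply Rmin_glb_lt| |].
  - apply holomorphic_at_eps in Hh; destruct Hh as (d' & Hd' & Hh).
    apply holomorphic_at_eps; exists (Rmin d' (Cmod (q - c))).
    split; [now apply Rmin_glb_lt|]; intros z Hz.
    destruct (Hh z) as [l Hl]; [eapply Rlt_le_trans; [exact Hz|apply Rmin_l]|].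
    destruct (Cdiff_polar_sum a n c z) as [k Hk].
    + intros ->; pose proof (Rmin_r d' (Cmod (q - c))); rewrite Cmod_minus_sym in Hz; lra.
    + exists (l - k); now apply is_Cderive_minus.
  - intros x Hx Hxd; rewrite Hg.
    + rewrite E; [ring|auto|]; eapply Rlt_le_trans; [exact Hxd|apply Rmin_l].
    + intros Ec; pose proof (Rmin_r d (Cmod (q - c))).
      replace (q - c) with (- x) in * by (rewrite <- Ec; ring).
      rewrite Cmod_opp in *; lra. }
destruct Hb' as (b' & Hb' & Eb).
destruct (remove_polar_part g q m b' Hb') as (k & Hkq & Hk & Hkd).
assert (Hent : entire (fun z => k z - e0)).
{ intros z; assert (D : Cdiff k z).
  { destruct (Ceq_dec z q) as [->|Hq]; auto; apply Hkd; auto.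
    destruct (Ceq_dec z c) as [->|Hc]; auto. }
  destruct D as [l Hl]; eexists; Cderive. }
intros z Hzc Hzq.
assert (H0 : k z - e0 = 0).
{ revert z Hzc Hzq; assert (H0 : forall z, k z - e0 = 0); [|auto].
  apply (liouville _ Hent); intros e He.
  destruct (Hlim (e / 3)%R ltac:(lra)) as [M1 HM1].
  destruct (polar_sum_at_infinity a n c (e / 3)%R ltac:(lra)) as [M2 HM2].
  destruct (polar_sum_at_infinity b m q (e / 3)%R ltac:(lra)) as [M3 HM3].
  exists (Rmax (Rmax M1 (Rmax M2 M3)) (Rmax (Cmod c) (Cmod q))); intros z Hz.
  pose proof (Rmax_l (Rmax M1 (Rmax M2 M3)) (Rmax (Cmod c) (Cmod q))).
  pose proof (Rmax_r (Rmax M1 (Rmax M2 M3)) (Rmax (Cmod c) (Cmod q))).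
  pose proof (Rmax_l M1 (Rmax M2 M3)); pose proof (Rmax_r M1 (Rmax M2 M3)).
  pose proof (Rmax_l M2 M3); pose proof (Rmax_r M2 M3).
  pose proof (Rmax_l (Cmod c) (Cmod q)); pose proof (Rmax_r (Cmod c) (Cmod q)).
  assert (Hzc : z <> c) by (intros ->; lra).
  assert (Hzq : z <> q) by (intros ->; lra).
  rewrite Hk, Hg, Eb by auto.
  replace (G z - polar_sum a n (z - c) - polar_sum b m (z - q) - e0) with
    (G z - e0 + - polar_sum a n (z - c) + - polar_sum b m (z - q)) by ring.
  eapply Rle_trans; [apply Cmod_triangle|].
  eapply Rle_trans; [apply Rplus_le_compat_r, Cmod_triangle|].
  rewrite !Cmod_opp; specialize (HM1 z ltac:(lra)); specialize (HM2 z ltac:(lra));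
    specialize (HM3 z ltac:(lra)); lra. }
rewrite Hk, Hg, Eb in H0 by auto.
replace (G z) with (G z - polar_sum a n (z - c) - polar_sum b m (z - q) - e0 +
  (e0 + polar_sum a n (z - c) + polar_sum b m (z - q))) by ring.
rewrite H0; ring.
Qed.

Lemma conn_pole_finite (nabla : connection) (c : C) (n : nat) :
  pole (christoffel nabla (fin 0)) c n <-> conn_pole nabla (fin c) n.
Proof.
destruct (finite_chart_law nabla c) as (d & Hd & H).
split; intros (Hn & a & Ha & Hne); split; auto; exists a; split; auto;
  now apply (principal_part_shift _ _ c n a d Hd H).
Qed.

Lemma meromorphic_holomorphic_at (f : C -> C) (p : C) :
  meromorphic f -> (forall n, ~ pole f p n) -> holomorphic_at f p.
Proof. intros H Hn; destruct (H p) as [Hh|[n Hp]]; [auto|destruct (Hn n Hp)]. Qed.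

(** With [w = / z], the change of charts reads [G z = - w ^ 2 * Gamma w - 2 * w], where [Gamma] is
    the symbol at infinity: only its coefficient of order 2 survives in the limit. The truncation
    treats a double pole, a simple pole and a regular point alike. *)
Lemma finite_symbol_at_infinity (nabla : connection) (n : nat) (b : nat -> C) :
  (n <= 2)%nat -> principal_part (christoffel nabla infty) 0 n b ->
  forall e, 0 < e -> exists M, forall z, M < Cmod z ->
    Cmod (christoffel nabla (fin 0) z - - truncate b n 2) <= e.
Proof.
intros Hn H e He.
destruct (principal_part_eps _ _ _ _ H) as (h & d1 & Hd1 & Hh & E).
destruct (Cdiff_bounded h 0) as (d2 & Hd2 & Hb); [now apply holomorphic_at_Cdiff|].
destruct (infinite_chart_law nabla) as (d3 & Hd3 & Hlaw).
set (K := (Cmod (h 0) + 1 + Cmod (truncate b n 1 + 2) + 1)%R).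
assert (HK : 0 < K).
{ unfold K; pose proof (Cmod_ge_0 (h 0)); pose proof (Cmod_ge_0 (truncate b n 1 + 2)); lra. }
set (r := Rmin (Rmin 1 (e / K)) (Rmin d1 (Rmin d2 d3))).
assert (Hr : 0 < r).
{ repeat apply Rmin_glb_lt; auto; [lra|apply Rdiv_lt_0_compat; lra]. }
exists (/ r)%R; intros z Hz.
assert (Hz0 : z <> 0).
{ intros ->; rewrite Cmod_0 in Hz; pose proof (Rinv_0_lt_compat _ Hr); lra. }
assert (Hzm := proj1 (Cmod_gt_0 z) Hz0).
set (w := / z).
assert (Hw : Cmod w < r).
{ unfold w; rewrite Cmod_inv by auto; rewrite <- (Rinv_inv r).
  apply Rinv_lt_contravar; auto.
  apply Rmult_lt_0_compat; [apply Rinv_0_lt_compat; auto|auto]. }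
assert (Hw0 : w <> 0).
{ intros E0; apply C1_nz; rewrite <- (Cinv_r z Hz0); fold w; rewrite E0; ring. }
assert (Ew : / w = z) by (unfold w; field; auto).
destruct (Rmin_Rgt_l _ _ _ Hw) as [W1 W2].
destruct (Rmin_Rgt_l _ _ _ W1) as [W3 W4].
destruct (Rmin_Rgt_l _ _ _ W2) as [W5 W6].
destruct (Rmin_Rgt_l _ _ _ W6) as [W7 W8].
specialize (E w Hw0 W5); replace (0 + w) with w in E by ring.
specialize (Hlaw w Hw0 W8); rewrite Ew in Hlaw.
specialize (Hb w); replace (w - 0) with w in Hb by ring; specialize (Hb W7).
rewrite <- (polar_sum_truncate b n (2 - n)) in E.
replace (n + (2 - n))%nat with 2%nat in E by lia.
rewrite polar_sum_2 in E.
rewrite E in Hlaw.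
set (b1 := truncate b n 1) in *; set (b2 := truncate b n 2) in *.
replace (christoffel nabla (fin 0) z - - b2) with (- (w * (w * h w + (b1 + 2)))).
2:{ set (G := christoffel nabla (fin 0) z) in *.
  replace G with (- (w ^ 2 * (- (G / w ^ 2) - 2 / w)) - 2 * w) by (field; auto).
  rewrite <- Hlaw; field; auto. }
rewrite Cmod_opp, Cmod_mult.
assert (B : Cmod (w * h w + (b1 + 2)) <= K).
{ eapply Rle_trans; [apply Cmod_triangle|]; rewrite Cmod_mult; unfold K; fold b1.
  pose proof (Cmod_ge_0 w); pose proof (Cmod_ge_0 (h w)); nra. }
assert (e / K * K = e)%R by (field; lra).
pose proof (Cmod_ge_0 w); pose proof (Cmod_ge_0 (w * h w + (b1 + 2))); nra.
Qed.

Lemma far_from (c : C) : exists d, 0 < d /\ forall w : C, w <> 0 -> Cmod w < d -> / w <> c.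
Proof.
pose proof (Cmod_ge_0 c).
exists (/ (Cmod c + 1))%R; split; [apply Rinv_0_lt_compat; lra|].
intros w Hw Hwd E.
assert (H1 : Cmod (c * w) = 1%R) by (rewrite <- E, Cinv_l, Cmod_1; auto).
rewrite Cmod_mult in H1.
assert (H2 : (Cmod c + 1) * Cmod w < 1).
{ apply (Rmult_lt_compat_l (Cmod c + 1)) in Hwd; [|lra].
  rewrite Rinv_r in Hwd; lra. }
pose proof (Cmod_ge_0 w); nra.
Qed.

Lemma rational_symbol_at_infinity (nabla : connection) (c q e0 A B r : C) :
  (forall z, z <> c -> z <> q ->
    christoffel nabla (fin 0) z = e0 + (A / (z - c) ^ 2 + B / (z - c)) + r / (z - q)) ->
  exists d, 0 < d /\ forall w : C, w <> 0 -> Cmod w < d ->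
    1 - c * w <> 0 /\ 1 - q * w <> 0 /\
    christoffel nabla infty w = - e0 / w ^ 2 - (B + r + 2) / w -
      (A / (1 - c * w) ^ 2 + B * c / (1 - c * w) + r * q / (1 - q * w)).
Proof.
intros H.
destruct (infinite_chart_law nabla) as (d1 & Hd1 & Hlaw).
destruct (far_from c) as (d2 & Hd2 & Hc); destruct (far_from q) as (d3 & Hd3 & Hq).
exists (Rmin d1 (Rmin d2 d3)); split; [repeat apply Rmin_glb_lt; auto|].
intros w Hw Hwd.
destruct (Rmin_Rgt_l _ _ _ Hwd) as [W1 W2].
destruct (Rmin_Rgt_l _ _ _ W2) as [W3 W4].
specialize (Hc w Hw W3); specialize (Hq w Hw W4).
assert (Hden : forall s, / w <> s -> 1 - s * w <> 0).
{ intros s Hs E; apply Hs.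
  replace (/ w) with ((1 - s * w) / w + s) by (field; auto); rewrite E; unfold Cdiv; ring. }
split; [auto|split; [auto|]].
rewrite Hlaw, H by auto.
pose proof (Hden c Hc); pose proof (Hden q Hq).
field; repeat split; auto.
Qed.

(** The coefficient of [/ w] collects the finite residues and the 2 of the change of charts.
    Comparing it with the true coefficient at infinity amounts to the residue theorem for
    connections. *)
Lemma principal_part_at_infinity (nabla : connection) (c q e0 A B r : C) :
  (forall z, z <> c -> z <> q ->
    christoffel nabla (fin 0) z = e0 + (A / (z - c) ^ 2 + B / (z - c)) + r / (z - q)) ->
  principal_part (christoffel nabla infty) 0 2
    (fun k => if Nat.eqb k 2 then - e0 else - (B + r + 2)).
Proof.
intros H; destruct (rational_symbol_at_infinity _ _ _ _ _ _ _ H) as (d & Hd & E).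
assert (Hden : forall s, exists d', 0 < d' /\ forall w, Cmod w < d' -> 1 - s * w <> 0).
{ intros s; destruct (far_from s) as (d' & Hd' & Hs); exists d'; split; auto.
  intros w Hw E0; destruct (Ceq_dec w 0) as [->|Hw0].
  - apply C1_nz; rewrite <- E0; ring.
  - apply (Hs w Hw0 Hw).
    replace s with (/ w - (1 - s * w) / w) by (field; auto); rewrite E0; unfold Cdiv; ring. }
destruct (Hden c) as (dc & Hdc & Hc); destruct (Hden q) as (dq & Hdq & Hq).
apply (principal_part_intro _
  (fun w => - (A / (1 - c * w) ^ 2 + B * c / (1 - c * w) + r * q / (1 - q * w))) _ _ _ d Hd).
- apply holomorphic_at_eps; exists (Rmin dc dq); split; [now apply Rmin_glb_lt|].
  intros w Hw; replace (w - 0) with w in Hw by ring.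
  destruct (Rmin_Rgt_l _ _ _ Hw) as [W1 W2].
  eexists; Cderive; auto; now apply Cpow_nz, Hc.
- intros w Hw Hwd; replace (0 + w) with w by ring.
  destruct (E w Hw Hwd) as (_ & _ & ->).
  rewrite polar_sum_2; simpl; unfold Cdiv; ring.
Qed.

Lemma conn_residue_coefficient (nabla : connection) (p : sphere) (res : C) (b : nat -> C) :
  conn_residue nabla p res -> principal_part (christoffel nabla p) 0 2 b -> b 1%nat = - res.
Proof.
intros (n & a & Hn & Ha & E) Hb.
pose proof (principal_part_opp _ _ _ _ Hb) as Hb'.
pose proof (principal_part_unique _ _ _ _ _ _ Ha Hb' 1%nat (le_n 1)) as H.
unfold truncate in H; rewrite (proj2 (Nat.leb_le 1 n) Hn) in H; simpl in H.
rewrite <- E, H; ring.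
Qed.

(** [beta] is the inverse of the position of the simple pole in the chart centered at the double
    pole; it can be taken to be 0 if this position is infinite or if there is no simple pole. *)
Lemma at_most_one_simple_pole (nabla : connection) (p : sphere) (l : list sphere) (res : C) :
  conn_pole nabla p 2 -> conn_residue nabla p res -> (length l <= 1)%nat -> ~ In p l ->
  (forall q, In q l -> conn_pole nabla q 1) ->
  (forall q n, conn_pole nabla q n -> q = p \/ In q l) ->
  exists a beta rho,
    one_pole_form (christoffel nabla p) a res beta rho /\
    (forall b, principal_part (christoffel nabla p) 0 2 b -> b 2%nat = a) /\
    (l = nil -> res = 2).
Proof.
intros Hp Hres Hl Hpl Hsimple Hpoles.
set (G := christoffel nabla (fin 0)).
destruct Hp as (_ & b & Hb & Ha); set (a := b 2%nat) in *.
assert (Hb1 := conn_residue_coefficient nabla p res b Hres Hb).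
assert (Huniq : forall b', principal_part (christoffel nabla p) 0 2 b' -> b' 2%nat = a).
{ intros b' Hb'.
  exact (principal_part_unique _ _ _ _ _ _ Hb' Hb 2%nat ltac:(lia)). }
assert (HGhol : forall z, fin z <> p -> ~ In (fin z) l -> holomorphic_at G z).
{ intros z H1 H2; apply meromorphic_holomorphic_at; [apply christoffel_mero|].
  intros n Hn; apply conn_pole_finite in Hn; apply Hpoles in Hn; tauto. }
assert (Hlist : l = nil \/ exists q, l = q :: nil).
{ destruct l as [|q [|q' l']]; [auto|eauto|simpl in Hl; lia]. }
destruct p as [c|].
- assert (HGb : principal_part G c 2 b).
  { destruct (finite_chart_law nabla c) as (d & Hd & H).
    now apply (principal_part_shift _ _ c 2 b d Hd H). }
  assert (Hdata : exists q b' b'', q <> c /\ principal_part G q 1 b' /\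
    principal_part (christoffel nabla infty) 0 1 b'' /\
    (forall z, z <> c -> z <> q -> holomorphic_at G z) /\
    (l = nil -> b' 1%nat = 0) /\ (b' 1%nat = 0 \/ b'' 1%nat = 0) /\
    (l = nil -> b'' 1%nat = 0)).
  (* [c + 1] stands in for [q], with a zero polar part, when there is no simple pole or when it lies
     at infinity, so that all cases share one formula. *)
  { assert (Hdummy : c + 1 <> c).
    { intros E; apply C1_nz; replace (RtoC 1) with (c + 1 - c) by ring; rewrite E; ring. }
    assert (Hinf : ~ In infty l ->
      principal_part (christoffel nabla infty) 0 1 (fun _ => 0)).
    { intros Hi; apply holomorphic_principal_part, meromorphic_holomorphic_at;
        [apply christoffel_mero|].
      intros n Hn; destruct (Hpoles infty n Hn) as [E|E]; [discriminate|tauto]. }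
    destruct Hlist as [->|[[q|] ->]].
    - exists (c + 1), (fun _ => 0), (fun _ => 0).
      split; [exact Hdummy|split; [|split; [apply Hinf; simpl; tauto|split; [|auto]]]].
      + apply holomorphic_principal_part, HGhol; [congruence|tauto].
      + intros z H1 H2; apply HGhol; [congruence|tauto].
    - assert (Hqc : q <> c) by (intros ->; apply Hpl; simpl; auto).
      destruct (proj2 (conn_pole_finite nabla q 1)) as (_ & b' & Hb' & _);
        [apply Hsimple; simpl; auto|].
      exists q, b', (fun _ => 0).
      split; [exact Hqc|split; [exact Hb'|split; [|split;
        [|split; [intros E; discriminate E|split; [auto|intros E; discriminate E]]]]]].
      + apply Hinf; simpl; intros [E|[]]; discriminate.
      + intros z H1 H2; apply HGhol; [congruence|simpl; intros [E|[]]; congruence].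
    - destruct (Hsimple infty) as (_ & b'' & Hb'' & _); [simpl; auto|].
      exists (c + 1), (fun _ => 0), b''.
      split; [exact Hdummy|split; [|split; [exact Hb''|split;
        [|split; [auto|split; [auto|intros E; discriminate E]]]]]].
      + apply holomorphic_principal_part, HGhol;
          [congruence|simpl; intros [E|[]]; discriminate].
      + intros z H1 H2; apply HGhol; [congruence|simpl; intros [E|[]]; discriminate]. }
  destruct Hdata as (q & b' & b'' & Hqc & Hb' & Hb'' & HG & Hr0 & Hor & Hnil).
  set (r := b' 1%nat) in *.
  assert (Hrat : forall z, z <> c -> z <> q ->
    G z = 0 + (a / (z - c) ^ 2 + - res / (z - c)) + r / (z - q)).
  { intros z H1 H2.
    rewrite (rational_of_poles G c q 0 2 1 b b'); auto.
    - rewrite polar_sum_2, polar_sum_1, Hb1; reflexivity.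
    - intros v V1 V2; now apply holomorphic_at_Cdiff, HG.
    - intros e He.
      destruct (finite_symbol_at_infinity nabla 1 b'' ltac:(lia) Hb'' e He) as [M HM].
      exists M; intros v Hv; specialize (HM v Hv); unfold truncate in HM; simpl in HM.
      replace (G v - 0) with (G v - - 0) by ring; exact HM. }
  (* The residues at [c], [q] and infinity are linked. By [Hor] at least one of [r] and [b'' 1]
     vanishes, so a nonzero [r] must be [res - 2]. *)
  assert (Hsum : - (- res + r + 2) = b'' 1%nat).
  { pose proof (principal_part_unique _ _ _ _ _ _
      (principal_part_at_infinity nabla c q 0 a (- res) r Hrat) Hb'' 1%nat (le_n 1)) as E.
    exact E. }
  set (dq := q - c).
  assert (Hdq : dq <> 0) by (now apply Cminus_eq_contra).
  destruct (finite_chart_law nabla c) as (d & Hd & Hlaw).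
  assert (Hform : forall x : C, x <> 0 -> Cmod x < Rmin d (Cmod dq) ->
    x - dq <> 0 /\ christoffel nabla (fin c) x = a / x ^ 2 - res / x + r / (x - dq)).
  { intros x Hx Hxd.
    destruct (Rmin_Rgt_l _ _ _ Hxd) as [X1 X2].
    assert (Hne : x - dq <> 0).
    { intros E; apply (Rlt_irrefl (Cmod dq)).
      replace dq with (x - (x - dq)) at 1 by ring.
      rewrite E; replace (x - 0) with x by ring; exact X2. }
    split; auto.
    rewrite Hlaw by auto; fold G; rewrite Hrat.
    - replace (x + c - c) with x by ring.
      replace (x + c - q) with (x - dq) by (unfold dq; ring).
      unfold Cdiv; ring.
    - intros E; apply Hx; replace x with (x + c - c) by ring; rewrite E; ring.
    - intros E; apply Hne; replace (x - dq) with (x + c - q) by (unfold dq; ring).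
      rewrite E; ring. }
  exists a, (if Ceq_dec r 0 then RtoC 0 else / dq), (Rmin d (Cmod dq)).
  split; [split; [exact Ha|split]|split; [exact Huniq|]].
  + apply Rmin_glb_lt; [auto|now apply Cmod_gt_0].
  + intros x Hx Hxd; destruct (Hform x Hx Hxd) as [Hne ->].
    destruct (Ceq_dec r 0) as [E0|Hr]; [rewrite E0; unfold Cdiv; ring|].
    assert (Er : r = res - 2).
    { destruct Hor as [E|E]; [tauto|].
      rewrite E in Hsum; replace r with (- (- (- res + r + 2)) + res - 2) by ring.
      rewrite Hsum; ring. }
    rewrite Er; field; repeat split; try assumption.
    intros E; apply Hne; replace (x - dq) with (- (dq - x)) by ring; rewrite E; ring.
  + intros E; rewrite (Hnil E), (Hr0 E) in Hsum.
    replace res with (- (- res + 0 + 2) + 2) by ring; rewrite Hsum; ring.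
- assert (Hdata : exists q b', principal_part G q 1 b' /\
    (forall z, z <> q -> holomorphic_at G z) /\ (l = nil -> b' 1%nat = 0)).
  { destruct Hlist as [->|[[q|] ->]].
    - exists 0, (fun _ => 0); split; [|split]; auto.
      + apply holomorphic_principal_part, HGhol; [discriminate|tauto].
      + intros z _; apply HGhol; [discriminate|tauto].
    - destruct (proj2 (conn_pole_finite nabla q 1)) as (_ & b' & Hb' & _);
        [apply Hsimple; simpl; auto|].
      exists q, b'; split; [exact Hb'|split; [|intros E; discriminate E]].
      intros z H2; apply HGhol; [discriminate|simpl; intros [E|[]]; congruence].
    - exfalso; apply Hpl; simpl; auto. }
  destruct Hdata as (q & b' & Hb' & HG & Hr0).
  set (r := b' 1%nat) in *.
  assert (Hqc : q + 1 <> q).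
  { intros E; apply C1_nz; replace (RtoC 1) with (q + 1 - q) by ring; rewrite E; ring. }
  (* The double pole at infinity shows up as the constant [- a]; [q + 1] is a regular point with
     zero polar part. *)
  assert (Hrat : forall z, z <> q + 1 -> z <> q ->
    G z = - a + (0 / (z - (q + 1)) ^ 2 + 0 / (z - (q + 1))) + r / (z - q)).
  { intros z H1 H2.
    rewrite (rational_of_poles G (q + 1) q (- a) 2 1 (fun _ => 0) b'); auto.
    - rewrite polar_sum_2, polar_sum_1; reflexivity.
    - now apply holomorphic_principal_part, HG.
    - intros v V1 V2; now apply holomorphic_at_Cdiff, HG.
    - exact (finite_symbol_at_infinity nabla 2 b (le_n 2) Hb). }
  assert (Hsum : - (0 + r + 2) = - res).
  { rewrite <- Hb1.
    exact (principal_part_unique _ _ _ _ _ _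
      (principal_part_at_infinity nabla (q + 1) q (- a) 0 0 r Hrat) Hb 1%nat (le_n 1)). }
  assert (Er : res = r + 2) by (replace res with (- - res) by ring; rewrite <- Hsum; ring).
  destruct (rational_symbol_at_infinity nabla _ _ _ _ _ _ Hrat) as (d & Hd & Hform).
  exists a, q, d; split; [split; [exact Ha|split; [exact Hd|]]|split; [exact Huniq|]].
  + intros w Hw Hwd; destruct (Hform w Hw Hwd) as (H1 & H2 & ->).
    rewrite Er; field; auto.
  + intros E; rewrite Er, (Hr0 E); ring.
Qed.

(** * Connections with prescribed poles *)

Lemma meromorphic_shift (f : C -> C) (c : C) :
  meromorphic f -> meromorphic (fun x => f (x + c)).
Proof.
intros H p; destruct (H (p + c)) as [Hh|(n & Hn & a & Ha & Hne)].
- left; now apply holomorphic_at_shift.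
- right; exists n; split; auto; exists a; split; auto.
  apply (principal_part_translate f _ p c n a 1); [lra|reflexivity|exact Ha].
Qed.

Definition symbol_at_infinity (G : C -> C) (w : C) : C := - (G (/ w) / w ^ 2) - 2 / w.

(** The law of a [connection] quantifies over all functions that are derivatives of the transition
    map. Uniqueness of derivatives reduces it to explicit formulas [T1] and [T2]. *)
Lemma connection_law_of_derivatives (f g T T1 : C -> C) (x T2 : C) (psi1 : C -> C) (psi2 : C)
  (S : C -> C) (d : R) :
  0 < d -> (forall y, Cmod (y - x) < d -> S y = T y) ->
  (forall y, Cmod (y - x) < d -> is_Cderive T y (T1 y)) -> is_Cderive T1 x T2 ->
  f x = T1 x * g (T x) + T2 / T1 x ->
  locally x (fun y => is_Cderive S y (psi1 y)) -> is_Cderive psi1 x psi2 ->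
  f x = psi1 x * g (S x) + psi2 / psi1 x.
Proof.
intros Hd HS HT HT1 E Hpsi1 Hpsi2.
apply locally_Cmod in Hpsi1; destruct Hpsi1 as (d' & Hd' & Hpsi1).
assert (Hx : Cmod (x - x) = 0%R) by (replace (x - x) with (RtoC 0) by ring; apply Cmod_0).
assert (Eq : forall y, Cmod (y - x) < Rmin d d' -> T1 y = psi1 y).
{ intros y Hy.
  destruct (Rmin_Rgt_l _ _ _ Hy) as [Y1 Y2].
  apply (is_Cderive_unique T y); auto.
  apply (is_Cderive_ext_loc S T y _ (d - Cmod (y - x))); auto; [lra|].
  intros w Hw; apply HS.
  pose proof (Cmod_minus_triangle w y x); lra. }
assert (Hm : 0 < Rmin d d') by (now apply Rmin_glb_lt).
rewrite (HS x) by (rewrite Hx; auto).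
rewrite <- (Eq x) by (rewrite Hx; auto).
rewrite E; do 2 f_equal.
apply (is_Cderive_unique psi1 x); auto.
eapply is_Cderive_ext_loc; eauto.
Qed.

(** Finite charts are translates of one another and the symbol at infinity is forced by the change
    of charts, so [G] determines the connection. The law is checked for the four kinds of pairs of
    charts. *)
Lemma connection_of_symbol (G : C -> C) :
  meromorphic G -> meromorphic (symbol_at_infinity G) ->
  exists nabla, (forall c x, christoffel nabla (fin c) x = G (x + c)) /\
    forall w, christoffel nabla infty w = symbol_at_infinity G w.
Proof.
intros HG Hinf.
set (chr := fun p => match p with fin c => fun x => G (x + c) | infty => symbol_at_infinity G end).
assert (Hmero : forall p, meromorphic (chr p))
  by (intros [c|]; [now apply meromorphic_shift|exact Hinf]).
assert (Hlaw : forall (p q : sphere) (x : C) (psi1 : C -> C) (psi2 : C),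
  chart_dom q (chart_inv p x) -> holomorphic_at (chr p) x ->
  locally x (fun y => is_Cderive (transition p q) y (psi1 y)) ->
  is_Cderive psi1 x psi2 ->
  chr p x = psi1 x * chr q (transition p q x) + psi2 / psi1 x).
{ intros p q x psi1 psi2 Hdom _.
  destruct p as [c|], q as [c'|]; simpl in Hdom.
  - apply (connection_law_of_derivatives _ _ (fun y => y + c - c') (fun _ => 1) x 0 _ _ _ 1);
      try lra; auto.
    + intros y _; eapply is_Cderive_eq; [Cderive|ring].
    + apply is_Cderive_const.
    + simpl; replace (x + c - c' + c') with (x + c) by ring; unfold Cdiv; ring.
  - assert (Hx : x + c <> 0) by (intros E; apply Hdom; now rewrite E).
    assert (Hne : forall y, Cmod (y - x) < Cmod (x + c) -> y + c <> 0).
    { intros y Hy E; apply (Rlt_irrefl (Cmod (x + c))).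
      replace (Cmod (x + c)) with (Cmod (y - x)) at 1; auto.
      rewrite Cmod_minus_sym; f_equal.
      replace (x - y) with (x + c - (y + c)) by ring; rewrite E; ring. }
    apply (connection_law_of_derivatives _ _ (fun y => / (y + c))
      (fun y => - / ((y + c) * (y + c))) x (2 / ((x + c) * (x + c) * (x + c))) _ _ _
      (Cmod (x + c))); auto.
    + now apply Cmod_gt_0.
    + intros y Hy; eapply is_Cderive_eq;
        [Cderive; now apply Hne|cbv beta; field; now apply Hne].
    + eapply is_Cderive_eq; [Cderive; now apply Cmult_neq_0|cbv beta; field; auto].
    + simpl; unfold symbol_at_infinity.
      replace (/ / (x + c)) with (x + c) by (field; auto).
      set (g := G (x + c)); field; repeat split; auto; apply C1_nz.
  - destruct (Ceq_dec x 0) as [E|Hx]; [tauto|].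
    assert (Hne : forall y, Cmod (y - x) < Cmod x -> y <> 0).
    { intros y Hy ->; revert Hy; replace (0 - x) with (- x) by ring; rewrite Cmod_opp; lra. }
    apply (connection_law_of_derivatives _ _ (fun y => / y - c')
      (fun y => - / (y * y)) x (2 / (x * x * x)) _ _ _ (Cmod x)).
    + now apply Cmod_gt_0.
    + intros y Hy; unfold transition; simpl; destruct (Ceq_dec y 0) as [E|]; auto.
      now destruct (Hne y Hy).
    + intros y Hy; eapply is_Cderive_eq;
        [Cderive; now apply Hne|cbv beta; field; now apply Hne].
    + eapply is_Cderive_eq; [Cderive; now apply Cmult_neq_0|cbv beta; field; auto].
    + simpl; unfold symbol_at_infinity.
      replace (/ x - c' + c') with (/ x) by ring.
      set (g := G (/ x)); field; auto.
  - apply (connection_law_of_derivatives _ _ (fun y => y) (fun _ => 1) x 0 _ _ _ 1);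
      try lra; auto.
    + intros y _; unfold transition; simpl; destruct (Ceq_dec y 0) as [->|]; auto.
      field; auto.
    + intros y _; apply is_Cderive_id.
    + apply is_Cderive_const.
    + unfold Cdiv; ring. }
exists (Connection chr Hmero Hlaw); split; reflexivity.
Qed.

Section PartialFractions.

Variables (f : C -> C) (e0 e1 e2 r q : C).

Hypothesis Hq : q <> 0.
(** [meromorphic] rejects removable singularities, so the formula must also hold at 0 and at [q]
    when the corresponding coefficients vanish; at true poles the value is free. *)
Hypothesis Hf : forall z : C, z <> 0 \/ (e1 = 0 /\ e2 = 0) -> z <> q \/ r = 0 ->
  f z = e0 + e1 / z + e2 / z ^ 2 + r / (z - q).

Lemma polar_term_holomorphic (a s p : C) (n : nat) :
  p <> s -> holomorphic_at (fun z => a / (z - s) ^ n) p.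
Proof.
intros Hps; apply holomorphic_at_eps; exists (Cmod (p - s)).
split; [apply Cmod_gt_0; now apply Cminus_eq_contra|]; intros z Hz.
assert (Hzs : z - s <> 0).
{ apply Cminus_eq_contra; intros ->; rewrite Cmod_minus_sym in Hz; lra. }
eexists; Cderive; now apply Cpow_nz.
Qed.

Lemma holomorphic_at_plus (g h : C -> C) (p : C) :
  holomorphic_at g p -> holomorphic_at h p -> holomorphic_at (fun z => g z + h z) p.
Proof.
rewrite !holomorphic_at_eps; intros (d & Hd & Hg) (d' & Hd' & Hh).
exists (Rmin d d'); split; [now apply Rmin_glb_lt|]; intros z Hz.
destruct (Hg z) as [l Hl]; [eapply Rlt_le_trans; [exact Hz|apply Rmin_l]|].
destruct (Hh z) as [k Hk]; [eapply Rlt_le_trans; [exact Hz|apply Rmin_r]|].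
exists (l + k); now apply is_Cderive_plus.
Qed.

Lemma holomorphic_at_const (a p : C) : holomorphic_at (fun _ => a) p.
Proof.
apply holomorphic_at_eps; exists 1%R; split; [lra|]; intros z _; exists 0.
apply is_Cderive_const.
Qed.

Lemma holomorphic_at_ext (g h : C -> C) (p : C) (d : R) :
  0 < d -> (forall z, Cmod (z - p) < d -> g z = h z) -> holomorphic_at g p ->
  holomorphic_at h p.
Proof.
intros Hd E; rewrite !holomorphic_at_eps; intros (d' & Hd' & H).
exists (Rmin d d'); split; [now apply Rmin_glb_lt|]; intros z Hz.
destruct (Rmin_Rgt_l _ _ _ Hz) as [Z1 Z2].
apply (Cdiff_ext_loc g h z (d - Cmod (z - p))); auto; [lra|].
intros w Hw; apply E; pose proof (Cmod_minus_triangle w z p); lra.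
Qed.

Lemma partial_fractions_holomorphic (p : C) :
  p <> 0 \/ (e1 = 0 /\ e2 = 0) -> p <> q \/ r = 0 -> holomorphic_at f p.
Proof.
intros H0 Hpq.
assert (D0 : exists d, 0 < d /\ forall z, Cmod (z - p) < d -> z <> 0 \/ (e1 = 0 /\ e2 = 0)).
{ destruct H0 as [H0|H0]; [|exists 1%R; split; [lra|auto]].
  exists (Cmod p); split; [now apply Cmod_gt_0|]; intros z Hz; left; intros ->.
  revert Hz; replace (0 - p) with (- p) by ring; rewrite Cmod_opp; lra. }
assert (D1 : exists d, 0 < d /\ forall z, Cmod (z - p) < d -> z <> q \/ r = 0).
{ destruct Hpq as [Hpq|Hpq]; [|exists 1%R; split; [lra|auto]].
  exists (Cmod (p - q)); split; [apply Cmod_gt_0; now apply Cminus_eq_contra|].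
  intros z Hz; left; intros ->; rewrite Cmod_minus_sym in Hz; lra. }
destruct D0 as (d0 & Hd0 & D0), D1 as (d1 & Hd1 & D1).
assert (T : forall (a s : C) n, p <> s \/ a = 0 -> holomorphic_at (fun z => a / (z - s) ^ n) p).
{ intros a s n [H|H]; [now apply polar_term_holomorphic|].
  apply (holomorphic_at_ext (fun _ => 0) _ p 1); [lra| |apply holomorphic_at_const].
  intros z _; rewrite H; unfold Cdiv; ring. }
apply (holomorphic_at_ext (fun z => e0 + e1 / (z - 0) ^ 1 + e2 / (z - 0) ^ 2 + r / (z - q) ^ 1)
  f p (Rmin d0 d1)).
- now apply Rmin_glb_lt.
- intros z Hz; rewrite Hf.
  + rewrite !Cpow_1_r; now replace (z - 0) with z by ring.
  + apply D0; eapply Rlt_le_trans; [exact Hz|apply Rmin_l].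
  + apply D1; eapply Rlt_le_trans; [exact Hz|apply Rmin_r].
- apply (holomorphic_at_plus (fun z => e0 + e1 / (z - 0) ^ 1 + e2 / (z - 0) ^ 2)
    (fun z => r / (z - q) ^ 1)); [|exact (T r q 1%nat Hpq)].
  apply (holomorphic_at_plus (fun z => e0 + e1 / (z - 0) ^ 1) (fun z => e2 / (z - 0) ^ 2));
    [|apply (T e2 0 2%nat); tauto].
  apply (holomorphic_at_plus (fun _ => e0) (fun z => e1 / (z - 0) ^ 1));
    [apply holomorphic_at_const|apply (T e1 0 1%nat); tauto].
Qed.

Lemma partial_fractions_at_q : principal_part f q 1 (fun _ => r).
Proof.
apply (principal_part_intro f (fun z => e0 + e1 / (z - 0) ^ 1 + e2 / (z - 0) ^ 2) q 1 _ (Cmod q)).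
- now apply Cmod_gt_0.
- apply (holomorphic_at_plus (fun z => e0 + e1 / (z - 0) ^ 1) (fun z => e2 / (z - 0) ^ 2));
    [|now apply (polar_term_holomorphic e2 0 q 2)].
  apply (holomorphic_at_plus (fun _ => e0) (fun z => e1 / (z - 0) ^ 1));
    [apply holomorphic_at_const|now apply (polar_term_holomorphic e1 0 q 1)].
- intros x Hx Hxd; rewrite Hf.
  + rewrite polar_sum_1, !Cpow_1_r; replace (q + x - 0) with (q + x) by ring.
    now replace (q + x - q) with x by ring.
  + left; intros E; apply (Rlt_irrefl (Cmod q)).
    replace (Cmod q) with (Cmod x) at 1; auto.
    rewrite <- Cmod_opp; f_equal; replace q with (q + x - x) by ring; rewrite E; ring.
  + left; intros E; apply Hx; replace x with (q + x - q) by ring; rewrite E; ring.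
Qed.

Lemma partial_fractions_at_0 :
  principal_part f 0 2 (fun k => if Nat.eqb k 2 then e2 else e1).
Proof.
apply (principal_part_intro f (fun z => e0 + r / (z - q) ^ 1) 0 2 _ (Cmod q)).
- now apply Cmod_gt_0.
- apply (holomorphic_at_plus (fun _ => e0) (fun z => r / (z - q) ^ 1));
    [apply holomorphic_at_const|now apply (polar_term_holomorphic r q 0 1), not_eq_sym].
- intros x Hx Hxd; replace (0 + x) with x by ring; rewrite Hf.
  + rewrite polar_sum_2, Cpow_1_r; cbv beta iota delta [Nat.eqb]; ring.
  + auto.
  + left; intros ->; lra.
Qed.

Lemma partial_fractions_at_0_simple : e2 = 0 -> principal_part f 0 1 (fun _ => e1).
Proof.
intros E2; destruct (principal_part_eps _ _ _ _ partial_fractions_at_0) as (h & d & Hd & Hh & E).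
apply (principal_part_intro f h 0 1 _ d Hd Hh); intros x Hx Hxd.
rewrite (E x Hx Hxd), polar_sum_2, polar_sum_1; cbv beta iota delta [Nat.eqb]; rewrite E2; unfold Cdiv; ring.
Qed.

Lemma partial_fractions_meromorphic : meromorphic f.
Proof.
intros p; destruct (Ceq_dec p 0) as [->|Hp].
- destruct (Ceq_dec e2 0) as [E2|E2].
  + destruct (Ceq_dec e1 0) as [E1|E1].
    * left; apply partial_fractions_holomorphic; auto.
    * right; exists 1%nat; split; [auto|]; exists (fun _ => e1); split; auto.
      now apply partial_fractions_at_0_simple.
  + right; exists 2%nat; split; [auto|]; eexists; split;
      [apply partial_fractions_at_0|exact E2].
- destruct (Ceq_dec p q) as [->|Hpq].
  + destruct (Ceq_dec r 0) as [Er|Er].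
    * left; apply partial_fractions_holomorphic; auto.
    * right; exists 1%nat; split; [auto|]; exists (fun _ => r); split; auto.
      apply partial_fractions_at_q.
  + left; apply partial_fractions_holomorphic; auto.
Qed.

End PartialFractions.

(* In the coordinate [z], this connection has developing maps with derivative
   [exp (- z) * z ^ (res - 2 - k) * (z - c) ^ k]. *)
Lemma model_connection (res c : C) (k : nat) :
  c <> 0 -> exists nabla : connection,
    conn_pole nabla infty 2 /\ conn_residue nabla infty res /\
    (res - 2 <> RtoC (INR k) -> conn_pole nabla (fin 0) 1) /\
    (k <> 0%nat -> conn_pole nabla (fin c) 1) /\
    (forall s n, conn_pole nabla (fin s) n ->
      (s = 0 /\ (res - 2 = RtoC (INR k) -> k <> 0%nat)) \/ (s = c /\ k <> 0%nat)) /\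
    principal_part (christoffel nabla infty) 0 2
      (fun j => if Nat.eqb j 2 then RtoC 1 else - res) /\
    (forall w : C, w <> 0 -> w <> / c \/ k = 0%nat ->
      christoffel nabla infty w = 1 / w ^ 2 - res / w + RtoC (INR k) / (w - / c)).
Proof.
intros Hc.
set (r := RtoC (INR k)).
assert (Hr : r = 0 <-> k = 0%nat).
{ unfold r; split; [intros E; apply RtoC_inj in E; now apply INR_eq|intros ->; reflexivity]. }
assert (Hic : / c <> 0).
{ intros E; apply C1_nz; rewrite <- (Cinv_r c Hc), E; ring. }
(* The logarithmic derivative of [exp (- z) * z ^ (res - 2 - k) * (z - c) ^ k]; the exponents are
   chosen so that the residue at infinity is [res]. *)
set (G := fun z => - (1) + (res - 2 - r) / z + 0 / z ^ 2 + r / (z - c)).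
assert (HG : forall z : C, z <> 0 \/ (res - 2 - r = 0 /\ RtoC 0 = 0) -> z <> c \/ r = 0 ->
  G z = - (1) + (res - 2 - r) / z + 0 / z ^ 2 + r / (z - c)) by reflexivity.
assert (Hinf : forall w : C, w <> 0 \/ (- res = 0 /\ RtoC 1 = 0) -> w <> / c \/ r = 0 ->
  symbol_at_infinity G w = 0 + - res / w + 1 / w ^ 2 + r / (w - / c)).
{ intros w [Hw|[_ E]]; [|destruct (C1_nz E)]; intros Hwc.
  unfold symbol_at_infinity, G.
  destruct Hwc as [Hwc|E]; [|rewrite E; unfold Cdiv; rewrite !Cmult_0_l; field; auto].
  assert (H1 : 1 - c * w <> 0).
  { intros E; apply Hwc; replace w with ((1 - (1 - c * w)) / c) by (field; auto).
    rewrite E; field; auto. }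
  assert (H2 : w * c - 1 <> 0).
  { intros E; apply H1; replace (1 - c * w) with (- (w * c - 1)) by ring; rewrite E; ring. }
  field; repeat split; auto. }
destruct (connection_of_symbol G) as (nabla & Hfin & Hinfty).
{ exact (partial_fractions_meromorphic G _ _ _ r c Hc HG). }
{ exact (partial_fractions_meromorphic _ _ _ _ r (/ c) Hic Hinf). }
assert (Hpp : principal_part (christoffel nabla infty) 0 2
  (fun j => if Nat.eqb j 2 then RtoC 1 else - res)).
{ apply (partial_fractions_at_0 (christoffel nabla infty) 0 (- res) 1 r (/ c) Hic).
  intros w H1 H2; rewrite Hinfty; auto. }
assert (Hpole : forall s n, pole G s n <-> conn_pole nabla (fin s) n).
{ intros s n; unfold conn_pole, pole.
  assert (E : forall a, principal_part G s n a <->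
    principal_part (christoffel nabla (fin s)) 0 n a).
  { intros a; apply (principal_part_shift _ _ s n a 1); [lra|intros; apply Hfin]. }
  split; intros (Hn & a & Ha & Hne); split; auto; exists a; split; auto; now apply E. }
exists nabla; split; [|split; [|split; [|split; [|split; [|split]]]]].
- split; [auto|]; eexists; split; [exact Hpp|exact C1_nz].
- exists 2%nat, (fun j => - (if Nat.eqb j 2 then RtoC 1 else - res)).
  split; [auto|split; [now apply principal_part_opp|simpl; ring]].
- intros Hne; apply Hpole; split; [auto|]; exists (fun _ => res - 2 - r); split.
  + exact (partial_fractions_at_0_simple G _ _ _ r c Hc HG eq_refl).
  + now apply Cminus_eq_contra.
- intros Hk; apply Hpole; split; [auto|]; exists (fun _ => r); split.
  + exact (partial_fractions_at_q G _ _ _ r c Hc HG).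
  + intros E; apply Hk, Hr, E.
- intros s n Hn; apply Hpole, pole_not_holomorphic in Hn.
  destruct (Ceq_dec s 0) as [Es|Es].
  + left; split; auto; intros E Hk; apply Hn.
    apply (partial_fractions_holomorphic G (- (1)) (res - 2 - r) 0 r c); auto.
    * right; split; auto; rewrite E; fold r; ring.
    * right; now apply Hr.
  + destruct (Ceq_dec s c) as [Esc|Esc].
    * right; split; auto; intros Hk; apply Hn.
      apply (partial_fractions_holomorphic G (- (1)) (res - 2 - r) 0 r c); auto.
      right; now apply Hr.
    * exfalso; apply Hn.
      apply (partial_fractions_holomorphic G (- (1)) (res - 2 - r) 0 r c); auto.
- exact Hpp.
- intros w Hw Hwc; rewrite Hinfty, Hinf; auto; [unfold Cdiv; ring|].
  destruct Hwc as [|Hk]; [auto|right; now apply Hr].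
Qed.

(** * Asymptotic values of the model connections *)

(** Implies [asymptotic_value]: a path whose lifted argument tends to [th] eventually stays in the
    strip. Unlike a condition on paths, it passes easily through translations and affine maps. *)
Definition strip_limit (phi : C -> C) (th : R) (u : C) : Prop :=
  forall e, 0 < e -> exists M, forall zeta,
    Re zeta < M -> Rabs (Im zeta - th) <= 1 -> Cmod (phi zeta - u) < e.

Lemma strip_limit_radial (phi : C -> C) (th : R) (u : C) :
  strip_limit phi th u ->
  forall e, 0 < e -> exists M, forall x, x < M -> Cmod (phi (x, th) - u) < e.
Proof.
intros H e He; destruct (H e He) as [M HM]; exists M; intros x Hx; apply HM; [exact Hx|].
simpl; rewrite Rminus_diag, Rabs_R0; lra.
Qed.

Lemma strip_limit_unique (phi : C -> C) (th : R) (u v : C) :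
  strip_limit phi th u -> strip_limit phi th v -> u = v.
Proof.
intros Hu Hv; apply (limit_unique (fun x => phi (x, th)) (fun x => phi (x, th))).
- now apply strip_limit_radial.
- now apply strip_limit_radial.
- exists 0%R; reflexivity.
Qed.

Lemma strip_limit_asymptotic_value (phi : C -> C) (eps th : R) (u : C) :
  strip_limit phi th u -> asymptotic_value eps phi th u.
Proof.
intros H gamma _ _ Hg Him; apply filterlim_Cmod; intros e He.
destruct (H e He) as [M HM].
destruct (proj1 (filterlim_Cmod _ _) Hg (exp M) (exp_pos M)) as [T1 HT1].
destruct (Him (fun y => Rabs (y - th) <= 1)) as [T2 HT2].
{ exists (mkposreal 1 Rlt_0_1); intros y Hy; apply Rlt_le, Hy. }
exists (Rmax T1 T2); intros t Ht.
apply HM.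
- specialize (HT1 t (Rle_lt_trans _ _ _ (Rmax_l _ _) Ht)).
  replace (Cexp (gamma t) - 0) with (Cexp (gamma t)) in HT1 by ring.
  rewrite Cmod_Cexp in HT1; now apply exp_lt_inv.
- apply HT2; exact (Rle_lt_trans _ _ _ (Rmax_r _ _) Ht).
Qed.

(** The bound makes [psi] integrable along the real half-line, hence a Cauchy condition; a vertical
    displacement of at most 1 then costs at most [K * exp (Re zeta)]. *)
Lemma strip_limit_exists (phi psi : C -> C) (K : R) :
  (forall zeta, is_Cderive phi zeta (psi zeta)) ->
  (forall zeta, Re zeta <= 0 -> Rabs (Im zeta) <= 1 -> Cmod (psi zeta) <= K * exp (Re zeta)) ->
  exists u, strip_limit phi 0 u.
Proof.
intros Hphi Hpsi.
assert (HK : 0 <= K).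
{ specialize (Hpsi 0); rewrite re_RtoC, im_RtoC, Rabs_R0, exp_0 in Hpsi.
  specialize (Hpsi ltac:(lra) ltac:(lra)); pose proof (Cmod_ge_0 (psi 0)); lra. }
assert (Hh : forall x y, x <= y -> y <= 0 ->
  Cmod (phi (y, 0)%R - phi (x, 0)%R) <= K * exp y).
{ intros x y Hxy Hy.
  assert (M : Cmod (phi (y, 0)%R - phi (x, 0)%R) <= K * exp y - K * exp x).
  { apply (mean_value_inequality (fun t => phi (t, 0)%R) (fun t => psi (t, 0)%R)
      (fun t => K * exp t)%R (fun t => K * exp t)%R x y Hxy).
    - intros t _; apply is_derive_h, Hphi.
    - intros t _; auto_derive; auto; ring.
    - intros t Ht; apply Hpsi; simpl; [lra|rewrite Rabs_R0; lra]. }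
  pose proof (exp_pos x); nra. }
assert (Hsmall : forall e, 0 < e -> exists X, X <= 0 /\ K * exp X < e).
{ intros e He; exists (Rmin 0 (ln (e / (K + 1)))); split; [apply Rmin_l|].
  assert (Hq : 0 < e / (K + 1)) by (apply Rdiv_lt_0_compat; lra).
  assert (exp (Rmin 0 (ln (e / (K + 1)))) <= e / (K + 1)).
  { rewrite <- (exp_ln (e / (K + 1))) at 2 by auto; apply exp_le_mono, Rmin_r. }
  assert (e / (K + 1) * (K + 1) = e)%R by (field; lra).
  pose proof (exp_pos (Rmin 0 (ln (e / (K + 1))))); nra. }
assert (Hlim : exists u, filterlim (fun x => phi (x, 0)%R) (Rbar_locally m_infty)
  (locally (T := C_R_CompleteNormedModule) u)).
{ apply (filterlim_locally_cauchy (U := C_R_CompleteNormedModule)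
    (F := Rbar_locally m_infty)); intros e.
  destruct (Hsmall e (cond_pos e)) as (X & HX & HXe).
  exists (fun x => x < X); split; [exists X; auto|]; intros x y Hx Hy.
  apply C_NormedModule_mixin_compat1.
  change (minus (phi (y, 0)%R) (phi (x, 0)%R)) with (phi (y, 0)%R - phi (x, 0)%R).
  assert (Hxy : forall x y, x <= y -> y < X -> Cmod (phi (y, 0)%R - phi (x, 0)%R) < e).
  { intros x' y' H1 H2; eapply Rle_lt_trans; [apply Hh; lra|].
    eapply Rle_lt_trans; [|exact HXe]; apply Rmult_le_compat_l; auto.
    apply exp_le_mono; lra. }
  destruct (Rle_or_lt x y); [auto|rewrite Cmod_minus_sym; apply Hxy; lra]. }
destruct Hlim as [u Hu]; exists u; intros e He.
destruct (Hu (fun w => Cmod (w - u) < e / 2)) as [M HM].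
{ apply locally_Cmod; exists (e / 2)%R; split; [lra|auto]. }
destruct (Hsmall (e / 2)%R ltac:(lra)) as (X & HX & HXe).
exists (Rmin M X); intros zeta Hz Him; rewrite Rminus_0_r in Him.
destruct (Rmin_Rgt_l _ _ _ Hz) as [Z1 Z2].
assert (Hv : Cmod (phi zeta - phi (Re zeta, 0)%R) <= K * exp (Re zeta) * Cmod (zeta - (Re zeta, 0)%R)).
{ apply (line_mean_value phi psi).
  - intros t _; apply Hphi.
  - intros t Ht; set (p := (Re zeta, 0)%R + RtoC t * (zeta - (Re zeta, 0)%R)).
    assert (E1 : Re p = Re zeta) by (unfold p, Re; simpl; ring).
    assert (E2 : Im p = (t * Im zeta)%R) by (unfold p, Im; simpl; ring).
    rewrite <- E1; apply Hpsi; rewrite ?E1, ?E2; [lra|].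
    rewrite Rabs_mult, (Rabs_right t) by lra; pose proof (Rabs_pos (Im zeta)); nra. }
assert (Hd : Cmod (zeta - (Re zeta, 0)%R) <= 1).
{ replace (zeta - (Re zeta, 0)%R) with ((0, Im zeta)%R : C)
    by (apply Ceq_re_im; unfold Re, Im; simpl; ring).
  eapply Rle_trans; [apply Cmod_pair_le|]; rewrite Rabs_R0; lra. }
assert (Hx : Cmod (phi (Re zeta, 0)%R - u) < e / 2) by (apply HM, Z1).
pose proof (Cmod_minus_triangle (phi zeta) (phi (Re zeta, 0)%R) u).
assert (K * exp (Re zeta) <= K * exp X)
  by (apply Rmult_le_compat_l; [auto|apply exp_le_mono; lra]).
pose proof (exp_pos (Re zeta)).
assert (K * exp (Re zeta) * Cmod (zeta - (Re zeta, 0)%R) <= K * exp (Re zeta) * 1)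
  by (apply Rmult_le_compat_l; [nra|auto]).
lra.
Qed.

Lemma quasi_periodic_primitive (phi psi : C -> C) (mu : C) :
  (forall zeta, is_Cderive phi zeta (psi zeta)) ->
  (forall zeta, psi (zeta + period) = mu * psi zeta) ->
  exists b, forall zeta, phi (zeta + period) = mu * phi zeta + b.
Proof.
intros Hphi Hpsi; exists (phi (0 + period) - mu * phi 0); intros zeta.
assert (E : phi (zeta + period) - mu * phi zeta = phi (0 + period) - mu * phi 0).
{ apply (is_Cderive_zero_const (fun v => phi (v + period) - mu * phi v)
    (Rmax (Re zeta) 0 + 1)).
  - intros v _; eapply is_Cderive_eq.
    + apply is_Cderive_minus; [apply is_Cderive_shift, Hphi|Cderive; apply Hphi].
    + cbv beta; rewrite Hpsi; ring.
  - rewrite re_RtoC; pose proof (Rmax_r (Re zeta) 0); lra.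
  - pose proof (Rmax_l (Re zeta) 0); lra. }
rewrite <- E; ring.
Qed.

Lemma strip_limit_affine (phi : C -> C) (th : R) (u c b : C) :
  strip_limit phi th u -> strip_limit (fun zeta => c * phi zeta + b) th (c * u + b).
Proof.
intros H e He; pose proof (Cmod_ge_0 c) as Hc.
destruct (H (e / (Cmod c + 1))%R) as [M HM]; [apply Rdiv_lt_0_compat; lra|].
exists M; intros zeta Hz Him; specialize (HM zeta Hz Him).
replace (c * phi zeta + b - (c * u + b)) with (c * (phi zeta - u)) by ring.
rewrite Cmod_mult; pose proof (Cmod_ge_0 (phi zeta - u)).
assert (e / (Cmod c + 1) * (Cmod c + 1) = e)%R by (field; lra).
nra.
Qed.

Lemma strip_limit_ext (phi phi' : C -> C) (th : R) (u : C) :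
  (forall zeta, phi zeta = phi' zeta) -> strip_limit phi th u -> strip_limit phi' th u.
Proof.
intros E H e He; destruct (H e He) as [M HM]; exists M; intros zeta; rewrite <- E; apply HM.
Qed.

Lemma strip_limit_period (phi : C -> C) (k : Z) (u : C) :
  strip_limit (fun zeta => phi (zeta + period)) (2 * PI * IZR k) u <->
  strip_limit phi (2 * PI * IZR (k + 1)) u.
Proof.
rewrite plus_IZR.
split; intros H e He; destruct (H e He) as [M HM]; exists M; intros zeta Hz Him.
- specialize (HM (zeta - period)); replace (zeta - period + period) with zeta in HM by ring.
  unfold Cminus in HM at 1 2; rewrite re_plus, im_plus, re_opp, im_opp in HM.
  change (Re period) with 0%R in HM; change (Im period) with (2 * PI)%R in HM.
  apply HM; [lra|].
  replace (Im zeta + - (2 * PI) - 2 * PI * IZR k)%R with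
    (Im zeta - 2 * PI * (IZR k + 1))%R by ring; exact Him.
- apply HM; rewrite ?re_plus, ?im_plus;
    change (Re period) with 0%R; change (Im period) with (2 * PI)%R; [lra|].
  replace (Im zeta + 2 * PI - 2 * PI * (IZR k + 1))%R with
    (Im zeta - 2 * PI * IZR k)%R by ring; exact Him.
Qed.

(** Translation by a period carries the limit to the next strip through [v -> mu * v + b], and to
    the previous one through the inverse map; a limit in one strip therefore yields all of them. *)
Lemma strip_limit_sequence (phi : C -> C) (mu b u0 : C) :
  mu <> 0 -> (forall zeta, phi (zeta + period) = mu * phi zeta + b) ->
  strip_limit phi 0 u0 ->
  exists u : Z -> C, u 0%Z = u0 /\ (forall k, strip_limit phi (2 * PI * IZR k) (u k)) /\
    forall k, u (k + 1)%Z = mu * u k + b.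
Proof.
intros Hmu Hphi H0.
assert (Hup : forall k v, strip_limit phi (2 * PI * IZR k) v ->
  strip_limit phi (2 * PI * IZR (k + 1)) (mu * v + b)).
{ intros k v H; apply strip_limit_period; apply (strip_limit_affine _ _ _ mu b) in H.
  revert H; apply strip_limit_ext; intros; now rewrite Hphi. }
assert (Hdown : forall k v, strip_limit phi (2 * PI * IZR k) v ->
  strip_limit phi (2 * PI * IZR (k - 1)) (/ mu * v + - (b / mu))).
{ intros k v H; replace k with (k - 1 + 1)%Z in H by lia.
  apply strip_limit_period, (strip_limit_affine _ _ _ (/ mu) (- (b / mu))) in H.
  revert H; apply strip_limit_ext; intros; rewrite Hphi; field; auto. }
assert (Hex : forall k : Z, exists v, strip_limit phi (2 * PI * IZR k) v).
{ intros k; induction k as [|k [v IH]|k [v IH]] using Z.peano_ind.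
  - exists u0; now rewrite Rmult_0_r.
  - exists (mu * v + b); rewrite <- Z.add_1_r; auto.
  - exists (/ mu * v + - (b / mu)); rewrite <- Z.sub_1_r; auto. }
destruct (functional_choice _ Hex) as [u Hu].
exists u; split; [|split; auto].
- apply (strip_limit_unique phi 0); auto.
  specialize (Hu 0%Z); now rewrite Rmult_0_r in Hu.
- intros k; apply (strip_limit_unique phi (2 * PI * IZR (k + 1))); auto.
Qed.

(* The derivative of a developing map of [model_connection] with respect to the coordinate
   [zeta = - log z], up to a constant factor. *)
Definition model_density (res c : C) (k : nat) (zeta : C) : C :=
  Cexp (- Cexp (- zeta) + (1 - res) * zeta) * (1 - c * Cexp zeta) ^ k.

Lemma is_Cderive_model_density (res c : C) (k : nat) (zeta : C) :
  1 - c * Cexp zeta <> 0 \/ k = 0%nat ->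
  is_Cderive (model_density res c k) zeta
    ((Cexp (- zeta) + (1 - res) - RtoC (INR k) * c * Cexp zeta / (1 - c * Cexp zeta)) *
     model_density res c k zeta).
Proof.
intros Hk; eapply is_Cderive_eq.
- unfold model_density; Cderive.
- unfold model_density; cbv beta.
  destruct k as [|k].
  + simpl; unfold Cdiv; ring.
  + simpl pred; rewrite Cpow_S; field; destruct Hk; [auto|discriminate].
Qed.

Lemma model_density_entire (res c : C) (k : nat) : entire (model_density res c k).
Proof.
intros zeta; unfold model_density; eexists; Cderive.
Qed.

(** [PI > 3], so [1 < PI / 3]. *)
Lemma half_le_cos (y : R) : Rabs y <= 1 -> 1 / 2 <= cos y.
Proof.
intros Hy; pose proof PI2_3_2.
replace (cos y) with (cos (Rabs y))
  by (unfold Rabs; destruct (Rcase_abs y); [apply cos_neg|reflexivity]).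
rewrite <- cos_PI3; apply cos_decr_1; pose proof (Rabs_pos y); lra.
Qed.

(** Let [t = exp (- Re zeta)]. In the strip [Re (Cexp (- zeta)) >= t / 2], while the power
    contributes at most a constant times [t ^ N], where [N] exceeds [Cmod (1 - res)]. The product is
    [O (/ t)], that is [O (exp (Re zeta))]. *)
Lemma model_density_bound (res c : C) (k : nat) :
  exists K, forall zeta, Re zeta <= 0 -> Rabs (Im zeta) <= 1 ->
    Cmod (model_density res c k zeta) <= K * exp (Re zeta).
Proof.
set (kap := Cmod (1 - res)).
assert (Hkap : 0 <= kap) by apply Cmod_ge_0.
destruct (INR_unbounded kap) as [N HN].
set (K1 := ((INR (S N) / (1 / 2)) ^ S N)%R).
exists (K1 * exp kap * (1 + Cmod c) ^ k)%R; intros zeta Hre Him.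
unfold model_density; rewrite Cmod_mult, Cmod_pow, Cmod_Cexp, re_plus, re_opp, re_Cexp,
  re_opp, im_opp, cos_neg.
set (t := exp (- Re zeta)).
assert (Ht1 : 1 <= t) by (unfold t; rewrite <- exp_0; apply exp_le_mono; lra).
pose proof (half_le_cos (Im zeta) Him) as Hcos.
assert (Hlin : Re ((1 - res) * zeta) <= INR N * (- Re zeta) + kap).
{ eapply Rle_trans; [apply Rle_abs|]; eapply Rle_trans; [apply re_le_Cmod|].
  rewrite Cmod_mult; fold kap.
  pose proof (Cmod_le_re_im zeta) as Hm.
  rewrite (Rabs_left1 (Re zeta)) in Hm by lra.
  assert (kap * Cmod zeta <= kap * (- Re zeta + 1)) by (apply Rmult_le_compat_l; lra).
  assert (kap * - Re zeta <= INR N * - Re zeta) by (apply Rmult_le_compat_r; lra).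
  lra. }
assert (H1 : exp (- (t * cos (Im zeta)) + Re ((1 - res) * zeta)) <=
  t ^ N * exp (- (1 / 2 * t)) * exp kap).
{ replace (t ^ N)%R with (exp (INR N * (- Re zeta))).
  2:{ unfold t; rewrite <- Rpower_pow by apply exp_pos.
      unfold Rpower; rewrite ln_exp; reflexivity. }
  rewrite <- !exp_plus; apply exp_le_mono.
  assert (t * (1 / 2) <= t * cos (Im zeta)) by (apply Rmult_le_compat_l; lra).
  lra. }
assert (H2 : t ^ N * exp (- (1 / 2 * t)) <= K1 * exp (Re zeta)).
{ eapply Rle_trans; [apply pow_exp_bound; lra|]; fold K1.
  right; unfold Rdiv; f_equal; unfold t; rewrite exp_Ropp, Rinv_inv; reflexivity. }
assert (H3 : Cmod (1 - c * Cexp zeta) ^ k <= (1 + Cmod c) ^ k).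
{ apply pow_incr; split; [apply Cmod_ge_0|].
  eapply Rle_trans; [apply Cmod_triangle|]; rewrite Cmod_opp, Cmod_1, Cmod_mult, Cmod_Cexp.
  assert (exp (Re zeta) <= 1) by (rewrite <- exp_0; apply exp_le_mono; lra).
  pose proof (Cmod_ge_0 c); pose proof (exp_pos (Re zeta)); nra. }
replace (K1 * exp kap * (1 + Cmod c) ^ k * exp (Re zeta))%R with
  (K1 * exp (Re zeta) * exp kap * (1 + Cmod c) ^ k)%R by ring.
apply Rmult_le_compat; [apply Rlt_le, exp_pos|apply pow_le, Cmod_ge_0| |exact H3].
eapply Rle_trans; [exact H1|]; apply Rmult_le_compat_r; [apply Rlt_le, exp_pos|exact H2].
Qed.

(** Monodromy of the derivative of developing maps about the double pole; it is the ratio in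
    [U2]. *)
Definition multiplier (res : C) : C := Cexp (- (2 * RtoC PI * Ci * res)).

Lemma model_density_period (res c : C) (k : nat) (zeta : C) :
  model_density res c k (zeta + period) = multiplier res * model_density res c k zeta.
Proof.
unfold model_density, multiplier; rewrite !Cexp_opp, Cexp_period, Cmult_assoc.
f_equal.
assert (Ep : period = 2 * RtoC PI * Ci)
  by (apply Ceq_re_im; unfold period, Re, Im; simpl; ring).
replace (- / Cexp zeta + (1 - res) * (zeta + period)) with
  (period + (- (2 * RtoC PI * Ci * res) + (- / Cexp zeta + (1 - res) * zeta)))
  by (rewrite Ep; ring).
rewrite !Cexp_plus, Ep, Cexp_2PI, Cexp_opp; ring.
Qed.

Lemma model_family (nabla : connection) (res c : C) (k : nat) (phi : C -> C) :
  c <> 0 ->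
  principal_part (christoffel nabla infty) 0 2 (fun j => if Nat.eqb j 2 then RtoC 1 else - res) ->
  (forall w : C, w <> 0 -> w <> / c \/ k = 0%nat ->
    christoffel nabla infty w = 1 / w ^ 2 - res / w + RtoC (INR k) / (w - / c)) ->
  (forall zeta, is_Cderive phi zeta (model_density res c k zeta)) ->
  exists u b, asymptotic_family (christoffel nabla infty) u /\ strip_limit phi 0 (u 0%Z) /\
    (forall zeta, phi (zeta + period) = multiplier res * phi zeta + b) /\
    forall j, u (j + 1)%Z = multiplier res * u j + b.
Proof.
intros Hc Hpp Hform Hphi.
assert (Hic : / c <> 0).
{ intros E; apply C1_nz; rewrite <- (Cinv_r c Hc), E; ring. }
assert (Hcm := proj1 (Cmod_gt_0 c) Hc).
destruct (quasi_periodic_primitive phi _ _ Hphi (model_density_period res c k)) as [b Hb].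
destruct (model_density_bound res c k) as [K HK].
destruct (strip_limit_exists phi _ K Hphi HK) as [u0 Hu0].
destruct (strip_limit_sequence phi (multiplier res) b u0 (Cexp_neq_0 _) Hb Hu0)
  as (u & E0 & Hu & Hrec).
exists u, b; split; [|split; [rewrite E0; exact Hu0|split; [exact Hb|exact Hrec]]].
assert (Hfar : forall w, Cmod w < / Cmod c -> w <> / c).
{ intros w Hw ->; rewrite Cmod_inv in Hw by auto; lra. }
(* The other possible pole is at [/ c], whence the radius; the leading coefficient is 1, so the
   repelling axis has argument 0. *)
exists (fun j => if Nat.eqb j 2 then RtoC 1 else - res), (/ Cmod c)%R, 0%R, phi.
split; [exact Hpp|split; [now apply Rinv_0_lt_compat|split; [|split; [|split]]]].
- intros w Hw Hwc.
  apply (partial_fractions_holomorphic _ 0 (- res) 1 (RtoC (INR k)) (/ c));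
    [|left; intros E; apply Hw; now apply RtoC_inj in E|left; now apply Hfar].
  intros v Hv Hvc; rewrite Hform; [unfold Cdiv; ring| |].
  + destruct Hv as [|[_ E]]; [auto|destruct (C1_nz E)].
  + destruct Hvc as [|E]; [auto|right; apply RtoC_inj in E; now apply INR_eq].
- exists (fun zeta => model_density res c k zeta * Cexp (- zeta)),
    (fun zeta => christoffel nabla infty (Cexp zeta) *
      (model_density res c k zeta * Cexp (- zeta))).
  intros zeta Hz; unfold in_cover in Hz; unfold is_zderive.
  set (x := Cexp zeta).
  assert (Hx : x <> 0) by apply Cexp_neq_0.
  assert (Hxm : Cmod x < / Cmod c).
  { unfold x; rewrite Cmod_Cexp; rewrite <- (exp_ln (/ Cmod c)) by (now apply Rinv_0_lt_compat).
    now apply exp_increasing. }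
  assert (Hxc := Hfar x Hxm).
  assert (H1 : 1 - c * x <> 0).
  { intros E; apply Hxc; replace x with ((1 - (1 - c * x)) / c) by (field; auto).
    rewrite E; field; auto. }
  assert (H2 : x * c - 1 <> 0).
  { intros E; apply H1; replace (1 - c * x) with (- (x * c - 1)) by ring; rewrite E; ring. }
  assert (Ex : Cexp (- zeta) = / x) by apply Cexp_opp.
  assert (Hd0 : model_density res c k zeta <> 0).
  { unfold model_density; apply Cmult_neq_0; [apply Cexp_neq_0|now apply Cpow_nz]. }
  assert (Hprod : model_density res c k zeta * Cexp (- zeta) <> 0)
    by (apply Cmult_neq_0; [auto|apply Cexp_neq_0]).
  split; [|split; [exact Hprod|split]].
  + eapply is_Cderive_eq; [apply Hphi|]; rewrite Ex; field; auto.
  + eapply is_Cderive_eq.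
    * apply is_Cderive_mult; [apply is_Cderive_model_density; left; exact H1|Cderive].
    * cbv beta; fold x; rewrite Ex, Hform by auto; field; auto.
  + fold x; field; repeat split; auto using Cexp_neq_0.
- unfold repelling_arg; cbv zeta.
  replace (- (Ci * RtoC 0)) with (RtoC 0) by ring.
  rewrite Cexp_0; simpl; split; lra.
- intros n; rewrite Rplus_0_l; apply strip_limit_asymptotic_value, Hu.
Qed.

(** * The invariant *)

(** The differences [u (k + 1) - u k] form a geometric sequence of nonzero ratio: if one vanishes,
    all do. *)
Lemma U2_constant (res : C) (u : Z -> C) :
  U2 res u -> u 1%Z = u 0%Z -> forall k, u k = u 0%Z.
Proof.
intros [b Hu] H1.
fold (multiplier res) in Hu.
assert (Hmu : multiplier res <> 0) by apply Cexp_neq_0.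
assert (Hstep : forall k : Z, u (k + 1)%Z = u k).
{ intros k; induction k as [|k IH|k IH] using Z.peano_ind; [exact H1| |].
  - rewrite Hu, <- Z.add_1_r, IH at 1; rewrite <- Hu; reflexivity.
  - unfold Z.pred in *; replace (k + -1 + 1)%Z with k by lia.
    assert (E : multiplier res * (u k - u (k + -1)%Z) = 0).
    { replace (multiplier res * (u k - u (k + -1)%Z)) with
        (multiplier res * u k + b - (multiplier res * u (k + -1)%Z + b)) by ring.
      rewrite <- !Hu, IH; replace (k + -1 + 1)%Z with k by lia; ring. }
    apply Ceq_minus; destruct (Ceq_dec (u k - u (k + -1)%Z) 0) as [E'|E']; auto.
    now destruct (Cmult_neq_0 _ _ Hmu E'). }
intros k; induction k as [|k IH|k IH] using Z.peano_ind; [reflexivity| |].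
- rewrite <- Z.add_1_r, Hstep; exact IH.
- rewrite <- (Hstep (Z.pred k)); unfold Z.pred; replace (k + -1 + 1)%Z with k by lia; exact IH.
Qed.

(** When [u] is not constant, [du * v - dv * u] satisfies a recurrence of the same kind and takes
    equal values at 0 and 1. It is therefore constant, which makes [v] an affine function of [u]. *)
Lemma U2_affine_equiv (res : C) (u v : Z -> C) :
  U2 res u -> U2 res v -> (u 1%Z = u 0%Z <-> v 1%Z = v 0%Z) -> affine_equiv u v.
Proof.
intros Hu Hv H; destruct (Ceq_dec (u 1%Z) (u 0%Z)) as [E|E].
- exists 1, (v 0%Z - u 0%Z); split; [apply C1_nz|]; intros k.
  rewrite (U2_constant _ _ Hu E), (U2_constant _ _ Hv (proj1 H E)); ring.
- assert (Du : u 1%Z - u 0%Z <> 0) by (now apply Cminus_eq_contra).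
  assert (Dv : v 1%Z - v 0%Z <> 0) by (apply Cminus_eq_contra; tauto).
  set (du := u 1%Z - u 0%Z) in *; set (dv := v 1%Z - v 0%Z) in *.
  assert (Hw : U2 res (fun k => du * v k - dv * u k)).
  { destruct Hu as [b Hb], Hv as [b' Hb']; exists (du * b' - dv * b); intros k.
    rewrite Hb, Hb'; ring. }
  assert (Hc := U2_constant _ _ Hw); cbv beta in Hc.
  exists (dv / du), (v 0%Z - dv / du * u 0%Z); split.
  + intros E0; apply Dv; replace dv with (dv / du * du) by (field; auto); rewrite E0; ring.
  + intros k; replace (v k) with ((du * v k - dv * u k + dv * u k) / du) by (field; auto).
    rewrite Hc; [field; auto|unfold du, dv; ring].
Qed.

Lemma affine_equiv_constant (u v : Z -> C) :
  affine_equiv u v -> (u 1%Z = u 0%Z <-> v 1%Z = v 0%Z).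
Proof.
intros (a & b & Ha & H); rewrite !H; split; intros E; [now rewrite E|].
apply Ceq_minus; destruct (Ceq_dec (u 1%Z - u 0%Z) 0) as [E'|E']; auto.
destruct (Cmult_neq_0 _ _ Ha E').
replace (a * (u 1%Z - u 0%Z)) with (a * u 1%Z + b - (a * u 0%Z + b)) by ring.
rewrite E; ring.
Qed.

Lemma centered_iff (res : C) (iota : I2 res) (u : Z -> C) :
  I2_class iota u -> (centered iota <-> u 1%Z = u 0%Z).
Proof.
destruct (I2_classP res iota) as (v & Hv & Hcl).
intros Hu; apply Hcl in Hu; destruct Hu as [Hu Hvu]; apply affine_equiv_constant in Hvu.
split.
- intros (w & Hw & Hconst); apply Hcl in Hw; destruct Hw as [_ Hvw].
  apply affine_equiv_constant in Hvw; apply Hvu, Hvw, Hconst.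
- intros E; exists u; split.
  + apply Hcl; split; auto; apply (U2_affine_equiv res); auto.
  + intros k l; now rewrite (U2_constant _ _ Hu E k), (U2_constant _ _ Hu E l).
Qed.

Lemma I2_class_intro (res : C) (iota : I2 res) (u : Z -> C) :
  U2 res u -> (centered iota <-> u 1%Z = u 0%Z) -> I2_class iota u.
Proof.
destruct (I2_classP res iota) as (v & Hv & Hcl).
intros Hu H; apply Hcl; split; auto; apply (U2_affine_equiv res); auto.
assert (Hv' : I2_class iota v).
{ apply Hcl; split; auto; exists 1, 0; split; [apply C1_nz|]; intros k; ring. }
rewrite <- H; symmetry; now apply centered_iff.
Qed.

(** * Realizations by model connections and lower bounds *)

Lemma integer_ge_INR (m : nat) (z : C) :
  integer_ge (Z.of_nat m) z <-> exists n, z - RtoC (INR m) = RtoC (INR n).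
Proof.
split.
- intros (k & Hk & ->); exists (Z.to_nat (k - Z.of_nat m)).
  rewrite <- RtoC_minus, !INR_IZR_INZ, Z2Nat.id, minus_IZR by lia; reflexivity.
- intros [n E]; exists (Z.of_nat m + Z.of_nat n)%Z; split; [lia|].
  rewrite plus_IZR, <- !INR_IZR_INZ, RtoC_plus, <- E; ring.
Qed.

(** For [k = 0] the model has the one-pole form with [beta = 0], so the general criteria decide
    without computing its asymptotic values. *)
Lemma model_centered (nabla : connection) (res : C) (u : Z -> C) :
  principal_part (christoffel nabla infty) 0 2 (fun j => if Nat.eqb j 2 then RtoC 1 else - res) ->
  (forall w : C, w <> 0 -> christoffel nabla infty w = 1 / w ^ 2 - res / w) ->
  asymptotic_family (christoffel nabla infty) u -> U2 res u ->
  (u 1%Z = u 0%Z <-> integer_ge 2 res).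
Proof.
intros Hpp Hform Hu HU.
assert (HG : one_pole_form (christoffel nabla infty) 1 res 0 1).
{ split; [apply C1_nz|split; [lra|]]; intros x Hx _; rewrite Hform by auto.
  unfold Cdiv; ring. }
assert (Ha : forall b, principal_part (christoffel nabla infty) 0 2 b -> b 2%nat = 1).
{ intros b Hb; exact (principal_part_unique _ _ _ _ _ _ Hb Hpp 2%nat ltac:(lia)). }
rewrite (integer_ge_INR 2); replace (RtoC (INR 2)) with (RtoC 2) by (f_equal; simpl; ring).
split.
- intros E; apply (one_pole_constant_integer _ _ _ _ _ _ HG Ha Hu).
  exact (U2_constant _ _ HU E).
- intros [n E]; apply (one_pole_integer_constant _ _ _ _ _ _ n HG Ha Hu).
  rewrite <- E; ring.
Qed.

(** Uses [k = 0]: developing maps have derivative [z ^ (res - 2) * exp (- z)], and the simple pole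
    at 0 disappears exactly when [res = 2]. *)
Lemma model_realizes_few (res : C) (iota : I2 res) :
  (centered iota <-> integer_ge 2 res) ->
  (res = 2 -> realizable res iota 0) /\ (res <> 2 -> realizable res iota 1).
Proof.
intros Hiota.
destruct (model_connection res 1 0 C1_nz)
  as (nabla & Hp & Hres & Hp0 & _ & Hpoles & Hpp & Hform).
destruct (entire_primitive _ (model_density_entire res 1 0)) as [phi Hphi].
destruct (model_family nabla res 1 0 phi C1_nz Hpp Hform Hphi) as (u & b & Hu & _ & _ & Hrec).
assert (HU : U2 res u) by (exists b; exact Hrec).
assert (Hdouble : double_pole nabla infty res iota).
{ split; [exact Hp|split; [exact Hres|]]; exists u; split; [exact Hu|].
  apply I2_class_intro; auto; rewrite Hiota; symmetry.
  apply (model_centered nabla); auto.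
  intros w Hw; rewrite Hform by auto; simpl (INR 0); unfold Cdiv; ring. }
simpl (INR 0) in *; split; intros Hr.
- exists nabla, infty, nil; split; [exact Hdouble|].
  split; [constructor|split; [reflexivity|split; [tauto|split; [simpl; tauto|]]]].
  intros [s|] n Hn; [|auto]; exfalso.
  destruct (Hpoles s n Hn) as [[_ H]|[_ H]]; apply H; auto; rewrite Hr; ring.
- exists nabla, infty, (fin 0 :: nil); split; [exact Hdouble|].
  split; [repeat constructor; simpl; tauto|split; [reflexivity|split; [|split]]].
  + simpl; intros [E|[]]; discriminate.
  + intros q [<-|[]]; apply Hp0; intros E; apply Hr.
    replace res with (res - 2 + 2) by ring; rewrite E; ring.
  + intros [s|] n Hn; [|auto]; right; simpl.
    destruct (Hpoles s n Hn) as [[-> _]|[_ H]]; [auto|now destruct H].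
Qed.

(** The condition on [iota] involves the values at 0 and 1 only, and provides the relations that
    determine them, so each example has little more than [b] to find. *)
Lemma model_realizes_two (res c : C) (k : nat) (iota : I2 res) (phi : C -> C) :
  c <> 0 -> k <> 0%nat -> res - 2 <> RtoC (INR k) ->
  (forall zeta, is_Cderive phi zeta (model_density res c k zeta)) ->
  (forall u b, strip_limit phi 0 (u 0%Z) ->
    (forall zeta, phi (zeta + period) = multiplier res * phi zeta + b) ->
    u 1%Z = multiplier res * u 0%Z + b -> (centered iota <-> u 1%Z = u 0%Z)) ->
  realizable res iota 2.
Proof.
intros Hc Hk Hrk Hphi Hiota.
destruct (model_connection res c k Hc)
  as (nabla & Hp & Hres & Hp0 & Hpc & Hpoles & Hpp & Hform).
destruct (model_family nabla res c k phi Hc Hpp Hform Hphi) as (u & b & Hu & H0 & Hb & Hrec).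
assert (HU : U2 res u) by (exists b; exact Hrec).
exists nabla, infty, (fin 0 :: fin c :: nil); split.
{ split; [exact Hp|split; [exact Hres|]]; exists u; split; [exact Hu|].
  apply I2_class_intro; auto; apply (Hiota u b); auto; exact (Hrec 0%Z). }
split; [|split; [reflexivity|split; [|split]]].
- repeat constructor; simpl; [intros [E|[]]; congruence|tauto].
- simpl; intros [E|[E|[]]]; discriminate.
- intros q [<-|[<-|[]]]; auto.
- intros [s|] n Hn; [|auto]; right; simpl.
  destruct (Hpoles s n Hn) as [[-> _]|[-> _]]; auto.
Qed.

Lemma model_realizes_two_centered (res : C) (iota : I2 res) :
  ~ integer_ge 2 res -> centered iota -> realizable res iota 2.
Proof.
intros Hint Hiota.
assert (Hne : forall n, res - 2 <> RtoC (INR n)).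
{ intros n E; apply Hint, (integer_ge_INR 2); exists n; rewrite <- E.
  do 2 f_equal; simpl; ring. }
(* [z ^ (res - 2) * exp (- z)], which tends to [0] along every asymptotic direction *)
set (phi := fun zeta => Cexp (- Cexp (- zeta) + (2 - res) * zeta)).
assert (Hphi : forall zeta, is_Cderive phi zeta (model_density res (res - 2) 1 zeta)).
{ intros zeta; eapply is_Cderive_eq.
  - unfold phi; Cderive.
  - unfold model_density.
    replace (- Cexp (- zeta) + (2 - res) * zeta) with
      (zeta + (- Cexp (- zeta) + (1 - res) * zeta)) by ring.
    rewrite (Cexp_plus zeta), Cpow_1_r.
    assert (E : Cexp zeta * Cexp (- zeta) = 1)
      by (rewrite Cexp_opp; apply Cinv_r, Cexp_neq_0).
    set (y := Cexp zeta) in *; set (z := Cexp (- zeta)) in *.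
    set (X := Cexp (- z + (1 - res) * zeta)).
    cbv beta; replace (y * X * (- (z * - (1)) + (0 * zeta + (2 - res) * 1))) with
      (X * (y * z + (2 - res) * y)) by ring.
    rewrite E; ring. }
apply (model_realizes_two res (res - 2) 1 iota phi); auto.
- exact (Hne 0%nat).
- intros u b H0 Hb E.
  (* Up to a shift of [res] by 1, which leaves the multiplier unchanged, this primitive is itself a
     density; its period and its decay are thus already known. *)
  assert (Hphi1 : forall zeta, phi zeta = model_density (res - 1) 1 0 zeta).
  { intros zeta; unfold phi, model_density; simpl; rewrite Cmult_1_r; f_equal; ring. }
  assert (Hb0 : b = 0).
  { specialize (Hb 0); rewrite !Hphi1, model_density_period in Hb.
    replace (multiplier (res - 1)) with (multiplier res) in Hb.
    - replace b with (multiplier res * model_density (res - 1) 1 0 0 + b -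
        multiplier res * model_density (res - 1) 1 0 0) by ring.
      rewrite <- Hb; ring.
    - unfold multiplier.
      replace (- (2 * RtoC PI * Ci * (res - 1))) with
        (2 * RtoC PI * Ci + - (2 * RtoC PI * Ci * res)) by ring.
      rewrite Cexp_plus, Cexp_2PI; ring. }
  assert (Hu0 : u 0%Z = 0).
  { apply (strip_limit_unique phi 0); auto; intros e He.
    destruct (model_density_bound (res - 1) 1 0) as [K HK].
    set (K' := (Rabs K + 1)%R); assert (HK' : 0 < K') by (unfold K'; pose proof (Rabs_pos K); lra).
    exists (Rmin 0 (ln (e / K'))); intros zeta Hz Him; rewrite Rminus_0_r in Him.
    replace (phi zeta - 0) with (model_density (res - 1) 1 0 zeta) by (rewrite Hphi1; ring).
    destruct (Rmin_Rgt_l _ _ _ Hz) as [Z1 Z2].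
    assert (Hq : 0 < e / K') by (apply Rdiv_lt_0_compat; lra).
    apply exp_increasing in Z2; rewrite exp_ln in Z2 by auto.
    eapply Rle_lt_trans; [apply HK; auto; lra|].
    assert (e / K' * K' = e)%R by (field; lra).
    assert (K < K') by (unfold K'; pose proof (Rle_abs K); lra).
    pose proof (exp_pos (Re zeta)); nra. }
  rewrite E, Hb0, Hu0; split; [intros _; ring|auto].
Qed.

Lemma model_realizes_two_noncentered (res : C) (iota : I2 res) :
  integer_ge 2 res -> ~ centered iota -> realizable res iota 2.
Proof.
intros Hint Hiota.
apply (integer_ge_INR 2) in Hint; destruct Hint as [n Hn].
replace (RtoC (INR 2)) with (RtoC 2) in Hn by (f_equal; simpl; ring).
assert (Hres : res = RtoC (INR n) + 2) by (rewrite <- Hn; ring).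
(* With multiplier 1, [u 1 - u 0 = b], so it remains to see that [b] is nonzero. *)
assert (Hmu : multiplier res = 1).
{ unfold multiplier; rewrite Cexp_opp.
  replace (2 * RtoC PI * Ci * res) with (RtoC (INR (n + 2)) * (2 * RtoC PI * Ci)).
  - rewrite <- Cexp_pow, Cexp_2PI, Cpow_1_l; field; apply C1_nz.
  - rewrite Hres, plus_INR, RtoC_plus; replace (INR 2) with 2%R by (simpl; ring); ring. }
(* For [k = n + 1] the exponent [res - 2 - k] is -1: the derivative of the developing map in [z] has
   a simple pole at 0. *)
destruct (entire_primitive _ (model_density_entire res 1 (S n))) as [phi Hphi].
assert (Hc : forall zeta, Ccont (model_density res 1 (S n)) zeta)
  by (intros; apply entire_cont, model_density_entire).
apply (model_realizes_two res 1 (S n) iota phi C1_nz); auto.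
- rewrite Hn; intros E; apply RtoC_inj, INR_eq in E; lia.
- intros u b _ Hb Hrec.
  rewrite Hmu, Cmult_1_l in Hrec.
  split; [tauto|]; intros E; exfalso.
  assert (Hb0 : b = 0).
  { replace b with (u 0%Z + b - u 0%Z) by ring; rewrite <- Hrec, E; ring. }
  (* [u 1 - u 0] is the integral of [g z / z] around [0], that is [2 i PI g 0] up to sign *)
  pose (g := fun z => Cexp (- z) * (z - 1) ^ S n).
  assert (Hg : entire g).
  { intros z; unfold g; eexists; Cderive. }
  assert (Hgd : forall zeta, model_density res 1 (S n) zeta = g (0 + Cexp (- zeta))).
  { intros zeta; unfold model_density, g; rewrite Cplus_0_l.
    replace ((1 - res) * zeta) with (RtoC (INR (S n)) * - zeta)
      by (rewrite Hres, S_INR, RtoC_plus; ring).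
    rewrite Cexp_plus, <- Cexp_pow, <- Cmult_assoc, <- Cpow_mult_l; f_equal; f_equal.
    rewrite Cexp_opp; field; apply Cexp_neq_0. }
  pose proof (mean_value_property g 0 0 Hg) as Hmean.
  rewrite (CInt_ext _ (fun y => model_density res 1 (S n) (0, y)%R)) in Hmean
    by (intros; now rewrite Hgd).
  pose proof (CInt_v_primitive phi _ 0 0 (2 * PI) Hc Hphi) as Hint.
  rewrite Hmean in Hint.
  specialize (Hb (0, 0)%R); rewrite pair_period, Rplus_0_l, Hmu, Hb0 in Hb.
  rewrite Hb in Hint.
  pose proof PI_RGT_0.
  assert (Hg0 : g 0 <> 0).
  { unfold g; apply Cmult_neq_0; [apply Cexp_neq_0|apply Cpow_nz].
    intros E0; apply C1_nz; replace (RtoC 1) with (- (0 - 1)) by ring; rewrite E0; ring. }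
  assert (Hnz : Ci * (RtoC (2 * PI) * g 0) <> 0).
  { apply Cmult_neq_0; [apply Ci_nz|apply Cmult_neq_0; [|exact Hg0]].
    intros E0; apply RtoC_inj in E0; lra. }
  apply Hnz; rewrite Hint; ring.
Qed.

(** Source of all the lower bounds: with at most one simple pole, [res] decides whether the
    invariant is centered; with none, the sum of the residues forces [res = 2]. *)
Lemma realizable_at_most_one (res : C) (iota : I2 res) (t : nat) :
  realizable res iota t -> (t <= 1)%nat ->
  (centered iota <-> integer_ge 2 res) /\ (t = 0%nat -> res = 2).
Proof.
intros (nabla & p & l & (Hp & Hres & u & Hu & Hcl) & _ & Hl & Hpl & Hsimple & Hpoles) Ht.
destruct (at_most_one_simple_pole nabla p l res Hp Hres ltac:(lia) Hpl Hsimple Hpoles)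
  as (a & beta & rho & HG & Ha & Hnil).
assert (HU : U2 res u).
{ destruct (I2_classP res iota) as (v & _ & H); now apply H. }
split.
- rewrite (centered_iff res iota u Hcl), (integer_ge_INR 2).
  replace (RtoC (INR 2)) with (RtoC 2) by (f_equal; simpl; ring).
  split.
  + intros E; apply (one_pole_constant_integer _ _ _ _ _ _ HG Ha Hu).
    exact (U2_constant _ _ HU E).
  + intros [n E]; apply (one_pole_integer_constant _ _ _ _ _ _ n HG Ha Hu).
    rewrite <- E; ring.
- intros ->; apply Hnil; destruct l; [reflexivity|discriminate].
Qed.

Lemma integer_ge_3 (res : C) : integer_ge 3 res -> integer_ge 2 res /\ res <> 2.
Proof.
intros (n & Hn & ->); split; [exists n; split; [lia|reflexivity]|].
intros E; apply RtoC_inj, eq_IZR in E; lia.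
Qed.

Theorem theorem7p3 (res : C) (iota : I2 res) :
  (res = RtoC 2 -> centered iota ->
     is_minimum (realizable res iota) 0) /\
  (integer_ge 3 res -> centered iota ->
     is_minimum (realizable res iota) 1) /\
  (~ integer_ge 2 res -> ~ centered iota ->
     is_minimum (realizable res iota) 1) /\
  (integer_ge 2 res -> ~ centered iota ->
     is_minimum (realizable res iota) 2) /\
  (~ integer_ge 2 res -> centered iota ->
     is_minimum (realizable res iota) 2).
Proof.
assert (H2 : res = 2 -> integer_ge 2 res)
  by (intros ->; exists 2%Z; split; [lia|reflexivity]).
split; [|split; [|split; [|split]]].
- intros Hres Hc; split; [|intros; lia].
  apply (model_realizes_few res iota); auto; tauto.
- intros H3 Hc; apply integer_ge_3 in H3; destruct H3 as [Hint Hres]; split.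
  + apply (model_realizes_few res iota); auto; tauto.
  + intros [|t] Ht; [|lia].
    destruct (realizable_at_most_one _ _ _ Ht ltac:(lia)) as [_ H]; tauto.
- intros Hint Hc; split.
  + apply (model_realizes_few res iota); tauto.
  + intros [|t] Ht; [|lia].
    destruct (realizable_at_most_one _ _ _ Ht ltac:(lia)) as [_ H]; tauto.
- intros Hint Hc; split; [now apply model_realizes_two_noncentered|].
  intros t Ht; destruct (Nat.le_gt_cases t 1) as [Hle|]; [|lia].
  destruct (realizable_at_most_one _ _ _ Ht Hle) as [H _]; tauto.
- intros Hint Hc; split; [now apply model_realizes_two_centered|].
  intros t Ht; destruct (Nat.le_gt_cases t 1) as [Hle|]; [|lia].
  destruct (realizable_at_most_one _ _ _ Ht Hle) as [H _]; tauto.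
Qed.
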